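(* Let $f\in D(A^{1/2})$, $f\ne0$, and let $u$ be a Leray–Hopf solution of the space-periodic Navier–Stokes equations with force $f$ and $u\in\mathcal{A}_w$ (the weak global attractor). Put $$c_1=\frac{2C_0}{\pi^2},\quad \sigma_f=\frac{2\gamma_f^2\nu^2}{c_\eta C_A}\frac{\|f\|^{1/2}}{\|A^{1/2}f\|^{1/2}}\frac{\|f\|^2}{\|A^{-1/2}f\|^2},\quad \theta_f=\frac{c_\eta}{4C_A}\frac1{R_0^{5/2}}\frac{\|A^{-1/2}f\|^2}{\|f\|^{3/2}\|A^{1/2}f\|^{1/2}},$$ where $\gamma_f=\frac{C_0}{\nu T}\frac{\|A^{-1}f\|}{\|f\|}+1$ and $c_\eta=\frac1T\int_0^T\eta\,dt$. Assume $$\|f\|\ge\sigma_f,\qquad T\ge c_1\frac{R_0^2}{\nu},$$ and that there is a constant $K>0$ such that $$K\,\frac{e_0^{3/2}}{R_0}\le\varepsilon_0\le\frac{2\sqrt2}{\theta_f}\,\frac{e_0^{3/2}}{R_0}.$$ Then $$\frac{K^{3/2}\theta_f^{3/2}}{8^{1/4}}\,\frac{\|f\|}{R_0^{3/2}}\,e_0^{1/2}\le\varepsilon_0\le2\sqrt2\,\frac{\|f\|}{R_0^{3/2}}\,e_0^{1/2},$$ $$\theta_f\,\frac{\|f\|}{R_0^{1/2}}\le e_0\le\frac{2\sqrt2}{K}\,\frac{\|f\|}{R_0^{1/2}},$$ and $$K\,\theta_f^{3/2}\,\frac{\|f\|^{3/2}}{R_0^{7/4}}\le\varepsilon_0\l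e\frac{8^{5/4}}{K^{3/2}\theta_f}\,\frac{\|f\|^{3/2}}{R_0^{7/4}}.$$
   Context: Setting. $\nu>0$, $R_0>0$, $L=4R_0$, $\Omega=[0,L]^3$; $f$ is $\Omega$-periodic, divergence-free, time-independent, with zero average. $\|\cdot\|$ and $(\cdot,\cdot)$ are the $L^2(\Omega)$ norm and inner product. $H$ is the space of $\Omega$-periodic, divergence-free, zero-average $L^2$ vector fields; $A=-\Delta$ is the Stokes operator on $H$ (positive-definite, self-adjoint, with compact inverse, so its powers are defined); $V=D(A^{1/2})$ with dual $V'$; $B(u,v)=P_L((u\cdot\nabla)v)$ with $P_L$ the Leray projector, so $(B(u,v),w)=\int_\Omega(u\cdot\nabla v)\cdot w$. A Leray–Hopf solution is $u\in L^\infty([0,\infty),H)\cap L^2_{loc}((0,\infty),V)$ satisfying $u_t+\nu Au+B(u,u)=f$ in $V'$, i.e. $(u,v)_t+\nu(A^{1/2}u,A^{1/2}v)-(B(u,v),u)=(f,v)$ in the sense of distributions in time for all $v\in V$, and the energy inequality $\nu\int_{t_0}^{t_1}\|\nabla u\|^2\le\frac{\|u(t_0)\|^2}{2}-\frac{\|u(t_1)\|^2}{2}+\int_{t_0}^{t_1}(f,u)$ for a.e. $t_0$ and all $t_1\ge t_0$. Such solutions also satisfy $\nu\int_0^T\eta\|\nabla u\|^2\le\int_0^T\eta_t\frac{\|u\|^2}{2}+\int_0^T\eta(f,u)$ for the time cut-offs $\eta$ below. The weak global attractor $\mathcal{A}_w\subset H$ is the set of all values of Leray–Hopf solutions that exist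 for all times (forward and backward) and are bounded in $H$; $u\in\mathcal{A}_w$ means $u(t)\in\mathcal{A}_w$ for all $t$ considered. Constants and cut-off. $C_0>0$, $\delta\in(1/2,1)$ are fixed, $T>0$, and $\eta\not\equiv0$ is a fixed refined time cut-off: smooth, $0\le\eta\le1$, $\mathrm{Supp}(\eta)\subseteq[0,T]$, $|\eta'|\le\frac{C_0}{T}\eta^\delta$. $C_A$ is a constant in the Agmon inequality $\|w\|_{\infty}\le C_A\|A^{1/2}w\|^{1/2}\|Aw\|^{1/2}$, valid for all zero-average $\Omega$-periodic $H^2$ functions $w$ (scalar-, vector- or matrix-valued, with Euclidean pointwise norm, $A=-\Delta$). Global energy and total (viscous plus anomalous) dissipation rate: $$e_0=\frac1T\frac1{R_0^3}\int_0^T\eta^\delta\frac{\|u\|^2}{2}\,dt,\qquad \varepsilon_0=\frac1T\frac1{R_0^3}\nu\int_0^T\eta\|\nabla u\|^2\,dt+\varepsilon_\infty,$$ where $\varepsilon_\infty\ge0$ is such that $\varepsilon_0=\frac1T\frac1{R_0^3}\int_0^T\eta_t\frac{\|u\|^2}{2}\,dt+\frac1T\frac1{R_0^3}\int_0^T\eta(f,u)\,dt$. *)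

(* Defs.v *)
From HB Require Import structures.
From mathcomp Require Import all_boot all_order all_algebra.
From mathcomp Require Import all_classical all_reals all_analysis.
Set Implicit Arguments.
Unset Strict Implicit.
Unset Printing Implicit Defensive.
Import Order.TTheory GRing.Theory Num.Theory.
Import numFieldTopology.Exports numFieldNormedType.Exports.
Local Open Scope classical_set_scope.
Local Open Scope ring_scope.

Notation point3 R := (R * R * R)%type.

(* The same type, with the Borel structure carried by [lebesgue_measure]. *)
Notation mpoint3 R :=
  (measurableTypeR R * measurableTypeR R * measurableTypeR R)%type.

(* A field with values in R^I: I = unit for scalars, 'I_3 for vectors and
   'I_3 * 'I_3 for matrices, always with the Euclidean pointwise norm.  Fields
   are representatives; the L^2 notions below only depend on the a.e. class. *)
Definition field (R : realType) (I : finType) := I -> point3 R -> R.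
Notation vfield R := (field R 'I_3).

Definition coord3 (R : realType) (j : 'I_3) (x : point3 R) : R :=
  match val j with 0%N => x.1.1 | 1%N => x.1.2 | _ => x.2 end.

Definition shift3 (R : realType) (j : 'I_3) (h : R) (x : point3 R) : point3 R :=
  match val j with
  | 0%N => (x.1.1 + h, x.1.2, x.2)
  | 1%N => (x.1.1, x.1.2 + h, x.2)
  | _ => (x.1.1, x.1.2, x.2 + h)
  end.

Definition lebesgue3 (R : realType) : {measure set (mpoint3 R) -> \bar R} :=
  ((@lebesgue_measure R \x @lebesgue_measure R) \x @lebesgue_measure R)%E.

Definition box3 (R : realType) (L : R) : set (point3 R) :=
  (`[0, L] `*` `[0, L]) `*` `[0, L].

Definition periodic3 (R : realType) (L : R) (phi : point3 R -> R) :=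
  forall j x, phi (shift3 j L x) = phi x.

Section L2.
Variables (R : realType) (L : R) (I : finType).
Implicit Types w z : field R I.

Definition L2per w :=
  forall i, [/\ periodic3 L (w i), measurable_fun [set: mpoint3 R] (w i) &
    (lebesgue3 R).-integrable (box3 L) (EFin \o (fun x => w i x ^+ 2))].

Definition ip w z : R :=
  \int[lebesgue3 R]_(x in box3 L) \sum_i (w i x * z i x).

Definition L2norm w : R := Num.sqrt (ip w w).

Definition euclid w (x : point3 R) : R := Num.sqrt (\sum_i w i x ^+ 2).

Definition Linfnorm w : \bar R :=
  'N[lebesgue3 R]_+oo [EFin \o (euclid w \_ (box3 L))].

Definition L2per0 w :=
  L2per w /\ forall i, \int[lebesgue3 R]_(x in box3 L) w i x = 0.

Definition ae_zero w :=
  {ae lebesgue3 R, forall x, box3 L x -> forall i, w i x = 0}.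

End L2.

(* Powers of A = -Δ on zero-average periodic fields, by the spectral
   decomposition: the real eigenfunctions are the cosines and sines of
   (2π/L) k·x, k in Z^3, with eigenvalue (2π/L)^2 |k|^2.  On periodic
   divergence-free fields this is the Stokes operator. *)
Section StokesPowers.
Variables (R : realType) (L : R).

Definition phase (k : 'I_3 -> int) (x : point3 R) : R :=
  2 * pi / L * \sum_j (k j)%:~R * coord3 j x.

Definition eigval (k : 'I_3 -> int) : R :=
  (2 * pi / L) ^+ 2 * \sum_j (k j)%:~R ^+ 2.

Definition is_Apow (I : finType) (s : R) (w z : field R I) :=
  L2per0 L z /\
  forall i k,
    \int[lebesgue3 R]_(x in box3 L) (z i x * cos (phase k x)) =
      eigval k `^ s * \int[lebesgue3 R]_(x in box3 L) (w i x * cos (phase k x)) /\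
    \int[lebesgue3 R]_(x in box3 L) (z i x * sin (phase k x)) =
      eigval k `^ s * \int[lebesgue3 R]_(x in box3 L) (w i x * sin (phase k x)).

Definition domA (I : finType) (s : R) (w : field R I) :=
  L2per0 L w /\ exists z, is_Apow s w z.

(* Determined up to a null set, and meaningful only on [domA s]. *)
Definition Apow (I : finType) (s : R) (w : field R I) : field R I :=
  get (is_Apow s w).

End StokesPowers.

Section Derivatives.
Variables (R : realType) (L : R).
Implicit Types phi : point3 R -> R.

Definition partial (j : 'I_3) phi (x : point3 R) : R :=
  derive1 (fun h : R => phi (shift3 j h x)) 0.

(* C^oo: all iterated partial derivatives exist and are continuous. *)
Definition smooth3 phi :=
  forall s : seq 'I_3, let psi := foldr partial phi s in
    continuous psi /\
    forall j x, derivable (fun h : R => psi (shift3 j h x)) 0 1.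

Definition is_wpartial (j : 'I_3) (g dg : point3 R -> R) :=
  L2per L (fun _ : unit => dg) /\
  forall phi, smooth3 phi -> periodic3 L phi ->
    \int[lebesgue3 R]_(x in box3 L) (g x * partial j phi x) =
    - \int[lebesgue3 R]_(x in box3 L) (dg x * phi x).

(* Weak derivative, determined up to a null set and meaningful only for
   functions that have one in L^2. *)
Definition wpartial (j : 'I_3) (g : point3 R -> R) : point3 R -> R :=
  get (is_wpartial j g).

Definition grad (v : vfield R) : field R ('I_3 * 'I_3)%type :=
  fun ij => wpartial ij.2 (v ij.1).

Definition div_free (v : vfield R) :=
  forall phi, smooth3 phi -> periodic3 L phi ->
    \int[lebesgue3 R]_(x in box3 L) (\sum_j v j x * partial j phi x) = 0.

(* (B(u,v),w) = ∫ (u·∇)v · w; the Leray projector disappears when w is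
   divergence-free. *)
Definition trilinear (u v w : vfield R) : R :=
  ip L (fun i x => \sum_j u j x * grad v (i, j) x) w.

Definition inH (v : vfield R) := L2per0 L v /\ div_free v.

Definition inDA (s : R) (v : vfield R) := inH v /\ domA L s v.

Definition inV (v : vfield R) := inDA (1/2) v.

End Derivatives.

Definition agmon_constant (R : realType) (L CA : R) :=
  0 < CA /\
  forall (I : finType) (w : field R I), domA L 1 w ->
    (Linfnorm L w <= (CA * L2norm L (Apow L (1/2) w) `^ (1/2)
                         * L2norm L (Apow L 1 w) `^ (1/2))%:E)%E.

Section NavierStokes.
Variables (R : realType) (L nu : R) (f : vfield R).
Implicit Types u v : R -> vfield R.

Definition smooth (phi : R -> R) :=
  forall n t, derivable (derive1n n phi) t 1.

Definition supp (phi : R -> R) : set R := closure [set t | phi t != 0].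

Definition test_function (phi : R -> R) :=
  [/\ smooth phi, compact (supp phi) & supp phi `<=` `]0, +oo[ ].

Definition L2loc_V u :=
  {ae (@lebesgue_measure R), forall t, 0 < t -> inV L (u t)} /\
  forall a b, 0 < a -> a < b ->
    (\int[@lebesgue_measure R]_(t in `[a, b])
       (L2norm L (Apow L (1/2) (u t)) ^+ 2)%:E < +oo)%E.

(* u_t + νAu + B(u,u) = f in V', tested against v in V and distributionally in
   time, with (B(u,u),v) = -(B(u,v),u). *)
Definition weak_NSE u :=
  forall (v : vfield R) (phi : R -> R), inV L v -> test_function phi ->
    - (\int[@lebesgue_measure R]_(t in `]0, +oo[) (derive1 phi t * ip L (u t) v))
    + nu * (\int[@lebesgue_measure R]_(t in `]0, +oo[)
              (phi t * ip L (Apow L (1/2) (u t)) (Apow L (1/2) v)))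
    - \int[@lebesgue_measure R]_(t in `]0, +oo[) (phi t * trilinear L (u t) v (u t))
    = \int[@lebesgue_measure R]_(t in `]0, +oo[) (phi t * ip L f v).

Definition energy_inequality u :=
  {ae (@lebesgue_measure R), forall t0, 0 <= t0 -> forall t1, t0 <= t1 ->
    (nu%:E * \int[@lebesgue_measure R]_(t in `[t0, t1])
               (L2norm L (grad L (u t)) ^+ 2)%:E
     <= (L2norm L (u t0) ^+ 2 / 2 - L2norm L (u t1) ^+ 2 / 2
         + \int[@lebesgue_measure R]_(t in `[t0, t1]) ip L f (u t))%:E)%E}.

(* Values at every time refer to the weakly continuous representative, which
   every solution in L^oo(H) has; weak continuity also makes t |-> u t
   measurable, H being separable. *)
Record LerayHopf u : Prop := {
  LH_H : forall t, 0 <= t -> inH L (u t);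
  LH_weakly_continuous : forall v : vfield R, inH L v ->
    {within `[0, +oo[, continuous (fun t : R => ip L (u t) v)};
  LH_bounded : exists M : R,
    {ae (@lebesgue_measure R), forall t, 0 <= t -> L2norm L (u t) <= M};
  LH_L2V : L2loc_V u;
  LH_equation : weak_NSE u;
  LH_energy : energy_inequality u }.

(* A solution on the whole line: f does not depend on time, so it is enough
   that every time translate is a solution on [0, +oo[. *)
Definition complete_LerayHopf v :=
  forall s : R, LerayHopf (fun t => v (t + s)).

Definition weak_attractor : set (vfield R) :=
  [set h | exists v : R -> vfield R,
    [/\ complete_LerayHopf v,
        exists M : R, forall t, L2norm L (v t) <= M &
        exists t, h = v t]].

End NavierStokes.

Record time_cutoff (R : realType) (C0 delta T : R) (eta : R -> R) : Prop := {
  cutoff_smooth : smooth eta;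
  cutoff_range : forall t, 0 <= eta t <= 1;
  cutoff_supp : supp eta `<=` `[0, T];
  cutoff_derive : forall t, `|derive1 eta t| <= C0 / T * eta t `^ delta;
  cutoff_neq0 : exists t, eta t != 0 }.

Section Quantities.
Variables (R : realType) (R0 T nu delta : R) (eta : R -> R).
Variables (f : vfield R) (u : R -> vfield R).
Let L := 4 * R0.

Definition global_energy : R :=
  T^-1 * (R0 ^+ 3)^-1 *
  \int[@lebesgue_measure R]_(t in `[0, T])
    (eta t `^ delta * (L2norm L (u t) ^+ 2 / 2)).

Definition viscous_dissipation : R :=
  T^-1 * (R0 ^+ 3)^-1 *
  (nu * \int[@lebesgue_measure R]_(t in `[0, T])
          (eta t * L2norm L (grad L (u t)) ^+ 2)).

Definition energy_input : R :=
  T^-1 * (R0 ^+ 3)^-1 *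
    (\int[@lebesgue_measure R]_(t in `[0, T])
       (derive1 eta t * (L2norm L (u t) ^+ 2 / 2)))
  + T^-1 * (R0 ^+ 3)^-1 *
    \int[@lebesgue_measure R]_(t in `[0, T]) (eta t * ip L f (u t)).

End Quantities.

(* Main.v *)
(** Lower bound on the energy: testing the equation with [A^-1 f] and the
    cut-off [eta (t - h)] gives, through Agmon's inequality and Young's, an upper
    bound for [|A^(-1/2) f|^2 * \int eta] that is affine in the energy weighted by
    [eta (t - h) ^ delta]; as [h] tends to 0 this weighted energy is at most [e0]
    up to an arbitrarily small error.

    Upper bound on the dissipation: the energy input is at most
    [C0 / T * e0 + sqrt 2 * |f| * R0^(-3/2) * sqrt e0], and the first term is
    absorbed in the second because [|u(t)| <= |f| / (nu * (2 pi / L)^2)] on the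
    attractor and [T >= c1 * R0^2 / nu].

    The six estimates follow from these two and the two hypotheses relating
    [eps0] to [e0^(3/2)].

    The spectral definition of the powers of [A] and the weak derivatives are
    both read off the coefficients in the real orthonormal basis of Hartley
    functions [L^(-3/2) (cos + sin)], indexed by [Z^3], on which [d/dx_j] acts as
    [k -> -k] up to a scalar. *)

(* With [A^-1 f] as test field every term of the equation is controlled by [|u|] alone: the force
   gives [|A^(-1/2) f|^2], the viscous term collapses to [nu * (u, f)], and in the nonlinear term
   the derivative falls on [A^-1 f], whose gradient has the size of [A^(-1/2) f]. Agmon's inequality
   for that gradient asks for the norms of [f] and [A^(1/2) f], which explains the shape of
   [theta_f]. The terms from the time derivative and the viscosity are linear in [|u|], the
   nonlinear one is quadratic; [sigma_f <= |f|] is what lets Young's inequality spend only a quarter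
   of the left-hand side on the linear ones. The time shift is forced by the weak formulation: its
   test functions have compact support in the open half-line, whereas the support of [eta] may
   contain 0. In the upper bound the gradient of [u] is not estimated: [eps0] enters only through
   its equality with the energy input. The gradient matters only for the attractor bound, through
   Poincare's inequality. *)
Require Import Defs.
From HB Require Import structures.
From mathcomp Require Import all_boot all_order all_algebra.
From mathcomp Require Import all_classical all_reals all_analysis.
From mathcomp Require Import measurable_realfun ess_sup_inf ring lra.
Set Implicit Arguments.
Unset Strict Implicit.
Unset Printing Implicit Defensive.
Import Order.TTheory GRing.Theory Num.Theory.
Import numFieldTopology.Exports numFieldNormedType.Exports.
Local Open Scope classical_set_scope.
Local Open Scope ring_scope.

(* The integral of a nonnegative function is a supremum over simple functions
   below it, whether or not the function is measurable.  Inequalities between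
   such lower integrals suffice for [t |-> |u(t)|^2], whose measurability is
   never needed. *)
Section LowerIntegral.
Local Open Scope ereal_scope.
Context {d} {T : measurableType d} {R : realType}.
Variable mu : {measure set T -> \bar R}.
Implicit Types (f g : T -> \bar R) (D : set T).
Import HBNNSimple.

Lemma ge0_le_integral_nomeas D f g : (forall x, D x -> 0 <= f x) ->
  (forall x, D x -> f x <= g x) -> \int[mu]_(x in D) f x <= \int[mu]_(x in D) g x.
Proof.
move=> f0 fg.
have g0 x : D x -> 0 <= g x by move=> Dx; exact: le_trans (f0 _ Dx) (fg _ Dx).
rewrite !ge0_integralE//; apply: ereal_sup_le => _ [h hf <-]; exists h => // x.
apply: le_trans (hf x) _; rewrite !patchE; case: ifPn => // /set_mem; exact: fg.
Qed.

(** Lower integrals are in general only superadditive; the reverse inequality holds here because [g]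
    is measurable and finite. A simple function [h] below [f + g] is covered by [g] and the excess
    of [h] over [g], which is measurable and lies below [f]. *)
Lemma ge0_integralD_le_nomeas D f g : measurable D -> (forall x, D x -> 0 <= f x) ->
  (forall x, D x -> 0 <= g x) -> measurable_fun D g ->
  (forall x, D x -> g x < +oo) ->
  \int[mu]_(x in D) (f x + g x) <= \int[mu]_(x in D) f x + \int[mu]_(x in D) g x.
Proof.
move=> mD f0 g0 mg goo.
rewrite [leLHS]ge0_integralE; last by move=> x Dx; rewrite adde_ge0 ?f0 ?g0.
apply: ge_ereal_sup => _ [h hfg <-].
have -> : sintegral mu h = \int[mu]_(x in D) (h x)%:E.
  rewrite -integralT_nnsfun [RHS]integral_mkcond; apply: eq_integral => x _.
  rewrite patchE; case: ifPn => // xD; apply/eqP.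
  by have := hfg x; rewrite patchE (negbTE xD) eq_le => ->; rewrite lee_fin fun_ge0.
pose k x := maxe 0 ((h x)%:E - g x).
have mh : measurable_fun D (fun x => (h x)%:E) by apply/measurable_EFinP; apply: measurable_funTS.
have mk : measurable_fun D k.
  by apply: measurable_maxe => //; exact: emeasurable_funB.
apply: (@le_trans _ _ (\int[mu]_(x in D) (k x + g x))).
  apply: ge0_le_integral_nomeas => x Dx; first by rewrite lee_fin fun_ge0.
  have := g0 _ Dx; have := goo _ Dx; rewrite /k; case: (g x) => [r| |]// _ _.
  by rewrite -leeBlDr// le_max lexx orbT.
rewrite ge0_integralD//; last by move=> x _; rewrite le_max lexx.
rewrite leeD2r//; apply: ge0_le_integral_nomeas => x Dx; first by rewrite le_max lexx.
rewrite ge_max f0//=.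
have := hfg x; rewrite patchE mem_set// => hx.
by have := g0 _ Dx; have := goo _ Dx; case: (g x) hx => [r| |]//; rewrite leeBlDr.
Qed.

Lemma ge0_integralZl_nomeas D f (k : R) : (0 < k)%R -> (forall x, D x -> 0 <= f x) ->
  \int[mu]_(x in D) (k%:E * f x) = k%:E * \int[mu]_(x in D) f x.
Proof.
have sub (c : R) f' : (0 < c)%R -> (forall x, D x -> 0 <= f' x) ->
  c%:E * \int[mu]_(x in D) f' x <= \int[mu]_(x in D) (c%:E * f' x).
  move=> c0 f0; rewrite muleC -lee_pdivlMr//.
  rewrite ge0_integralE//; apply: ge_ereal_sup => _ [h hf <-].
  rewrite lee_pdivlMr// muleC -sintegralrM.
  rewrite [leRHS]ge0_integralE; last by move=> x Dx; apply: mule_ge0; [exact: ltW|exact: f0].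
  apply: ereal_sup_ubound; exists (scale_nnsfun h (ltW c0)) => // x.
  rewrite /= EFinM; have := hf x; rewrite !patchE; case: ifPn => // _ hx.
    by apply: lee_pmul => //; rewrite lee_fin ?fun_ge0 ?ltW.
  by rewrite -EFinM lee_fin pmulr_rle0.
move=> k0 f0; apply/eqP; rewrite eq_le sub// andbT.
(* The converse inequality is [sub] for the inverse of [k], applied to [k * f]. *)
rewrite muleC -lee_pdivrMr// muleC.
apply: le_trans (sub _ _ _ _) _ => //; first by rewrite invr_gt0.
  by move=> x Dx; apply: mule_ge0; [exact: ltW|exact: f0].
apply: ge0_le_integral_nomeas => x Dx.
  by apply: mule_ge0; [rewrite lee_fin invr_ge0 ltW|apply: mule_ge0; [exact: ltW|exact: f0]].
by rewrite muleA -EFinM mulVf ?gt_eqF// mul1e.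
Qed.

(** For any function the integral is the difference of the lower integrals of the positive and
    negative parts, and both of these lie between 0 and [B]. *)
Lemma le_abs_Rintegral_nomeas D (g : T -> R) (B : R) :
  \int[mu]_(x in D) `|(g x)%:E| <= B%:E -> (`| Rintegral mu D g | <= B)%R.
Proof.
move=> gB.
have p : 0 <= \int[mu]_(x in D) (EFin \o g)^\+ x <= B%:E.
  rewrite integral_ge0//=; apply: le_trans gB; apply: ge0_le_integral_nomeas => // x _.
  by rewrite funeposE /= -EFin_max lee_fin ge_max ler_norm normr_ge0.
have n : 0 <= \int[mu]_(x in D) (EFin \o g)^\- x <= B%:E.
  rewrite integral_ge0//=; apply: le_trans gB; apply: ge0_le_integral_nomeas => // x _.
  by rewrite funenegE /= -EFin_max lee_fin ge_max -normrN ler_norm normr_ge0.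
rewrite /Rintegral integralE.
case: (\int[mu]_(x in D) (EFin \o g)^\+ x) p => [p| |] // /andP[]; rewrite ?leNye ?leeNy_eq// !lee_fin => p0 pB.
case: (\int[mu]_(x in D) (EFin \o g)^\- x) n => [n| |] // /andP[]; rewrite ?leNye ?leeNy_eq// !lee_fin => n0 nB.
rewrite /= ler_norml; apply/andP; split; lra.
Qed.

End LowerIntegral.

(** * Square-integrable functions and orthonormal systems *)

Section SquareIntegrable.
Context {d} {T : measurableType d} {R : realType}.
Variables (mu : {measure set T -> \bar R}) (D : set T).
Hypothesis mD : measurable D.
Implicit Types (f g h : T -> R).

Definition sqint f := measurable_fun D f /\ mu.-integrable D (EFin \o (fun x => f x ^+ 2)).

Definition dot f g : R := \int[mu]_(x in D) (f x * g x).

Lemma sqint_mul f g : sqint f -> sqint g -> mu.-integrable D (EFin \o (fun x => f x * g x)).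
Proof.
move=> [mf f2] [mg g2].
apply: (@le_integrable _ _ _ mu D mD _ (EFin \o (fun x => f x ^+ 2 + g x ^+ 2))).
- by apply/measurable_EFinP; exact: measurable_funM.
- move=> x _ /=; rewrite lee_fin.
  rewrite [leRHS]ger0_norm ?addr_ge0 ?sqr_ge0//.
  by rewrite ler_norml; apply/andP; split; nra.
- rewrite (_ : _ \o _ = (EFin \o (fun x => f x ^+ 2)%R) \+ (EFin \o (fun x => g x ^+ 2)%R))%E//.
  exact: integrableD.
Qed.

Lemma sqintP f : measurable_fun D f -> (\int[mu]_(x in D) (f x ^+ 2)%:E < +oo)%E -> sqint f.
Proof.
move=> mf foo; split=> //; apply/integrableP; split.
  by apply/measurable_EFinP; exact: measurable_funX.
by under eq_integral do rewrite /= ger0_norm ?sqr_ge0//.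
Qed.

Lemma dotC f g : dot f g = dot g f.
Proof. by apply: eq_Rintegral => x _; rewrite mulrC. Qed.

Lemma eq_dot f f' g g' : {in D, f =1 f'} -> {in D, g =1 g'} -> dot f g = dot f' g'.
Proof. by move=> ff gg; apply: eq_Rintegral => x xD; rewrite ff// gg. Qed.

Lemma dot_ge0 f : 0 <= dot f f.
Proof. by apply: Rintegral_ge0 => x _; rewrite -expr2 sqr_ge0. Qed.

Lemma dot_sqE f : sqint f -> (\int[mu]_(x in D) (f x ^+ 2)%:E = (dot f f)%:E)%E.
Proof.
move=> [mf f2]; rewrite /dot /Rintegral.
under [in RHS]eq_integral do rewrite -expr2.
by rewrite fineK//; exact: integrable_fin_num f2.
Qed.

Lemma sqintZ a f : sqint f -> sqint (fun x => a * f x).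
Proof.
move=> [mf f2]; split; first exact: measurable_funM.
rewrite (_ : _ \o _ = fun x => ((a ^+ 2)%:E * (EFin \o (fun x => f x ^+ 2)%R) x)%E).
  exact: integrableZl.
by apply/funext => x /=; rewrite -EFinM exprMn.
Qed.

Lemma sqintD f g : sqint f -> sqint g -> sqint (fun x => f x + g x).
Proof.
move=> sf sg; have fg := sqint_mul sf sg; move: sf sg => [mf f2] [mg g2].
split; first exact: measurable_funD.
rewrite (_ : _ \o _ = (EFin \o (fun x => f x ^+ 2)%R) \+
  ((fun x => 2%:E * (EFin \o (fun x => f x * g x)%R) x) \+ (EFin \o (fun x => g x ^+ 2)%R)))%E.
  by apply: integrableD => //; apply: integrableD => //; exact: integrableZl.
by apply/funext => x /=; rewrite -EFinM -!EFinD; congr EFin; ring.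
Qed.

Lemma sqintB f g : sqint f -> sqint g -> sqint (fun x => f x - g x).
Proof.
move=> sf sg; rewrite (_ : (fun _ => _) = (fun x => f x + (-1) * g x)).
  by apply: sqintD => //; exact: sqintZ.
by apply/funext => x; rewrite mulN1r.
Qed.

Lemma sqint0 : sqint (fun=> 0).
Proof.
split; first exact: measurable_cst.
rewrite (_ : _ \o _ = cst 0%E); first exact: integrable0.
by apply/funext => x /=; rewrite expr0n.
Qed.

Lemma sqint_sum (I : Type) (r : seq I) (F : I -> T -> R) :
  (forall i, sqint (F i)) -> sqint (fun x => \sum_(i <- r) F i x).
Proof.
move=> sF; elim: r => [|i r IH].
  rewrite (_ : (fun _ => _) = fun=> 0); first exact: sqint0.
  by apply/funext => x; rewrite big_nil.
rewrite (_ : (fun _ => _) = fun x => F i x + \sum_(i <- r) F i x); first exact: sqintD.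
by apply/funext => x; rewrite big_cons.
Qed.

Lemma dotDl f g h : sqint f -> sqint g -> sqint h ->
  dot (fun x => f x + g x) h = dot f h + dot g h.
Proof.
move=> sf sg sh; rewrite -RintegralD//; [|exact: sqint_mul..].
by apply: eq_Rintegral => x _; rewrite mulrDl.
Qed.

Lemma dotZl a f g : sqint f -> sqint g -> dot (fun x => a * f x) g = a * dot f g.
Proof.
move=> sf sg; rewrite -RintegralZl//; last exact: sqint_mul.
by apply: eq_Rintegral => x _; rewrite mulrA.
Qed.

Lemma dotBl f g h : sqint f -> sqint g -> sqint h ->
  dot (fun x => f x - g x) h = dot f h - dot g h.
Proof.
move=> sf sg sh; rewrite -RintegralB//; [|exact: sqint_mul..].
by apply: eq_Rintegral => x _; rewrite mulrBl.
Qed.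

Lemma dotBr f g h : sqint f -> sqint g -> sqint h ->
  dot h (fun x => f x - g x) = dot h f - dot h g.
Proof. by move=> sf sg sh; rewrite dotC dotBl// !(dotC h). Qed.

Lemma dotDr f g h : sqint f -> sqint g -> sqint h ->
  dot h (fun x => f x + g x) = dot h f + dot h g.
Proof. by move=> sf sg sh; rewrite dotC dotDl// !(dotC h). Qed.

Lemma dotZr a f g : sqint f -> sqint g -> dot g (fun x => a * f x) = a * dot g f.
Proof. by move=> sf sg; rewrite dotC dotZl// dotC. Qed.

Lemma dot_suml (I : Type) (r : seq I) (F : I -> T -> R) g : (forall i, sqint (F i)) -> sqint g ->
  dot (fun x => \sum_(i <- r) F i x) g = \sum_(i <- r) dot (F i) g.
Proof.
move=> sF sg; elim: r => [|i r IH].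
  rewrite big_nil /dot.
  under eq_Rintegral do rewrite big_nil mul0r.
  by rewrite Rintegral_cst// mul0r.
rewrite big_cons -IH -dotDl//; last exact: sqint_sum.
by apply: eq_Rintegral => x _; rewrite big_cons.
Qed.

Lemma dot_CS f g : sqint f -> sqint g -> dot f g ^+ 2 <= dot f f * dot g g.
Proof.
move=> sf sg.
have q t : 0 <= dot f f - 2 * t * dot f g + t ^+ 2 * dot g g.
  have := dot_ge0 (fun x => f x - t * g x).
  rewrite dotBl ?dotBr//; try by [|exact: sqintZ|apply: sqintB => //; exact: sqintZ].
  rewrite !dotZl ?dotZr// ?(dotC g f); try by [|exact: sqintZ|apply: sqintB => //; exact: sqintZ].
  by move=> h; rewrite (_ : _ + _ = dot f f - t * dot f g - (t * dot f g - t * (t * dot g g)))//; ring.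
have [g0|g0] := eqVneq (dot g g) 0.
  suff -> : dot f g = 0 by rewrite g0 mulr0 expr0n.
  apply/eqP/negPn/negP => fg0.
  (* With [dot g g = 0] the quadratic is affine, and at this parameter it equals [-1]. *)
  have := q ((dot f f + 1) / (2 * dot f g)); rewrite g0 mulr0 addr0.
  rewrite [X in _ - X](_ : _ = dot f f + 1); first by rewrite opprD addrA subrr add0r oppr_ge0 ler10.
  by field.
have gp : 0 < dot g g by rewrite lt_neqAle eq_sym g0 dot_ge0.
have := q (dot f g / dot g g).
rewrite [X in 0 <= X](_ : _ = (dot f f * dot g g - dot f g ^+ 2) / dot g g); last by field.
by rewrite pmulr_lge0 ?invr_gt0// subr_ge0.
Qed.

End SquareIntegrable.

Lemma sum_halfpow (R : realType) n : \sum_(0 <= k < n) (2^-1 : R) ^+ k = 2 - 2 * 2^-1 ^+ n.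
Proof.
elim: n => [|n IH]; first by rewrite big_geq// expr0 mulr1 subrr.
by rewrite big_nat_recr//= IH exprS; field.
Qed.

(** By [|a| <= (2^-k + 2^k * a^2) / 2] the weighted squares control the sum of the absolute
    increments. Thus one integrable function built from squares yields pointwise convergence almost
    everywhere. *)
Lemma cvgn_weighted_squares (R : realType) (s : R^nat) (B : R) :
  (forall n, \sum_(0 <= k < n) 2 ^+ k * (s k.+1 - s k) ^+ 2 <= B) -> cvgn s.
Proof.
move=> sB.
suff /normed_cvg/cvg_ex[l cl] : cvgn [normed series (telescope s)].
  apply/cvg_ex; exists (s 0%N + l).
  under eq_cvg do rewrite (eq_sum_telescope s); apply: cvgD => //; exact: cvg_cst.
apply: nondecreasing_is_cvgn.
  apply/nondecreasing_seqP => n; rewrite /normed_series_of seriesEnat /= big_nat_recr//= lerDl; exact: normr_ge0.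

exists (1 + B / 2) => _ [n _ <-]; rewrite /series/=.
apply: (@le_trans _ _ (\sum_(0 <= k < n) (2^-1 ^+ k / 2 + 2 ^+ k * (s k.+1 - s k) ^+ 2 / 2))).
  apply: ler_sum => k _; rewrite /telescope /=.
  have p : 0 < 2 ^+ k :> R by rewrite exprn_gt0.
  rewrite exprVn -mulrDl ler_pdivlMr// -subr_ge0.
  rewrite -(real_normK (num_real (s k.+1 - s k))).
  set a := `|_|.
  rewrite (_ : _ + _ - _ = (2 ^+ k)^-1 * (1 - 2 ^+ k * a) ^+ 2); last by field; rewrite gt_eqF.
  by rewrite mulr_ge0 ?invr_ge0 ?sqr_ge0// ltW.
rewrite big_split/= -!mulr_suml lerD//; last by rewrite ler_pM2r.
by rewrite sum_halfpow ler_pdivrMr// mul1r gerBl mulr_ge0.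
Qed.

(** * Completeness of L2, Riesz-Fischer and Parseval *)

Section L2Limit.
Context {d} {T : measurableType d} {R : realType}.
Variables (mu : {measure set T -> \bar R}) (D : set T).
Hypothesis mD : measurable D.

Notation sqint := (sqint mu D).
Notation dot := (dot mu D).

(** A subsequence with [tau <= 4^-k] has increments whose squares, weighted by [2^k], form an
    integrable sum; hence it converges almost everywhere, and Fatou's lemma transfers the rate
    [tau N] to the limit for every [N], not only along the subsequence. *)
Lemma L2_limit (S : nat -> T -> R) (tau : R^nat) :
  (forall n, measurable_fun setT (S n)) -> (forall n, sqint (S n)) ->
  tau @ \oo --> (0 : R) ->
  (forall N m, (N <= m)%N -> dot (fun x => S m x - S N x) (fun x => S m x - S N x) <= tau N) ->
  exists w, [/\ measurable_fun setT w, sqint w,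
    (forall x y, (forall n, S n x = S n y) -> w x = w y) &
    forall N, dot (fun x => w x - S N x) (fun x => w x - S N x) <= tau N].
Proof.
move=> mS sS tau0 cS.
have /choice[N_ HN] : forall k, exists N, forall n, (N <= n)%N -> tau n <= 4^-1 ^+ k.
  move=> k.
  have /cvgrPdist_le /(_ (4^-1 ^+ k)) := tau0.
  case; first by rewrite exprn_gt0// invr_gt0.
  move=> N _ h; exists N => n /h /=; rewrite sub0r normrN; exact: le_trans (ler_norm _).
(* Summing the thresholds makes [phi] strictly increasing and at least [N_ k]; the successor gives
   [k <= phi k]. *)
pose phi k := (\sum_(0 <= i < k.+1) (N_ i).+1)%N.
have phiS k : (phi k.+1 = phi k + (N_ k.+1).+1)%N by rewrite /phi [LHS]big_nat_recr.
have phi_ge k : (k <= phi k)%N.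
  elim: k => // k IH; rewrite phiS addnS ltnS; apply: (leq_trans IH); exact: leq_addr.
have phiN k : (N_ k <= phi k)%N.
  by rewrite /phi big_nat_recr//=; apply: leq_trans (leq_addl _ _).
pose D_ k x := S (phi k.+1) x - S (phi k) x.
have sD k : sqint (D_ k) by exact: sqintB.
have mD_ k : measurable_fun setT (D_ k) by exact: measurable_funB.
pose t k x := (2 ^+ k * D_ k x ^+ 2)%:E.
have t0 k x : (0 <= t k x)%E by rewrite lee_fin; apply: mulr_ge0; [exact: exprn_ge0|exact: sqr_ge0].
have mt k : measurable_fun setT (t k).
  by apply/measurable_EFinP; apply: measurable_funM => //; exact: measurable_funX.
pose H x := (\sum_(k <oo) t k x)%E.
have mH : measurable_fun D H.
  by apply: ge0_emeasurable_sum => // k _; apply: measurable_funTS.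
have Hint : mu.-integrable D H.
  apply/integrableP; split=> //.
  under eq_integral do rewrite gee0_abs ?nneseries_ge0//.
  rewrite integral_nneseries//; last by move=> n; exact: measurable_funTS.
  apply: (@le_lt_trans _ _ (\sum_(k <oo) ((2^-1 : R) ^+ k)%:E)%E).
    apply: lee_nneseries => [k _ _|k _]; first by apply: integral_ge0.
    rewrite /t; under eq_integral do rewrite EFinM.
    rewrite ge0_integralZl//; last 2 first.
      by apply/measurable_EFinP/measurable_funX; exact: measurable_funTS.
      by move=> x _; rewrite lee_fin sqr_ge0.
    rewrite dot_sqE// -EFinM lee_fin.
    apply: (@le_trans _ _ (2 ^+ k * 4^-1 ^+ k)); last first.
      have e : 2 * 4^-1 = 2^-1 :> R by field.
      by rewrite -exprMn e.
    rewrite ler_pM2l ?exprn_gt0//.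
    apply: le_trans (HN k _ (phiN k)); apply: cS; rewrite phiS; exact: leq_addr.
  apply: (@le_lt_trans _ _ 2%:E); last exact: ltry.
  apply: lime_le.
    by apply: is_cvg_nneseries => n _ _; rewrite lee_fin exprn_ge0// invr_ge0.
  by apply: nearW => k; rewrite sumEFin sum_halfpow lee_fin gerBl mulr_ge0// exprn_ge0// invr_ge0.
(* The upper limit is taken at every point, without an exceptional set: [w] is measurable everywhere
   and [w x] depends only on the values [S n x]. *)
pose w x := fine (limn_esup (fun k => (S (phi k) x)%:E)).
have mw : measurable_fun setT w.
  apply: measurableT_comp => //; apply: measurable_fun_limn_esup => k.
  exact/measurable_EFinP.
have wcvg x : (H x \is a fin_num) -> S (phi k) x @[k --> \oo] --> w x.
  move=> Hx.
  have /cvg_ex[l Sl] : cvgn (fun k => S (phi k) x).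
    apply: (@cvgn_weighted_squares _ _ (fine (H x))) => n.
    rewrite -lee_fin fineK// -sumEFin.
    by apply: (@nneseries_lim_ge _ (fun k => t k x) xpredT 0%N n) => k _ _; exact: t0.
  suff -> : w x = l by [].
  rewrite /w; have /cvg_limn_einf_sup [_ ->] // : (S (phi k) x)%:E @[k --> \oo] --> l%:E.
  by apply: cvg_EFin => //; exact: nearW.
have Hae := integrable_ae mD Hint.
have fat N : (\int[mu]_(x in D) ((w x - S N x) ^+ 2)%:E <= (tau N)%:E)%E.
  pose F k x := ((S (phi (k + N)%N) x - S N x) ^+ 2)%:E.
  have mF k : measurable_fun D (F k).
    by apply/measurable_EFinP/measurable_funX/measurable_funB; exact: measurable_funTS.
  have F0 k x : D x -> (0 <= F k x)%E by rewrite lee_fin sqr_ge0.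
  apply: (@le_trans _ _ (\int[mu]_(x in D) limn_einf (F ^~ x))%E); last first.
    apply: le_trans (fatou mu mD mF F0) _; rewrite limn_einf_lim; apply: lime_le.
      exact: is_cvg_einfs.
    apply: nearW => k; apply: (@le_trans _ _ (\int[mu]_(x in D) F k x)%E).
      by apply: ereal_inf_lbound; exists k => /=.
    rewrite dot_sqE// ?lee_fin; last exact: sqintB.
    apply: cS; apply: leq_trans (phi_ge _); exact: leq_addl.
  apply: ae_ge0_le_integral => //.
  - by move=> x _; rewrite lee_fin sqr_ge0.
  - by apply/measurable_EFinP/measurable_funX/measurable_funB; exact: measurable_funTS.
  - move=> x Dx; rewrite limn_einf_lim; apply: lime_ge; first exact: is_cvg_einfs.
    by apply: nearW => k; apply: le_ereal_inf_tmp => _ [m _ <-]; exact: F0.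
  - rewrite (_ : (fun x => _) = (fun x => - limn_esup ((fun k => \- (F k)) ^~ x))%E); last first.
      by apply/funext => x; rewrite /limn_einf.
    apply: measurableT_comp => //; apply: measurable_fun_limn_esup => k.
    exact: measurableT_comp.
  - apply: filterS Hae => x hx Dx; have /hx/wcvg wx := Dx.
    suff /cvg_limn_einf_sup[-> _] : F k x @[k --> \oo] --> ((w x - S N x) ^+ 2)%:E by [].
    apply: cvg_EFin; first exact: nearW.
    apply: (@cvg_comp _ _ _ (fun k => S (phi (k + N)%N) x) (fun z => (z - S N x) ^+ 2) _ (nbhs (w x))).
      by rewrite (cvg_shiftn N (fun k => S (phi k) x)).
    apply: (@continuous_comp _ _ _ (fun z => z - S N x) (fun z => z ^+ 2)).
      by apply: continuousB; [exact: cvg_id|exact: cvg_cst].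
    exact: exprn_continuous.
have sw : sqint w.
  have : sqint (fun x => w x - S 0%N x).
    apply: sqintP => //; first by apply: measurable_funTS; exact: measurable_funB.
    exact: le_lt_trans (fat 0%N) (ltry _).
  move=> /sqintD -/(_ mD _ (sS 0%N)).
  by rewrite (_ : (fun _ => _) = w)//; apply/funext => x; rewrite subrK.
exists w; split => //.
- move=> x y xy; rewrite /w; congr (fine (limn_esup _)).
  by apply/funext => k; rewrite xy.
- by move=> N; rewrite -lee_fin -dot_sqE//; exact: sqintB.
Qed.

End L2Limit.

Section Orthonormal.
Context {d} {T : measurableType d} {R : realType}.
Variables (mu : {measure set T -> \bar R}) (D : set T).
Hypothesis mD : measurable D.

Notation sqint := (sqint mu D).
Notation dot := (dot mu D).

Variable e : nat -> T -> R.
Hypothesis me : forall n, measurable_fun setT (e n).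
Hypothesis se : forall n, sqint (e n).
Hypothesis oe : forall m n, dot (e m) (e n) = (m == n)%:R.

Let comb (a : nat -> R) (r : seq nat) (x : T) : R := \sum_(n <- r) a n * e n x.

Let sqint_comb a r : sqint (comb a r).
Proof. by apply: sqint_sum => // n; exact: sqintZ. Qed.

Let dot_comb a r f : sqint f -> dot (comb a r) f = \sum_(n <- r) a n * dot (e n) f.
Proof.
move=> sf; rewrite dot_suml//; last by move=> n; exact: sqintZ.
by apply: eq_bigr => n _; rewrite dotZl.
Qed.

Let dot_comb_e a r m : uniq r -> dot (comb a r) (e m) = if m \in r then a m else 0.
Proof.
move=> ur; rewrite dot_comb//; case: ifPn => mr.
  rewrite (bigD1_seq m)//= oe eqxx mulr1 big1 ?addr0// => i im.
  by rewrite oe (negbTE im) mulr0.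
rewrite big_seq big1// => i ir; rewrite oe (_ : i == m = false) ?mulr0//.
by apply: contraNF mr => /eqP <-.
Qed.

Let dot_comb_comb a r : uniq r -> dot (comb a r) (comb a r) = \sum_(n <- r) a n ^+ 2.
Proof.
move=> ur; rewrite dot_comb//; apply: eq_big_seq => n nr.
by rewrite dotC dot_comb_e// nr expr2.
Qed.

Lemma bessel f n : sqint f -> \sum_(0 <= i < n) dot f (e i) ^+ 2 <= dot f f.
Proof.
move=> sf; pose c i := dot f (e i); set r := index_iota 0 n.
have := dot_ge0 mu D (fun x => f x - comb c r x).
have sB : sqint (fun x => f x - comb c r x) by exact: sqintB.
rewrite dotBl// !dotBr// dot_comb_comb ?iota_uniq// (dotC _ _ f (comb _ _)) dot_comb//.
under eq_bigr do rewrite dotC -expr2.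
by rewrite subrr subr0 subr_ge0.
Qed.

(** The clause on points with equal values says that the sum inherits every symmetry of the basis;
    it later makes synthesized functions periodic at every point, not merely almost everywhere. *)
Lemma riesz_fischer (a : nat -> R) (B : R) :
  (forall n, \sum_(0 <= i < n) a i ^+ 2 <= B) ->
  exists w, [/\ measurable_fun setT w, sqint w,
    (forall x y, (forall n, e n x = e n y) -> w x = w y),
    forall n, dot w (e n) = a n & dot w w <= B].
Proof.
move=> aB; pose s n := \sum_(0 <= i < n) a i ^+ 2.
have nds : nondecreasing_seq s.
  by apply/nondecreasing_seqP => n; rewrite /s big_nat_recr//= lerDl sqr_ge0.
have cs : s @ \oo --> limn s.
  by apply: nondecreasing_is_cvgn => //; exists B => _ [n _ <-]; exact: aB.
have s_le n : s n <= limn s by apply: nondecreasing_cvgn_le => //; exact: cvgP cs.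
pose S n := comb a (index_iota 0 n).
have SB N m x : (N <= m)%N -> S m x - S N x = comb a (index_iota N m) x.
  by move=> Nm; rewrite /S /comb (@big_cat_nat _ _ _ N 0%N m)//= addrAC subrr add0r.
have := @L2_limit _ _ _ mu D mD S (fun n => limn s - s n).
case.
- by move=> n; apply: measurable_sum => i; exact: measurable_funM.
- by move=> n; exact: sqint_comb.
- by rewrite -[X in _ --> X](subrr (limn s)); apply: cvgB => //; exact: cvg_cst.
- move=> N m Nm; rewrite (@eq_dot _ _ _ mu D _ (comb a (index_iota N m)) _ (comb a (index_iota N m))).
  + rewrite dot_comb_comb ?iota_uniq//.
    rewrite (_ : \sum_(_ <- _) _ = s m - s N) ?lerD2r//.
    by rewrite /s (@big_cat_nat _ _ _ N 0%N m)//= addrAC subrr add0r.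
  + by move=> x _; exact: SB.
  + by move=> x _; exact: SB.
move=> w [mw sw wS wlim]; exists w.
have we n : dot w (e n) = a n.
  have q N : (n < N)%N -> (dot w (e n) - a n) ^+ 2 <= limn s - s N.
    move=> nN; have sB : sqint (fun x => w x - S N x) by apply: sqintB => //; exact: sqint_comb.
    rewrite (_ : _ - a n = dot (fun x => w x - S N x) (e n)).
      by apply: le_trans (dot_CS mD sB (se n)) _; rewrite oe eqxx mulr1.
    by rewrite dotBl//; [rewrite dot_comb_e ?iota_uniq// mem_index_iota nN|exact: sqint_comb].
  have {}q : (dot w (e n) - a n) ^+ 2 <= limn s - limn s.
    by apply: (ler_cvg_to (cvg_cst _) (cvgB (cvg_cst _) cs)); exists n.+1.
  apply/eqP; rewrite -subr_eq0 -sqrf_eq0 eq_le sqr_ge0 andbT.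
  by rewrite -(subrr (limn s)).
split=> //.
  by move=> x y xy; apply: wS => n; apply: eq_bigr => i _; rewrite xy.
have := wlim 0%N; rewrite /s big_geq// subr0.
rewrite (@eq_dot _ _ _ mu D _ w _ w) => [ww| |]; last 2 first.
- by move=> x _; rewrite /S /comb big_geq// subr0.
- by move=> x _; rewrite /S /comb big_geq// subr0.
apply: le_trans ww _; apply: limr_le; first exact: cvgP cs.
by apply: nearW.
Qed.

Hypothesis total : forall f, sqint f -> (forall n, dot f (e n) = 0) -> dot f f = 0.

(** Bessel gives one inequality. For the other, Riesz-Fischer rebuilds some [w] from the
    coefficients of [f], with [dot w w] at most the sum of the series; [f - w] has zero
    coefficients, so totality and Cauchy-Schwarz give [dot f f = dot w w]. *)
Lemma parseval_sq f : sqint f -> series (fun n => dot f (e n) ^+ 2) @ \oo --> dot f f.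
Proof.
move=> sf; set s := series _.
have sb n : s n <= dot f f by exact: bessel.
have cs : s @ \oo --> limn s.
  apply: nondecreasing_is_cvgn; last by exists (dot f f) => _ [n _ <-]; exact: sb.
  by apply/nondecreasing_seqP => n; rewrite /s /series /= big_nat_recr//= lerDl sqr_ge0.
have [|w [mw sw _ we wB]] := @riesz_fischer (fun n => dot f (e n)) (limn s).
  move=> n; apply: nondecreasing_cvgn_le; last exact: cvgP cs.
  by apply/nondecreasing_seqP => m; rewrite /s /series /= big_nat_recr//= lerDl sqr_ge0.
suff -> : dot f f = limn s by [].
apply/eqP; rewrite eq_le; apply/andP; split; last first.
  by apply: limr_le; [exact: cvgP cs|exact: nearW].
have sB : sqint (fun x => f x - w x) by exact: sqintB.
have d0 : dot (fun x => f x - w x) (fun x => f x - w x) = 0.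
  by apply: total => // n; rewrite dotBl// we subrr.
have dg g : sqint g -> dot f g = dot w g.
  move=> sg; have := dot_CS mD sB sg; rewrite d0 mul0r => le0.
  have /eqP : dot (fun x => f x - w x) g ^+ 2 == 0 by rewrite eq_le le0 sqr_ge0.
  by move/eqP; rewrite sqrf_eq0 dotBl// subr_eq0 => /eqP.
by rewrite dg// dotC dg.
Qed.

(** Polarization of [parseval_sq]. *)
Lemma parseval f g : sqint f -> sqint g ->
  series (fun n => dot f (e n) * dot g (e n)) @ \oo --> dot f g.
Proof.
move=> sf sg; have sfg : sqint (fun x => f x + g x) by exact: sqintD.
have h : (2^-1 * (series (fun n => dot (fun x => f x + g x) (e n) ^+ 2) n
    - series (fun n => dot f (e n) ^+ 2) n - series (fun n => dot g (e n) ^+ 2) n)) @[n --> \oo]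
    --> 2^-1 * (dot (fun x => f x + g x) (fun x => f x + g x) - dot f f - dot g g).
  apply: cvgM; first exact: cvg_cst.
  by apply: cvgB; [apply: cvgB|]; exact: parseval_sq.
rewrite (_ : dot f g = 2^-1 * (dot (fun x => f x + g x) (fun x => f x + g x) - dot f f - dot g g)); last first.
  by rewrite dotDl// !dotDr// (dotC _ _ g f); field.
move: h; apply: cvg_trans; apply: near_eq_cvg; apply: nearW => n.
rewrite seriesEnat /= -!sumrB mulr_sumr; apply: eq_bigr => i _ /=.
by rewrite !dotDl//; field.
Qed.

End Orthonormal.

(** * Functions orthogonal to an algebra of bounded functions *)

Lemma bernoulli_ge (R : realType) (b : R) k : b <= 1 -> 1 - k%:R * b <= (1 - b) ^+ k \/ b < 0.
Proof.
move=> b1; have [b0|] := leP 0 b; [left|by right].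
elim: k => [|k IH]; first by rewrite mul0r subr0 expr0.
rewrite exprS; apply: (@le_trans _ _ ((1 - b) * (1 - k%:R * b))).
  rewrite -natr1; have := mulr_ge0 (ler0n R k) (sqr_ge0 b); nra.
by rewrite ler_wpM2l// subr_ge0.
Qed.

Lemma expr_onem_le (R : realType) (b : R) k : 0 <= b <= 1 -> (1 - b) ^+ k <= (1 + k%:R * b)^-1.
Proof.
move=> /andP[b0 b1]; have p j : 0 < 1 + j%:R * b by rewrite ltr_pwDl// mulr_ge0.
rewrite -div1r ler_pdivlMr//.
elim: k => [|k IH]; first by rewrite expr0 mul0r addr0 mulr1.
apply: le_trans IH; rewrite exprS -mulrA mulrCA ler_wpM2l ?exprn_ge0 ?subr_ge0//.
rewrite -natr1; have := mulr_ge0 (ler0n R k) (sqr_ge0 b); have := sqr_ge0 b; nra.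
Qed.

(** The outer exponent times the inner power is [(n+1) * (2s)^(2(n+1))]: it tends to 0 for [s < 1/2]
    and is at least [n+1] for [s >= 1/2], so the two Bernoulli bounds give the limits 1 and 0. The
    factor [n+1] settles the threshold [s = 1/2] itself. *)
Lemma step_polynomials_cvg (R : realType) (s : R) : 0 <= s <= 1 ->
  (1 - s ^+ (2 * n.+1)) ^+ (n.+1 * 4 ^ n.+1) @[n --> \oo] --> ((s < 2^-1)%R%:R : R).
Proof.
move=> /andP[s0 s1].
have sk k : 0 <= s ^+ k <= 1 by rewrite exprn_ge0//= exprn_ile1.
have e n : (n.+1 * 4 ^ n.+1)%:R * s ^+ (2 * n.+1) = n.+1%:R * (2 * s) ^+ (2 * n.+1).
  rewrite natrM -mulrA; congr (_ * _).
  by rewrite !exprM natrX -exprMn; congr (_ ^+ _); ring.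
have [s2|s2] := ltP s 2^-1.
  have r1 : 0 <= 2 * s < 1 by apply/andP; split; lra.
  (* From [(1 - b)^(n+1) <= 1 / ((n+1) * b)], squaring gives [(n+1) * (2s)^(2(n+1)) <= 1 / ((n+1) *
     b^2)]; the factor 2 in the inner exponent provides this square. *)
  pose b := 1 - 2 * s.
  have b0 : 0 < b by rewrite /b; lra.
  apply: (@squeeze_cvgr _ _ _ _ (fun n => 1 - b ^- 2 * harmonic n) (cst 1)).
  - apply: nearW => n; apply/andP; split; last by rewrite exprn_ile1// ?subr_ge0 ?gerBl; case/andP: (sk (2 * n.+1)%N).
    have [h1|] := @bernoulli_ge R (s ^+ (2 * n.+1)) (n.+1 * 4 ^ n.+1) (proj2 (andP (sk _))); last first.
      by rewrite ltNge; case/andP: (sk (2 * n.+1)%N) => ->.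
    apply: le_trans h1; rewrite lerB// e /harmonic/=.
    have h : (2 * s) ^+ n.+1 <= (n.+1%:R * b)^-1.
      have := @expr_onem_le R b n.+1; rewrite {1}/b subKr => /(_ _)/le_trans; apply.
        by rewrite ltW//= /b; lra.
      by rewrite lef_pV2 ?posrE ?ltr_wpDl ?mulr_gt0// lerDr.
    rewrite mulnC exprM; apply: (@le_trans _ _ (n.+1%:R * (n.+1%:R * b)^-1 ^+ 2)).
      by rewrite ler_wpM2l// ler_pXn2r// nnegrE ?exprn_ge0 ?invr_ge0 ?mulr_ge0// ltW//; case/andP: r1.
    rewrite le_eqVlt; apply/orP; left; apply/eqP; field.
    by apply/andP; split; [rewrite nat1r pnatr_eq0|exact: lt0r_neq0].
  - rewrite -[X in _ --> X](subr0 1) -[X in _ - X](mulr0 (b ^- 2)).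
    apply: cvgB; first exact: cvg_cst.
    by apply: cvgM; [exact: cvg_cst|exact: cvg_harmonic].
  - exact: cvg_cst.
apply: (@squeeze_cvgr _ _ _ _ (cst 0) harmonic).
- apply: nearW => n; rewrite exprn_ge0 ?subr_ge0//=; last by case/andP: (sk (2 * n.+1)%N).
  apply: le_trans (@expr_onem_le _ _ _ (sk _)) _.
  rewrite /harmonic /= lef_pV2 ?posrE// ?ltr_pwDl//; last by rewrite mulr_ge0// exprn_ge0.
  rewrite e ler_wpDl// -[leLHS]mulr1 ler_wpM2l// exprn_ege1//; lra.
- exact: cvg_cst.
- exact: cvg_harmonic.
Qed.

Section Multipliers.
Context {d} {T : measurableType d} {R : realType}.
Variables (mu : {measure set T -> \bar R}) (D : set T).
Hypothesis mD : measurable D.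
Variable w : T -> R.
Hypothesis iw : mu.-integrable D (EFin \o w).
Variable tests : set (T -> R).

Definition bounded_measurable (g : T -> R) :=
  measurable_fun setT g /\ exists M : R, forall x, `|g x| <= M.

Hypothesis btests : forall h, tests h -> bounded_measurable h.

(* If the tests span an algebra and [w] is orthogonal to it, the constant 1 is
   annihilated and the tests are multipliers; the sets whose indicator is a
   multiplier form a sigma-algebra, so [w] is orthogonal to the indicators of
   all the sets generated by the tests. *)
Definition annihilated (g : T -> R) := bounded_measurable g /\
  forall h, tests h -> \int[mu]_(x in D) (w x * g x * h x) = 0.

Definition multiplier (m : T -> R) := bounded_measurable m /\
  forall g, annihilated g -> annihilated (fun x => g x * m x).

Lemma bounded_measurableM g h : bounded_measurable g -> bounded_measurable h ->
  bounded_measurable (fun x => g x * h x).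
Proof.
move=> [mg [M gM]] [mh [N hN]]; split; first exact: measurable_funM.
by exists (M * N) => x; rewrite normrM ler_pM.
Qed.

Lemma bounded_measurableD g h : bounded_measurable g -> bounded_measurable h ->
  bounded_measurable (fun x => g x + h x).
Proof.
move=> [mg [M gM]] [mh [N hN]]; split; first exact: measurable_funD.
by exists (M + N) => x; apply: le_trans (ler_normD _ _) _; rewrite lerD.
Qed.

Lemma bounded_measurable_cst c : bounded_measurable (fun=> c).
Proof. by split; [exact: measurable_cst|exists `|c|]. Qed.

Lemma integrable_bounded_mul g : bounded_measurable g ->
  mu.-integrable D (EFin \o (fun x => w x * g x)).
Proof.
move=> [mg [M gM]].
have mw : measurable_fun D w by apply/measurable_EFinP; exact: measurable_int iw.
apply: (@le_integrable _ _ _ mu D mD _ (fun x => (M%:E * (EFin \o w) x)%E)).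
- by apply/measurable_EFinP; apply: measurable_funM => //; exact: measurable_funTS.
- move=> x _ /=; rewrite lee_fin !normrM mulrC ler_wpM2r//.
  by apply: le_trans (gM x) _; exact: ler_norm.
- exact: integrableZl.
Qed.

Lemma multiplier_cst c : multiplier (fun=> c).
Proof.
split=> [|g [bg g0]]; first exact: bounded_measurable_cst.
split=> [|h th]; first by apply: bounded_measurableM => //; exact: bounded_measurable_cst.
transitivity (\int[mu]_(x in D) (c * (w x * (g x * h x)))).
  by apply: eq_Rintegral => x _; ring.
rewrite RintegralZl//; last by apply: integrable_bounded_mul; exact: bounded_measurableM (btests th).
by under eq_Rintegral do rewrite mulrA; rewrite g0// mulr0.
Qed.

Lemma multiplierM m n : multiplier m -> multiplier n -> multiplier (fun x => m x * n x).
Proof.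
move=> [bm mm] [bn mn]; split=> [|g ag]; first exact: bounded_measurableM.
by have := mn _ (mm _ ag); congr annihilated; apply/funext => x; rewrite mulrA.
Qed.

Lemma multiplierD m n : multiplier m -> multiplier n -> multiplier (fun x => m x + n x).
Proof.
move=> [bm mm] [bn mn]; split=> [|g ag]; first exact: bounded_measurableD.
have [bgm gm0] := mm _ ag; have [bgn gn0] := mn _ ag.
split=> [|h th]; first by apply: bounded_measurableM; [exact: ag.1|exact: bounded_measurableD].
transitivity (\int[mu]_(x in D) (w x * ((g x * m x) * h x) + w x * ((g x * n x) * h x))).
  by apply: eq_Rintegral => x _; ring.
rewrite RintegralD//; last 2 first.
- by apply: integrable_bounded_mul; exact: bounded_measurableM (btests th).
- by apply: integrable_bounded_mul; exact: bounded_measurableM (btests th).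
under eq_Rintegral do rewrite mulrA.
by under [X in _ + X]eq_Rintegral do rewrite mulrA; rewrite gm0// gn0// addr0.
Qed.

Lemma multiplierX m n : multiplier m -> multiplier (fun x => m x ^+ n).
Proof.
move=> mm; elim: n => [|n IH].
  by rewrite (_ : (fun _ => _) = fun=> 1); [exact: multiplier_cst|apply/funext => x; rewrite expr0].
rewrite (_ : (fun _ => _) = fun x => m x * m x ^+ n); last by apply/funext => x; rewrite exprS.
exact: multiplierM.
Qed.

Lemma multiplier_lim (m_ : nat -> T -> R) (m : T -> R) (B : R) : (forall n, multiplier (m_ n)) ->
  (forall n x, `|m_ n x| <= B) -> (forall x, m_ n x @[n --> \oo] --> m x) -> multiplier m.
Proof.
move=> mm mB mlim.
have bm : bounded_measurable m.
  split.
    apply: (@measurable_fun_cvg _ T R setT m_ m) => [n|x _]; first exact: (mm n).1.1.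
    exact: mlim.
  exists B => x; apply: (ler_cvg_to (cvg_norm (mlim x)) (cvg_cst B)).
  by apply: nearW => n; exact: mB.
split=> // g ag; have bg := ag.1; split=> [|h th]; first exact: bounded_measurableM.
have [mg [M gM]] := bg; have [mh [N hN]] := btests th.
have mw : measurable_fun D w by apply/measurable_EFinP; exact: measurable_int iw.
pose F n x := (w x * (g x * m_ n x) * h x)%:E.
have := @dominated_convergence _ _ _ mu D mD F (fun x => (w x * (g x * m x) * h x)%:E)
  (fun x => ((M * B * N)%:E * `|(EFin \o w) x|)%E).
case.
- move=> n; apply/measurable_EFinP; apply: measurable_funM; last exact: measurable_funTS.
  apply: measurable_funM => //; apply: measurable_funM; first exact: measurable_funTS.
  by apply: measurable_funTS; exact: (mm n).1.1.
- apply/measurable_EFinP; apply: measurable_funM; last exact: measurable_funTS.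
  apply: measurable_funM => //; apply: measurable_funM; first exact: measurable_funTS.
  by apply: measurable_funTS; exact: bm.1.
- apply: aeW => x _; apply: cvg_EFin; first exact: nearW.
  apply: cvgM; last exact: cvg_cst.
  apply: cvgM; first exact: cvg_cst.
  by apply: cvgM; [exact: cvg_cst|exact: mlim].
- by apply: integrableZl => //; exact: integrable_abse.
- apply: aeW => x n _ /=; rewrite lee_fin !normrM.
  rewrite (_ : _ * `|w x| = `|w x| * (M * B) * N); last by ring.
  rewrite ler_pM// ?mulr_ge0//.
  by rewrite ler_wpM2l// ler_pM.
move=> _ _ Flim; rewrite /Rintegral.
suff : (\int[mu]_(x in D) F n x)%E @[n --> \oo] --> 0%E.
  move=> F0; have -> : (\int[mu]_(x in D) (w x * (g x * m x) * h x)%:E = 0)%E; last by [].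
  exact: (cvg_unique _ Flim F0).
rewrite (_ : (fun n => _) = cst 0%E); first exact: cvg_cst.
apply/funext => n /=.
have [_ /(_ h th)] := (mm n).2 g ag; rewrite /Rintegral => e0.
rewrite -[LHS]fineK ?e0//.
have : mu.-integrable D (EFin \o (fun x => w x * (g x * m_ n x * h x))).
  apply: integrable_bounded_mul; apply: bounded_measurableM; last exact: btests.
  by apply: bounded_measurableM => //; exact: (mm n).1.
move=> /(integrable_fin_num mD); congr (_ \is a fin_num).
by apply: eq_integral => x _; rewrite /F/= mulrA.
Qed.

(* The explicit polynomials of [step_polynomials_cvg] turn a multiplier into the
   indicator of a superlevel set, which replaces the Weierstrass theorem. *)
Lemma multiplier_gt (m : T -> R) (c : R) : multiplier m -> (forall x, `|m x| <= 1) -> `|c| <= 1 ->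
  multiplier (\1_[set x | c < m x]).
Proof.
(* The affine map [1/2 + (c - m) / 4] takes values in [[0, 1]] and is below [1/2] exactly where [m]
   exceeds [c]. *)
move=> mm m1 c1; pose s x := 2^-1 + (c * 4^-1 + (- 4^-1) * m x).
have ms : multiplier s.
  apply: multiplierD; first exact: multiplier_cst.
  apply: multiplierD; first exact: multiplier_cst.
  by apply: multiplierM => //; exact: multiplier_cst.
have s01 x : 0 <= s x <= 1.
  have := m1 x; move: c1; rewrite /s !ler_norml => /andP[? ?] /andP[? ?].
  by apply/andP; split; lra.
pose q n x := (1 + (-1) * s x ^+ (2 * n.+1)) ^+ (n.+1 * 4 ^ n.+1).
apply: (@multiplier_lim q _ 1).
- move=> n; apply: multiplierX; apply: multiplierD; first exact: multiplier_cst.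
  by apply: multiplierM; [exact: multiplier_cst|exact: multiplierX].
- move=> n x; rewrite /q mulN1r; have /andP[s0 s1] := s01 x.
  rewrite ger0_norm ?exprn_ge0 ?exprn_ile1 ?subr_ge0 ?exprn_ile1//.
  by rewrite gerBl exprn_ge0.
- move=> x; have -> : \1_[set x | c < m x] x = (s x < 2^-1)%R%:R :> R.
    rewrite indicE; congr (_%:R); congr nat_of_bool; apply/idP/idP.
      by rewrite inE /= /s => ?; lra.
    by rewrite /s => ?; rewrite inE /=; lra.
  apply: cvg_trans (step_polynomials_cvg (s01 x)).
  by apply: near_eq_cvg; apply: nearW => n; rewrite /q mulN1r.
Qed.

Definition multiplier_set (A : set T) := multiplier (\1_A).

Lemma multiplier_setC A : multiplier_set A -> multiplier_set (~` A).
Proof.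
move=> mA; rewrite /multiplier_set (_ : \1_(~` A) = fun x => 1 + (-1) * \1_A x).
  by apply: multiplierD; [|apply: multiplierM => //]; exact: multiplier_cst.
apply/funext => x; rewrite !indicE in_setC.
by case: (x \in A); rewrite /= ?mulr1 ?subrr ?mulr0 ?addr0.
Qed.

Lemma multiplier_setI A B : multiplier_set A -> multiplier_set B -> multiplier_set (A `&` B).
Proof.
move=> mA mB; rewrite /multiplier_set indicI; exact: multiplierM.
Qed.

Lemma multiplier_setU A B : multiplier_set A -> multiplier_set B -> multiplier_set (A `|` B).
Proof.
move=> /multiplier_setC mA /multiplier_setC mB.
by rewrite -[_ `|` _]setCK setCU; apply: multiplier_setC; exact: multiplier_setI.
Qed.

Lemma multiplier_set0 : multiplier_set set0.
Proof. by rewrite /multiplier_set indic0; exact: multiplier_cst. Qed.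

Lemma multiplier_bigcup (A : (set T)^nat) : (forall n, multiplier_set (A n)) ->
  multiplier_set (\bigcup_n A n).
Proof.
move=> mA; pose B n := \big[setU/set0]_(i < n) A i.
apply: (@multiplier_lim (fun n => \1_(B n)) _ 1).
- move=> n; apply: (big_ind multiplier_set) => //; first exact: multiplier_set0.
  exact: multiplier_setU.
- by move=> n x; rewrite indicE; case: (_ \in _); rewrite ?normr1 ?normr0.
- move=> x; have [[n _ Anx]|nA] := pselect ((\bigcup_n A n) x).
    apply: cvg_near_cst.
    exists n.+1 => // k /= nk.
    have Bx : B k x by rewrite /B -bigcup_mkord; exists n.
    have Ux : (\bigcup_n A n) x by exists n.
    by rewrite !indicE !mem_set.
  apply: cvg_near_cst.
  apply: nearW => k; rewrite !indicE !memNset//.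
  by rewrite /B -bigcup_mkord => -[i _ Aix]; apply: nA; exists i.
Qed.

(** Sets are compared through their traces on [H] because periodic tests can produce a coordinate
    ray only inside one period cell. *)
Lemma sigma_algebra_multiplier (H : set T) :
  sigma_algebra setT [set A | exists2 B, multiplier_set B & A `&` H = B `&` H].
Proof.
split.
- by exists set0 => //; exact: multiplier_set0.
- move=> A [B mB AB]; exists (~` B); first exact: multiplier_setC.
  rewrite setTD; apply/seteqP; split => x [nA Hx]; split => //= Bx; apply: nA.
    by have [] : (A `&` H) x by rewrite AB.
  by have [] : (B `&` H) x by rewrite -AB.
- move=> A AP; have /choice[B HB] : forall n, exists B, multiplier_set B /\ A n `&` H = B `&` H.
    by move=> n; have [B mB AB] := AP n; exists B.
  exists (\bigcup_n B n); first by apply: multiplier_bigcup => n; have [] := HB n.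
  by rewrite !setI_bigcupl; apply: eq_bigcupr => n _; have [] := HB n.
Qed.

End Multipliers.

(** * Measurability, Fubini and periodic derivatives on the cube *)

Section CaratheodoryFunctions.
Context {d} {T : measurableType d} {R : realType}.

(** Rounding [x] down to a multiple of [1/(n+1)] makes every preimage a countable union of
    rectangles, and continuity in [x] gives pointwise convergence as [n] grows. *)
Lemma measurable_fun_caratheodory (F : T * measurableTypeR R -> R) :
  (forall x, measurable_fun setT (fun t => F (t, x))) ->
  (forall t, continuous (fun x : R => F (t, x) : R)) -> measurable_fun setT F.
Proof.
move=> mF cF.
pose q n (x : R) : R := (Num.floor (n.+1%:R * x))%:~R / n.+1%:R.
have n0 n : 0 < n.+1%:R :> R by [].
apply: (@measurable_fun_cvg _ _ R setT (fun n z => F (z.1, q n z.2)) F) => [n|[t x] _ /=].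
  move=> _ B mB; rewrite setTI.
  rewrite (_ : _ @^-1` _ = \bigcup_(z : int) (((fun t => F (t, z%:~R / n.+1%:R)) @^-1` B) `*`
     [set` `[z%:~R / n.+1%:R, (z + 1)%:~R / n.+1%:R[ ])); last first.
    apply/seteqP; split => [[t x] /= Bx|[t x] /= [z _ [/= Bz]]].
      exists (Num.floor (n.+1%:R * x)) => //; split=> //=.
      by rewrite in_itv/= ler_pdivrMr// ltr_pdivlMr// mulrC floor_itv.
    rewrite in_itv/= ler_pdivrMr// ltr_pdivlMr// (mulrC x) => /floor_def zE.
    by rewrite /q zE.
  apply: countable_bigcupT_measurable; first exact: countableP.
  move=> z; apply: measurableX; last exact: measurable_itv.
  by rewrite -[X in measurable X]setTI; exact: mF.
apply: (@cvg_comp _ _ _ (q ^~ x) (fun x => F (t, x)) _ (nbhs (x : R))); last exact: cF.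
apply: (@squeeze_cvgr _ _ _ _ (fun n => x - harmonic n) (cst x)).
- apply: nearW => n; rewrite /q /harmonic/=.
  have /andP[h1 h2] := floor_itv (n.+1%:R * x).
  apply/andP; split; last by rewrite ler_pdivrMr// (mulrC x).
  rewrite ler_pdivlMr// mulrBl mulVf// (mulrC x) lerBlDr.
  by move: h2; rewrite rmorphD/= => /ltW.
- rewrite -[X in _ --> X]subr0; apply: cvgB; [exact: cvg_cst|exact: cvg_harmonic].
- exact: cvg_cst.
Qed.

End CaratheodoryFunctions.

Lemma continuous_triple (R : realType) (f1 f2 f3 : R -> R) :
  continuous f1 -> continuous f2 -> continuous f3 -> continuous (fun t => (f1 t, f2 t, f3 t)).
Proof.
move=> c1 c2 c3 t.
exact: (cvg_pair (cvg_pair (c1 t) (c2 t)) (c3 t)).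
Qed.

Lemma continuous_curve3 (R : realType) (f : point3 R -> R) (f1 f2 f3 : R -> R) :
  continuous f -> continuous f1 -> continuous f2 -> continuous f3 ->
  continuous (fun t => f (f1 t, f2 t, f3 t)).
Proof.
move=> cf c1 c2 c3 t.
apply: (@continuous_comp R (R * R * R)%type R (fun t => (f1 t, f2 t, f3 t)) f); last exact: cf.
exact: continuous_triple.
Qed.

(** Links the product topology with the product sigma-algebra: the previous lemma is applied twice,
    peeling off the last coordinate each time. *)
Lemma continuous_measurable3 (R : realType) (f : point3 R -> R) : continuous f ->
  measurable_fun [set: mpoint3 R] f.
Proof.
move=> cf.
have cid : continuous (@id R) by move=> ?; exact: cvg_id.
have cc (c : R) : continuous (cst c : R -> R) by move=> ?; exact: cvg_cst.
apply: measurable_fun_caratheodory => [y|[a b]].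
  apply: (@measurable_fun_caratheodory _ (measurableTypeR R) R (fun x => f (x, y))) => [b|a].
    apply: continuous_measurable_fun.
    exact: (@continuous_curve3 _ f id (cst b) (cst y)).
  exact: (@continuous_curve3 _ f (cst a) id (cst y)).
exact: (@continuous_curve3 _ f (cst a) (cst b) id).
Qed.

Section FubiniZero.
Local Open Scope ereal_scope.
Context d1 d2 (T1 : measurableType d1) (T2 : measurableType d2) (R : realType).
Variables (m1 : {sigma_finite_measure set T1 -> \bar R})
  (m2 : {sigma_finite_measure set T2 -> \bar R}).
Variables (A : set T1) (B : set T2) (F : T1 * T2 -> \bar R).
Hypotheses (mA : measurable A) (mB : measurable B).
Hypothesis iF : (m1 \x m2).-integrable (A `*` B) F.

Let iFr : (m1 \x m2).-integrable setT (F \_ (A `*` B)).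
Proof. by rewrite -integrable_mkcond//; exact: measurableX. Qed.

Lemma fubini_eq0r : (forall x, A x -> \int[m2]_(y in B) F (x, y) = 0) ->
  \int[m1 \x m2]_(z in A `*` B) F z = 0.
Proof.
move=> h; rewrite integral_mkcond -integral12_prod_meas1//.
apply: integral0_eq => x _; rewrite /fubini_F.
have [Ax|nAx] := pselect (A x).
  rewrite -[RHS](h x Ax) [RHS]integral_mkcond; apply: eq_integral => y _.
  by rewrite !patchE in_setX mem_set.
by apply: integral0_eq => y _; rewrite patchE in_setX memNset.
Qed.

Lemma fubini_eq0l : (forall y, B y -> \int[m1]_(x in A) F (x, y) = 0) ->
  \int[m1 \x m2]_(z in A `*` B) F z = 0.
Proof.
move=> h; rewrite integral_mkcond -integral21_prod_meas1//.
apply: integral0_eq => y _; rewrite /fubini_G.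
have [By|nBy] := pselect (B y).
  rewrite -[RHS](h y By) [RHS]integral_mkcond; apply: eq_integral => x _.
  by rewrite !patchE in_setX (mem_set By) andbT.
by apply: integral0_eq => x _; rewrite patchE in_setX (memNset nBy) andbF.
Qed.

End FubiniZero.

Lemma cos_periodz (R : realType) (x : R) (z : int) : cos (x + z%:~R * (pi *+ 2)) = cos x.
Proof.
case: z => n; first by rewrite mulr_natl (periodicn (@cosD2pi R)).
rewrite NegzE mulrNz mulNr mulr_natl.
by rewrite -(periodicn (@cosD2pi R) n.+1 (x - _)) subrK.
Qed.

Lemma sin_periodz (R : realType) (x : R) (z : int) : sin (x + z%:~R * (pi *+ 2)) = sin x.
Proof.
case: z => n; first by rewrite mulr_natl (periodicn (@sinD2pi R)).
rewrite NegzE mulrNz mulNr mulr_natl.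
by rewrite -(periodicn (@sinD2pi R) n.+1 (x - _)) subrK.
Qed.

Lemma derivable_shift0 (R : realType) (g : R -> R) (t : R) :
  derivable (fun h => g (t + h)) 0 1 ->
  derivable g t 1 /\ derive1 g t = derive1 (fun h => g (t + h)) 0.
Proof.
have e : (fun h : R => h^-1 *: ((g \o shift t) (h *: 1%R) - g t)) =
    (fun h : R => h^-1 *: (((fun h => g (t + h)) \o shift 0) (h *: 1%R) - g (t + 0))).
  by apply/funext => h; rewrite /= addr0 (addrC t) addr0 .
by rewrite /derivable !derive1E /derive e.
Qed.

Lemma integral_derive_eq0 (R : realType) (g : R -> R) (L : R) : 0 < L ->
  (forall t : R, derivable (fun h : R => g (t + h)) 0 1) ->
  continuous (fun t : R => derive1 (fun h : R => g (t + h)) 0 : R) -> g L = g 0 ->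
  (\int[@lebesgue_measure R]_(t in `[0%R, L]) (derive1 (fun h => (g (t + h))%R) 0%R)%:E = 0)%E.
Proof.
move=> L0 dg cdg gL.
have dg' t : derivable g t 1 by exact: (derivable_shift0 (dg t)).1.
have cg : continuous g.
  by move=> t; apply: differentiable_continuous; apply/derivable1_diffP.
have cd : {within `[0, L], continuous (fun t : R => derive1 (fun h : R => g (t + h)) 0 : R)}.
  by apply: continuous_subspaceT; exact: cdg.
have dLR : derivable_oo_LRcontinuous g 0 L.
  split; first by move=> t _; exact: dg'.
    exact: cvg_at_right_filter (cg 0).
  exact: cvg_at_left_filter (cg L).
have gE : {in `]0, L[, derive1 g =1 (fun t => derive1 (fun h => g (t + h)) 0)}.
  by move=> t _; rewrite (derivable_shift0 (dg t)).2.
by have -> := continuous_FTC2 L0 cd dLR gE; rewrite gL subee.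
Qed.

(* The library's sigma-finite instance on product measures is shadowed by the one for
   subprobabilities, hence this alias. *)
Definition lebesgue2 (R : realType) :
    set (measurableTypeR R * measurableTypeR R) -> \bar R :=
  (@lebesgue_measure R \x @lebesgue_measure R)%E.

Section Lebesgue2.
Variable R : realType.

HB.instance Definition _ := Measure.on (@lebesgue2 R).

Let lebesgue2_sigma_finite : sigma_finite setT (@lebesgue2 R).
Proof.
have /sigma_finiteP[F [TF ndF Foo]] := sigma_finiteT (@lebesgue_measure R).
exists (fun n => F n `*` F n).
  rewrite -setXTT TF predeqE => -[x y]; split.
    move=> [/= [n _ Fnx] [k _ Fky]]; exists (maxn n k) => //; split.
    - by move: x Fnx; exact/subsetPset/ndF/leq_maxl.
    - by move: y Fky; exact/subsetPset/ndF/leq_maxr.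
  by move=> [n _ []/= ? ?]; split; exists n.
move=> k; have [? ?] := Foo k; split; first exact: measurableX.
by rewrite /lebesgue2 product_measure1E// lte_mul_pinfty// ge0_fin_numE.
Qed.

HB.instance Definition _ := Measure_isSigmaFinite.Build _ _ _ (@lebesgue2 R)
  lebesgue2_sigma_finite.

End Lebesgue2.

Section Box.
Variables (R : realType) (L : R).
Hypothesis L_gt0 : 0 < L.
Notation leb := (@lebesgue_measure R).
Notation mu := (lebesgue3 R).
Notation D := (box3 L : set (mpoint3 R)).

Lemma measurable_box3 : measurable D.
Proof. by apply: measurableX; [apply: measurableX|]; exact: measurable_itv. Qed.

Lemma lebesgue3X (A B C : set (measurableTypeR R)) :
  measurable A -> measurable B -> measurable C ->
  (mu ((A `*` B) `*` C) = leb A * leb B * leb C)%E.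
Proof.
move=> mA mB mC; rewrite -(product_measure1E leb leb mA mB).
by apply: (@product_measure1E _ _ _ _ R (leb \x leb)%E leb) => //; exact: measurableX.
Qed.

Lemma lebesgue3_box3 : (mu D = (L ^+ 3)%:E)%E.
Proof.
rewrite lebesgue3X; [|exact: measurable_itv..].
rewrite lebesgue_measure_itv/= lte_fin L_gt0 -EFinB subr0 -!EFinM.
by congr EFin; rewrite !exprS expr0 mulr1 mulrA.
Qed.

Lemma bounded_sqint (f : mpoint3 R -> R) (M : R) : measurable_fun setT f ->
  (forall x, D x -> `|f x| <= M) -> sqint mu D f.
Proof.
have mD := measurable_box3; move=> mf fM; have mf' : measurable_fun D f by exact: measurable_funTS.
apply: sqintP => //; apply: (@le_lt_trans _ _ (\int[mu]_(x in D) (M ^+ 2)%:E)%E).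
  apply: ge0_le_integral => //.
  - by move=> x _; rewrite lee_fin sqr_ge0.
  - by apply/measurable_EFinP; exact: measurable_funX.
  - move=> x Dx; have fx := fM x Dx.
    by rewrite lee_fin -real_normK ?num_real// ler_pXn2r// nnegrE (le_trans _ fx).
by rewrite integral_cst// lebesgue3_box3 -EFinM ltry.
Qed.

Lemma sqint_integrable (f : mpoint3 R -> R) : sqint mu D f -> mu.-integrable D (EFin \o f).
Proof.
have mD := measurable_box3 => sf.
have s1 : sqint mu D (fun=> 1).
  by apply: (@bounded_sqint _ 1) => [|x _]; [exact: measurable_cst|rewrite normr1].
have := sqint_mul mD sf s1; congr (mu.-integrable D _).
by apply/funext => x /=; rewrite mulr1.
Qed.

Lemma compact_box3 : compact (box3 L).
Proof.
by apply: compact_setX; [apply: compact_setX|]; exact: segment_compact.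
Qed.

Lemma continuous_bounded_box3 (f : point3 R -> R) : continuous f ->
  exists M : R, forall x, box3 L x -> `|f x| <= M.
Proof.
move=> cf.
have /compact_bounded [M [_ MP]] : compact (f @` box3 L).
  by apply: continuous_compact; [exact: continuous_subspaceT|exact: compact_box3].
by exists (M + 1) => x Dx; apply: (MP (M + 1)); [rewrite ltrDl|exists x].
Qed.

Lemma continuous_sqint (f : point3 R -> R) : continuous f -> sqint mu D (f : mpoint3 R -> R).
Proof.
move=> cf; have [M fM] := continuous_bounded_box3 cf.
by apply: (@bounded_sqint f M) => //; exact: continuous_measurable3.
Qed.

(** Fubini isolates the integral along coordinate [j], which vanishes by the fundamental theorem of
    calculus and periodicity. All integrations by parts on the torus come from this. *)
Lemma integral_partial (j : 'I_3) (psi : point3 R -> R) :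
  periodic3 L psi -> (forall x, derivable (fun h => psi (shift3 j h x)) 0 1) ->
  continuous (partial j psi) -> \int[mu]_(x in D) partial j psi x = 0.
Proof.
move=> pp dpsi cp; rewrite /Rintegral.
have ip := sqint_integrable (continuous_sqint cp).
have cid : continuous (@id R) by move=> ?; exact: cvg_id.
have cc (c : R) : continuous (cst c : R -> R) by move=> ?; exact: cvg_cst.
suff -> : (\int[mu]_(x in D) (partial j psi x)%:E = 0)%E by [].
have mI : measurable (`[0, L] : set (measurableTypeR R)) by exact: measurable_itv.
have mII : measurable ((`[0, L] `*` `[0, L]) : set (measurableTypeR R * measurableTypeR R)).
  exact: measurableX.
have slice y : [set` `[0, L]] y -> (leb \x leb)%E.-integrable (`[0, L] `*` `[0, L])
    (fun x => (partial j psi (x, y))%:E).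
  move=> Ly; have [M fM] := continuous_bounded_box3 cp.
  apply: measurable_bounded_integrable => //.
  - have hL : leb `[0, L] = L%:E.
      by rewrite lebesgue_measure_itv/= lte_fin L_gt0 -EFinB subr0.
    have h : ((leb \x leb) (`[0%R, L] `*` `[0%R, L]) = L%:E * L%:E)%E.
      by rewrite -hL; exact: product_measure1E.
    apply: (@le_lt_trans _ _ (L * L)%:E); last exact: ltry.
    by rewrite EFinM -h.
  - apply: measurable_funTS.
    have mp : measurable_fun setT (fun x : measurableTypeR R * measurableTypeR R => (x, y : measurableTypeR R)).
      exact: pair2_measurable.
    exact: (measurableT_comp (continuous_measurable3 cp) mp).
  - by exists M; split; [exact: num_real|move=> N MN x Dx; apply: le_trans (ltW MN); exact: fM].
pose sets := (`[0, L] `*` `[0, L] : set (measurableTypeR R * measurableTypeR R)).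
have fl j' (H : mu.-integrable D (EFin \o partial j' psi)) := @fubini_eq0l _ _ _ _ R (@lebesgue2 R) leb
  sets `[0, L] (EFin \o partial j' psi) mII mI H.
have fr j' (H : mu.-integrable D (EFin \o partial j' psi)) := @fubini_eq0r _ _ _ _ R (@lebesgue2 R) leb
  sets `[0, L] (EFin \o partial j' psi) mII mI H.
case: j => -[|[|[|//]]] jP in dpsi cp ip slice *.
- apply: (fl _ ip) => y Ly.
  apply: (@fubini_eq0l _ _ _ _ R leb leb `[0, L] `[0, L] _ mI mI (slice y Ly)) => b _.
  apply: (@integral_derive_eq0 _ (fun a => psi (a, b, y)) _ L_gt0).
  + by move=> t; exact: (dpsi (t, b, y)).
  + exact: (@continuous_curve3 _ _ id (cst b) (cst y) cp).
  + by have := pp (Ordinal jP) (0, b, y); rewrite /shift3 /= add0r.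
- apply: (fl _ ip) => y Ly.
  apply: (@fubini_eq0r _ _ _ _ R leb leb `[0, L] `[0, L] _ mI mI (slice y Ly)) => a _.
  apply: (@integral_derive_eq0 _ (fun b => psi (a, b, y)) _ L_gt0).
  + by move=> t; exact: (dpsi (a, t, y)).
  + exact: (@continuous_curve3 _ _ (cst a) id (cst y) cp).
  + by have := pp (Ordinal jP) (a, 0, y); rewrite /shift3 /= add0r.
- apply: (fr _ ip) => -[a b] _.
  apply: (@integral_derive_eq0 _ (fun y => psi (a, b, y)) _ L_gt0).
  + by move=> t; exact: (dpsi (a, b, t)).
  + exact: (@continuous_curve3 _ _ (cst a) (cst b) id cp).
  + by have := pp (Ordinal jP) (a, b, 0); rewrite /shift3 /= add0r.
Qed.

End Box.

(** * Trigonometric functions on the torus and their completeness *)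

Section Trig.
Variables (R : realType) (L : R).
Hypothesis L_gt0 : 0 < L.
Notation mu := (lebesgue3 R).
Notation D := (box3 L : set (mpoint3 R)).
Notation omega := (2 * pi / L).
Implicit Types (k l : 'I_3 -> int) (a b : R).

Lemma coord3_shift (i j : 'I_3) h (x : point3 R) :
  coord3 i (shift3 j h x) = coord3 i x + (i == j)%:R * h.
Proof.
by case: i => -[|[|[|//]]] ?; case: j => -[|[|[|//]]] ?;
  rewrite /coord3 /shift3 /= ?mul1r ?mul0r ?addr0.
Qed.

Lemma phase_shift k (j : 'I_3) h (x : point3 R) :
  phase L k (shift3 j h x) = phase L k x + omega * (k j)%:~R * h.
Proof.
rewrite /phase -!mulrA -!mulrDr; congr (_ * (_ * (_ * _))).
under eq_bigr do rewrite coord3_shift mulrDr.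
rewrite big_split /=; congr (_ + _).
rewrite (bigD1 j)//= eqxx mul1r big1 ?addr0// => i /negbTE ->.
by rewrite mul0r mulr0.
Qed.

Lemma phaseN k x : phase L (fun j => - k j) x = - phase L k x.
Proof.
rewrite /phase -mulrN -sumrN; congr (_ * _); apply: eq_bigr => j _.
by rewrite mulrNz mulNr.
Qed.

Lemma phaseD k l x : phase L (fun j => k j + l j) x = phase L k x + phase L l x.
Proof.
rewrite /phase -mulrDr -big_split; congr (_ * _); apply: eq_bigr => j _.
by rewrite intrD mulrDl.
Qed.

Lemma phase0 x : phase L (fun=> 0) x = 0.
Proof. by rewrite /phase big1 ?mulr0// => j _; rewrite mul0r. Qed.

Lemma continuous_coord3 (j : 'I_3) : continuous (coord3 j : point3 R -> R).
Proof.
case: j => -[|[|[|//]]] ? x.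
- apply: (@continuous_comp (R * R * R)%type (R * R)%type R fst fst); exact: cvg_fst.
- apply: (@continuous_comp (R * R * R)%type (R * R)%type R fst snd); [exact: cvg_fst|exact: cvg_snd].
- exact: cvg_snd.
Qed.

Lemma continuous_phase k : continuous (phase L k : point3 R -> R).
Proof.
move=> x; rewrite /continuous_at /phase; apply: cvgM; first exact: cvg_cst.
under eq_cvg do rewrite !big_ord_recl big_ord0; rewrite !big_ord_recl big_ord0.
by do 3?[apply: cvgD]; try exact: cvg_cst; apply: cvgM; try exact: cvg_cst; exact: continuous_coord3.
Qed.

(** Two free coefficients make the class stable under every partial derivative at fixed frequency,
    and a product of two members a sum of two members. *)
Definition trig a b k (x : point3 R) : R := a * cos (phase L k x) + b * sin (phase L k x).

Lemma continuous_trig a b k : continuous (trig a b k).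
Proof.
move=> x; rewrite /continuous_at /trig; apply: cvgD; (apply: cvgM; first exact: cvg_cst).
- apply: (@continuous_comp (R * R * R)%type R R (phase L k) cos); first exact: continuous_phase.
  exact: continuous_cos.
- apply: (@continuous_comp (R * R * R)%type R R (phase L k) sin); first exact: continuous_phase.
  exact: continuous_sin.
Qed.

Lemma is_derive_trig_line a b p c :
  is_derive (0 : R) (1 : R) (fun h : R => a * cos (p + c * h) + b * sin (p + c * h))
    (c * b * cos p + (- (c * a)) * sin p).
Proof.
have dl : is_derive (0 : R) (1 : R) (fun h : R => p + c * h) c.
  apply: is_derive_eq.
  by rewrite add0r mul1r /GRing.scale/= mulr1.
have dc : is_derive (0 : R) (1 : R) (fun h : R => cos (p + c * h)) (- sin p * c).
  have -> : - sin p = - sin (p + c * 0) by rewrite mulr0 addr0.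
  exact: is_derive1_comp.
have ds : is_derive (0 : R) (1 : R) (fun h : R => sin (p + c * h)) (cos p * c).
  have -> : cos p = cos (p + c * 0) by rewrite mulr0 addr0.
  exact: is_derive1_comp.
have -> : c * b * cos p + - (c * a) * sin p = a *: (- sin p * c) + b *: (cos p * c).
  by rewrite /GRing.scale/=; ring.
by apply: is_deriveD.
Qed.

Lemma trig_line a b k j x : (fun h => trig a b k (shift3 j h x)) =
  (fun h => a * cos (phase L k x + omega * (k j)%:~R * h) + b * sin (phase L k x + omega * (k j)%:~R * h)).
Proof. by apply/funext => h; rewrite /trig phase_shift. Qed.

Lemma derivable_trig a b k j x : derivable (fun h => trig a b k (shift3 j h x)) 0 1.
Proof. by rewrite trig_line; have [] := is_derive_trig_line a b (phase L k x) (omega * (k j)%:~R). Qed.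

Lemma partial_trig a b k j : partial j (trig a b k) =
  trig (omega * (k j)%:~R * b) (- (omega * (k j)%:~R * a)) k.
Proof.
apply/funext => x; rewrite /partial trig_line derive1E.
by have [_ ->] := is_derive_trig_line a b (phase L k x) (omega * (k j)%:~R).
Qed.

Lemma smooth3_trig a b k : smooth3 (trig a b k).
Proof.
move=> s; suff [a' [b' ->]] : exists a' b', foldr (@partial R) (trig a b k) s = trig a' b' k.
  by split; [exact: continuous_trig|move=> j x; exact: derivable_trig].
elim: s => [|j s [a' [b' IH]]]; first by exists a, b.
by rewrite /= IH partial_trig; do 2 eexists.
Qed.

Lemma periodic3_trig a b k : periodic3 L (trig a b k).
Proof.
move=> j x; rewrite /trig phase_shift.
rewrite (_ : omega * (k j)%:~R * L = (k j)%:~R * (pi *+ 2)); first by rewrite cos_periodz sin_periodz.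
by rewrite -(mulr_natl _ 2); field; rewrite gt_eqF.
Qed.

Lemma sqint_trig a b k : sqint mu D (trig a b k).
Proof. exact: continuous_sqint (@continuous_trig _ _ _). Qed.

(** For a nonzero frequency the function is itself a partial derivative of a periodic one, in a
    direction [j] with [k j != 0]. *)
Lemma integral_trig a b k : k <> (fun=> 0) -> \int[mu]_(x in D) trig a b k x = 0.
Proof.
move=> k0; have [j kj] : exists j, k j != 0.
  by apply: contrapT => /forallNP h; apply: k0; apply/funext => j; have /negP := h j; rewrite negbK => /eqP.
have w0 : omega * (k j)%:~R != 0.
  by rewrite mulf_neq0 ?intr_eq0// gt_eqF// divr_gt0// mulr_gt0// pi_gt0.
set c := omega * (k j)%:~R in w0.
have -> : trig a b k = partial j (trig (- (b / c)) (a / c) k).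
  rewrite partial_trig -/c; congr trig; first by rewrite mulrCA divff// mulr1.
  by rewrite mulrN opprK mulrCA divff// mulr1.
apply: (integral_partial L_gt0); first exact: periodic3_trig.
  by move=> x; exact: derivable_trig.
rewrite partial_trig; exact: continuous_trig.
Qed.

Lemma integral_trig0 a b : \int[mu]_(x in D) trig a b (fun=> 0) x = a * L ^+ 3.
Proof.
transitivity (\int[mu]_(x in D) a).
  apply: eq_Rintegral.
  by move=> x _; rewrite /trig phase0 cos0 sin0 mulr1 mulr0 addr0.
by rewrite Rintegral_cst ?lebesgue3_box3//; exact: measurable_box3.
Qed.

(* With cos + sin a single real function belongs to each frequency, and the one
   of [-k] is cos - sin. *)
Definition hartley k : point3 R -> R := trig (Num.sqrt (L ^+ 3))^-1 (Num.sqrt (L ^+ 3))^-1 k.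

Lemma partial_hartley j k x :
  partial j (hartley k) x = omega * (k j)%:~R * hartley (fun j => - k j) x.
Proof. by rewrite /hartley partial_trig /trig phaseN cosN sinN; ring. Qed.

Lemma hartley_normsq : (Num.sqrt (L ^+ 3))^-1 ^+ 2 * L ^+ 3 = 1.
Proof.
by rewrite exprVn sqr_sqrtr ?mulVf ?gt_eqF ?exprn_gt0// ltW// exprn_gt0.
Qed.

(** Since [(cos p + sin p) * (cos q + sin q) = cos (p - q) + sin (p + q)], only the cosine at
    frequency [k - l = 0] contributes; the sine integrates to 0 even when [k + l = 0]. *)
Lemma hartley_orthonormal k l : dot mu D (hartley k) (hartley l) = `[< k = l >]%:R.
Proof.
have mD := measurable_box3 L.
pose N := (Num.sqrt (L ^+ 3))^-1.
have e x : hartley k x * hartley l x = trig (N ^+ 2) 0 (fun j => k j + - l j) x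
     + trig 0 (N ^+ 2) (fun j => k j + l j) x.
  rewrite /hartley /trig (phaseD k (fun j => - l j)) phaseN phaseD cosB sinB sinD -/N; ring.
rewrite /dot; under eq_Rintegral do rewrite e.
have it a b k' : mu.-integrable D (EFin \o trig a b k').
  by apply: sqint_integrable => //; exact: sqint_trig.
rewrite RintegralD//.
have -> : \int[mu]_(x in D) trig 0 (N ^+ 2) (fun j => k j + l j) x = 0.
  have [->|] := pselect ((fun j => k j + l j) = (fun=> 0)); first by rewrite integral_trig0 mul0r.
  exact: integral_trig.
rewrite addr0; case: asboolP => [->|kl].
  rewrite (_ : (fun j => l j + - l j) = (fun=> 0)); last by apply/funext => j; rewrite subrr.
  by rewrite integral_trig0 hartley_normsq.
apply: integral_trig => h; apply: kl; apply/funext => j.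
by move/(congr1 (fun f => f j)): h => /eqP; rewrite subr_eq0 => /eqP.
Qed.

Lemma enum_frequencies : exists kappa : nat -> ('I_3 -> int),
  injective kappa /\ forall k, exists n, kappa n = k.
Proof.
pose F := {ffun 'I_3 -> int}.
have /card_set_bijP[f [_ finj fsurj]] : ([set: F] #= [set: nat])%card.
  apply: eq_card_nat; first exact: countableP.
  move=> finF; apply: infinite_nat.
  have : finite_set ((fun n : nat => [ffun=> n%:Z] : F) @^-1` [set: F]).
    apply: finite_preimage => // m n _ _ /ffunP/(_ ord0).
    by rewrite !ffunE => -[].
  by rewrite preimage_setT.
have /choice[g gP] : forall n, exists k : F, f k = n.
  by move=> n; have [k _ kn] := fsurj n I; exists k.
exists (fun n => g n : 'I_3 -> int); split=> [m n|k].
  move=> e; rewrite -(gP m) -(gP n); congr f; apply/ffunP => i.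
  by rewrite -/(fun_of_fin (g m)) e.
exists (f [ffun i => k i]); have -> : g (f [ffun i => k i]) = [ffun i => k i] :> F.
  by apply: finj; rewrite ?inE// gP.
by apply/funext => i; rewrite ffunE.
Qed.

End Trig.

Section Completeness.
Variables (R : realType) (L : R).
Hypothesis L_gt0 : 0 < L.
Notation mu := (lebesgue3 R).
Notation D := (box3 L : set (mpoint3 R)).
Notation omega := (2 * pi / L).
Implicit Types (k l : 'I_3 -> int) (a b : R).

Lemma trigM a b k c d l x : trig L a b k x * trig L c d l x =
  trig L ((a * c - b * d) / 2) ((a * d + b * c) / 2) (fun j => k j + l j) x +
  trig L ((a * c + b * d) / 2) ((b * c - a * d) / 2) (fun j => k j + - l j) x.
Proof.
rewrite /trig (phaseD _ k (fun j => - l j)) phaseN phaseD cosB sinB cosD sinD.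
by field.
Qed.

Lemma bounded_trig a b k : bounded_measurable (trig L a b k : mpoint3 R -> R).
Proof.
split; first exact: continuous_measurable3 (@continuous_trig _ _ _ _ _).
exists (`|a| + `|b|) => x; apply: le_trans (ler_normD _ _) _.
by rewrite !normrM lerD// ler_piMr// ?cos_max ?sin_max.
Qed.

(* On the half-open cube the trigonometric functions separate points; on [D]
   they identify opposite faces. *)
Let H : set (mpoint3 R) := (`[0, L[ `*` `[0, L[) `*` `[0, L[.

Let mH : measurable H.
Proof. by apply: measurableX; [apply: measurableX|]; exact: measurable_itv. Qed.

Let HD : H `<=` D.
Proof.
have s (t : R) : t \in `[0, L[ -> t \in `[0, L] by rewrite !in_itv/= => /andP[-> /ltW ->].
by move=> [[x y] z] [[/= hx hy] hz]; split; [split|]; exact: s.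
Qed.

Let muDH : mu (D `\` H) = 0%E.
Proof.
pose I : set (measurableTypeR R) := [set` `[0, L]].
have mI : measurable I by exact: measurable_itv.
pose P := [set L] : set (measurableTypeR R).
have mP : measurable P by exact: measurable_set1.
have P0 : lebesgue_measure P = 0%E by exact: lebesgue_measure_set1.
pose U := ((P `*` I) `*` I) `|` ((I `*` P) `*` I) `|` ((I `*` I) `*` P).
have mU : measurable U.
  by apply: measurableU; [apply: measurableU|]; apply: measurableX => //; exact: measurableX.
have U0 : mu U = 0%E.
  rewrite !null_set_setU //; do ?[exact: measurableX|apply: measurableX => //; exact: measurableX|apply: measurableU];
    rewrite ?lebesgue3X// ?[lebesgue_measure P]P0 ?mul0e ?mule0 ?mul0e//.
apply: (@subset_measure0 _ _ _ mu _ U) => //; first by apply: measurableD => //; exact: measurable_box3.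
move=> [[x y] z] [[[/= hx hy] hz] nH].
have [xL|xL] := eqVneq x L; first by left; left; rewrite xL; split => //; split.
have [yL|yL] := eqVneq y L; first by left; right; rewrite yL; split => //; split.
have [zL|zL] := eqVneq z L; first by right; rewrite zL; split => //; split.
exfalso; apply: nH; move: hx hy hz; rewrite /= !in_itv/= => /andP[x0 xl] /andP[y0 yl] /andP[z0 zl].
by split; [split|]; rewrite /= in_itv/= ?x0 ?y0 ?z0/= lt_neqAle ?xL ?yL ?zL.
Qed.

Let RintegralH (f : mpoint3 R -> R) : mu.-integrable D (EFin \o f) ->
  \int[mu]_(x in D) f x = \int[mu]_(x in H) f x.
Proof.
move=> intf; rewrite /Rintegral (@negligible_integral _ _ _ mu D (D `\` H))//.
- by rewrite setDD setIidr.
- by apply: measurableD => //; exact: measurable_box3.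
- exact: measurable_box3.
Qed.

Variable w : mpoint3 R -> R.
Hypothesis iw : mu.-integrable D (EFin \o w).
Hypothesis w0 : forall k, \int[mu]_(x in D) (w x * cos (phase L k x)) = 0 /\
  \int[mu]_(x in D) (w x * sin (phase L k x)) = 0.

Let tests : set (mpoint3 R -> R) := [set h | exists a b k, h = trig L a b k].

Let btests h : tests h -> bounded_measurable h.
Proof. by move=> [a [b [k ->]]]; exact: bounded_trig. Qed.

Let iwH : mu.-integrable H (EFin \o w).
Proof. by apply: integrableS iw => //; exact: measurable_box3. Qed.

Let ann1 : annihilated mu H w tests (fun=> 1).
Proof.
have mD := measurable_box3 L.
split=> [|_ [a [b [k ->]]]]; first exact: bounded_measurable_cst.
have ic a' b' := integrable_bounded_mul mD iw (bounded_trig a' b' k).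
transitivity (\int[mu]_(x in D) (w x * trig L a b k x)).
  by rewrite RintegralH//; apply: eq_Rintegral => x _; rewrite mulr1.
transitivity (\int[mu]_(x in D) (a * (w x * trig L 1 0 k x) + b * (w x * trig L 0 1 k x))).
  by apply: eq_Rintegral => x _; rewrite /trig; ring.
rewrite RintegralD//; [|by apply: (integrableZl mD _ (ic _ _))..].
rewrite !RintegralZl//; [|exact: ic..].
have -> : \int[mu]_(x in D) (w x * trig L 1 0 k x) = 0.
  by rewrite -[RHS](w0 k).1; apply: eq_Rintegral => x _; rewrite /trig mul1r mul0r addr0.
have -> : \int[mu]_(x in D) (w x * trig L 0 1 k x) = 0.
  by rewrite -[RHS](w0 k).2; apply: eq_Rintegral => x _; rewrite /trig mul1r mul0r add0r.
by rewrite !mulr0 addr0.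
Qed.

(** By [trigM] a product of two tests is a sum of two tests, which is the algebra property. *)
Let mult_trig c d l : multiplier mu H w tests (trig L c d l).
Proof.
split=> [|g [bg g0]]; first exact: bounded_trig.
split=> [|_ [a [b [k ->]]]]; first by apply: bounded_measurableM => //; exact: bounded_trig.
pose t1 := trig L ((c * a - d * b) / 2) ((c * b + d * a) / 2) (fun j => l j + k j).
pose t2 := trig L ((c * a + d * b) / 2) ((d * a - c * b) / 2) (fun j => l j + - k j).
transitivity (\int[mu]_(x in H) (w x * (g x * t1 x) + w x * (g x * t2 x))).
  by apply: eq_Rintegral => x _; rewrite -!mulrA trigM -/(t1 x) -/(t2 x); ring.
rewrite RintegralD//; [|by apply: (integrable_bounded_mul mH iwH); apply: bounded_measurableM => //; exact: bounded_trig..].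
have e a' b' k' : \int[mu]_(x in H) (w x * (g x * trig L a' b' k' x)) = 0.
  rewrite -[RHS](g0 (trig L a' b' k')); last by exists a', b', k'.
  by apply: eq_Rintegral => x _; rewrite mulrA.
by rewrite !e addr0.
Qed.

Let msets : set (set (mpoint3 R)) :=
  [set A | exists2 B, multiplier_set mu H w tests B & A `&` H = B `&` H].

Let salg := sigma_algebra_multiplier mH iwH btests H.

Let msetsI A B : msets A -> msets B -> msets (A `&` B).
Proof.
move=> [A' mA' AA'] [B' mB' BB']; exists (A' `&` B'); first exact: multiplier_setI.
by rewrite setIIl AA' BB' -setIIl.
Qed.

Let unit_freq (j : 'I_3) : 'I_3 -> int := fun i => (i == j)%:Z.

Let phase_unit j x : phase L (unit_freq j) x = omega * coord3 j x.
Proof.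
rewrite /phase (bigD1 j)//= /unit_freq eqxx mul1r big1 ?addr0// => i /negbTE ->.
by rewrite mul0r.
Qed.

Let msets_gt (a b c : R) j : (forall x, `|trig L a b (unit_freq j) x| <= 1) -> `|c| <= 1 ->
  multiplier_set mu H w tests [set x | c < trig L a b (unit_freq j) x].
Proof. by move=> t1 c1; exact: (multiplier_gt mH iwH btests (mult_trig _ _ _)). Qed.

Let cos_unit j x : trig L (-1) 0 (unit_freq j) x = - cos (omega * coord3 j x).
Proof. by rewrite /trig phase_unit mul0r addr0 mulN1r. Qed.

Let sin_unit j x : trig L 0 (-1) (unit_freq j) x = - sin (omega * coord3 j x).
Proof. by rewrite /trig phase_unit mul0r add0r mulN1r. Qed.

Let coordH j x : H x -> 0 <= coord3 j x < L.
Proof.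
move=> [[]]; rewrite /= !in_itv/= => hx hy hz.
by case: j => -[|[|[|//]]].
Qed.

Let omega_gt0 : 0 < omega.
Proof. by rewrite divr_gt0// mulr_gt0// pi_gt0. Qed.

Let omegaL t : omega * t < 2 * pi = (t < L).
Proof. by rewrite -(ltr_pM2l omega_gt0 t L); congr (_ < _); field; rewrite gt_eqF. Qed.

(** On the half-open cube the angle [omega * x_j] runs through [[0, 2 pi[]. For a threshold
    [g < pi], being beyond [g] means [sin < 0] or [cos < cos g]; for [g >= pi] it means [sin < 0]
    and [cos > cos g]. *)
Let msets_ray j c : msets (coord3 j @^-1` [set` `]c, +oo[]).
Proof.
have sinle x : `|trig L 0 (-1) (unit_freq j) x| <= 1 by rewrite sin_unit normrN sin_max.
have cosle x : `|trig L (-1) 0 (unit_freq j) x| <= 1 by rewrite cos_unit normrN cos_max.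
have pi0 := pi_gt0 R.
have [c0|c0] := ltP c 0.
  exists setT; first by rewrite -setC0; apply: (multiplier_setC mH iwH btests); exact: multiplier_set0.
  apply/seteqP; split => x [_ Hx]; split => //=; rewrite in_itv/= andbT.
  by apply: lt_le_trans c0 _; case/andP: (coordH j Hx).
have [Lc|cL] := leP L c.
  exists set0; first exact: multiplier_set0.
  apply/seteqP; split => x [] //= + Hx; rewrite in_itv/= andbT => cx.
  by have /andP[_ /lt_le_trans/(_ Lc)] := coordH j Hx; rewrite ltNge ltW.
pose g := omega * c.
have g0 : 0 <= g by rewrite mulr_ge0// ltW.
have g2 : g < 2 * pi by rewrite omegaL.
have xg x : (c < coord3 j x) = (g < omega * coord3 j x) by rewrite ltr_pM2l.
have sin_neg (t : R) : pi < t < 2 * pi -> sin t < 0.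
  move=> /andP[pt t2]; rewrite -(subrK pi t) sinDpi oppr_lt0 sin_gt0_pi//; lra.
have cosB2 (t : R) : cos (2 * pi - t) = cos t.
  by rewrite cosB (_ : 2 * pi = pi *+ 2) ?cos2pi ?sin2pi ?mul1r ?mul0r ?addr0// mulr_natl.
have [gpi|pig] := ltP g pi.
  exists ([set x | 0 < trig L 0 (-1) (unit_freq j) x] `|` [set x | - cos g < trig L (-1) 0 (unit_freq j) x]).
    apply: (multiplier_setU mH iwH btests); apply: msets_gt => //; rewrite ?normr0// normrN cos_max//.
  apply/seteqP; split => x [] /= h Hx; split => //; move: h; rewrite /= in_itv/= andbT xg sin_unit cos_unit;
    have /andP[x0] := coordH j Hx; rewrite -omegaL => x2; have {}x0 : 0 <= omega * coord3 j x by rewrite mulr_ge0// ltW.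
  + move=> gx; have [xpi|xpi] := leP (omega * coord3 j x) pi.
      by right; rewrite ltrN2 ltr_cos// in_itv/= ?x0 ?g0//= ltW.
    by left; rewrite oppr_gt0 sin_neg// xpi.
  + case=> [|].
      rewrite oppr_gt0 => sx; have [xpi|xpi] := leP (omega * coord3 j x) pi; last exact: lt_trans gpi xpi.
      by have := sin_ge0_pi (introT andP (conj x0 xpi)); rewrite leNgt sx.
    rewrite ltrN2; have [xpi|xpi] := leP (omega * coord3 j x) pi; last by move=> _; exact: lt_trans gpi xpi.
    by rewrite ltr_cos// in_itv/= ?x0 ?g0//= ltW.
have cos1 x : trig L 1 0 (unit_freq j) x = cos (omega * coord3 j x).
  by rewrite /trig phase_unit mul0r addr0 mul1r.
exists ([set x | 0 < trig L 0 (-1) (unit_freq j) x] `&` [set x | cos g < trig L 1 0 (unit_freq j) x]).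
  apply: multiplier_setI; apply: msets_gt => //; rewrite ?normr0 ?cos_max//.
  by move=> x; rewrite cos1 cos_max.
apply/seteqP; split => x [] /= h Hx; split => //; move: h; rewrite /= in_itv/= andbT xg sin_unit cos1;
  have /andP[x0] := coordH j Hx; rewrite -omegaL => x2; have {}x0 : 0 <= omega * coord3 j x by rewrite mulr_ge0// ltW.
- move=> gx; split; first by rewrite oppr_gt0 sin_neg// x2 andbT; exact: le_lt_trans pig gx.
  rewrite -(cosB2 g) -(cosB2 (_ * _)) ltr_cos ?in_itv/=; try (apply/andP; split); lra.
- rewrite oppr_gt0 => -[sx]; have [xpi|xpi] := leP (omega * coord3 j x) pi.
    by have := sin_ge0_pi (introT andP (conj x0 xpi)); rewrite leNgt sx.
  rewrite -(cosB2 g) -(cosB2 (_ * _)) ltr_cos ?in_itv/=; [lra|apply/andP; split; lra..].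
Qed.

Let msets_coord j (B : set (measurableTypeR R)) : measurable B -> msets (coord3 j @^-1` B).
Proof.
have [s0 sC sU] := salg.
have sub : <<s @RGenOInfty.G R >> `<=` [set B | msets (coord3 j @^-1` B)].
  apply: smallest_sub; last by move=> _ [c ->]; exact: msets_ray.
  split.
  - by rewrite /= preimage_set0; exact: s0.
  - by move=> A mA; have := sC _ mA; rewrite !setTD.
  - by move=> A mA; rewrite /= preimage_bigcup; exact: sU.
by move=> mB; apply: sub; exact: (eq_ind _ (fun S => S B) mB _ (RGenOInfty.measurableE R)).
Qed.

Let msets_fst (A : set (measurableTypeR R * measurableTypeR R)) : measurable A ->
  msets (fst @^-1` A : set (mpoint3 R)).
Proof.
have [s0 sC sU] := salg.
rewrite measurable_prod_measurableType;
suff sub : <<s [set A `*` B | A in (measurable : set (set (measurableTypeR R))) &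
    B in (measurable : set (set (measurableTypeR R)))] >> `<=` [set A | msets (fst @^-1` A)].
  by move=> mA; exact: sub.
apply: smallest_sub; last first.
  move=> _ [A1 mA1 [A2 mA2 <-]].
  exact: msetsI (@msets_coord ord0 _ mA1) (@msets_coord (Ordinal (isT : (1 < 3)%N)) _ mA2).
split.
- by rewrite /= preimage_set0; exact: s0.
- by move=> B mB; have := sC _ mB; rewrite !setTD.
- by move=> B mB; rewrite /= preimage_bigcup; exact: sU.
Qed.

Let msets_measurable (A : set (mpoint3 R)) : measurable A -> msets A.
Proof.
rewrite measurable_prod_measurableType.
suff sub : <<s [set A `*` B | A in (measurable : set (set (measurableTypeR R * measurableTypeR R))) &
    B in (measurable : set (set (measurableTypeR R)))] >> `<=` msets by move=> mA; exact: sub.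
apply: smallest_sub; first exact: salg.
move=> _ [A1 mA1 [A2 mA2 <-]].
exact: msetsI (@msets_fst _ mA1) (@msets_coord (Ordinal (isT : (2 < 3)%N)) _ mA2).
Qed.

Let integral_indic0 (A : set (mpoint3 R)) : measurable A ->
  \int[mu]_(x in H) (w x * \1_A x) = 0.
Proof.
move=> /msets_measurable[B [_ mB] AB].
have [_ /(_ (trig L 1 0 (fun=> 0)))] := mB _ ann1.
move=> /(_ _) <-; last by exists 1, 0, (fun=> 0).
apply: eq_Rintegral => x /set_mem Hx; rewrite /trig phase0 cos0 sin0 mulr0 addr0 !mulr1 mul1r.
rewrite !indicE; congr (_ * _%:R); congr nat_of_bool; apply/idP/idP; rewrite !inE => h.
  by have [] : (B `&` H) x by rewrite -AB.
by have [] : (A `&` H) x by rewrite AB.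
Qed.

(** Writing [|w| = 2 * w * 1_A - w] with [A] the set where [w > 0], orthogonality to indicators
    makes the integral of [|w|] vanish. *)
Lemma trig_complete : {ae mu, forall x, D x -> w x = 0}.
Proof.
have mD := measurable_box3 L.
have mw : measurable_fun D w by apply/measurable_EFinP; exact: measurable_int iw.
pose A := D `&` w @^-1` [set` `]0, +oo[].
have mA : measurable A by apply: mw => //; exact: measurable_itv.
have ibm B : measurable B -> mu.-integrable H (EFin \o (fun x => w x * \1_B x)).
  move=> mB; apply: (integrable_bounded_mul mH iwH); split; first exact: measurable_indic.
  by exists 1 => x; rewrite indicE; case: (_ \in _); rewrite ?normr1 ?normr0.
have h : \int[mu]_(x in H) `|w x| = 0.
  transitivity (\int[mu]_(x in H) (2 * (w x * \1_A x) - w x * \1_setT x)).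
    apply: eq_Rintegral => x /set_mem Hx; rewrite !indicE (in_setT x) mulr1.
    have [w0x|w0x] := ltP 0 (w x).
      rewrite mem_set; last by split; [exact: HD|rewrite /= in_itv/= w0x].
      by rewrite gtr0_norm// mulr1; lra.
    rewrite memNset; last by move=> [_]; rewrite /= in_itv/= andbT ltNge w0x.
    by rewrite ler0_norm// !mulr0 sub0r.
  rewrite RintegralB//; [|by apply: (integrableZl mH _ (ibm _ _))|exact: ibm].
  by rewrite RintegralZl//; [rewrite !integral_indic0// mulr0 subr0|exact: ibm].
have {}h : \int[mu]_(x in D) `|w x| = 0.
  by rewrite RintegralH//; exact: (integrable_abse iw).
have /(ae_eq_integral_abs mu mD) : measurable_fun D (EFin \o w) by apply/measurable_EFinP.
case=> + _; rewrite /ae_eq => ae.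
have {}ae := ae _.
suff h' : (\int[mu]_(x in D) `|(EFin \o w) x| = 0)%E.
  by apply: filterS (ae h') => x wx Dx; have [] := wx Dx.
have := integrable_fin_num mD (integrable_abse iw).
by move/fineK <-; rewrite -[RHS]/(0%:E); congr EFin.
Qed.

End Completeness.

(** * Hartley coefficients, Parseval and synthesis *)

Definition freq : nat -> 'I_3 -> int := projT1 (cid enum_frequencies).

Lemma freq_inj : injective freq.
Proof. by have [] := projT2 (cid enum_frequencies). Qed.

Lemma freq_surj k : exists n, freq n = k.
Proof. by have [_] := projT2 (cid enum_frequencies); apply. Qed.

Definition negk (k : 'I_3 -> int) : 'I_3 -> int := fun j => - k j.

Lemma negkK : involutive negk.
Proof. by move=> k; apply/funext => j; rewrite /negk opprK. Qed.

Section Fourier.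
Variables (R : realType) (L : R).
Hypothesis L_gt0 : 0 < L.
Notation mu := (lebesgue3 R).
Notation D := (box3 L : set (mpoint3 R)).
Notation omega := (2 * pi / L).
Notation hartley := (hartley L).
Implicit Types (k l : 'I_3 -> int) (f g : mpoint3 R -> R).

Let mD : measurable D := measurable_box3 L.

Definition hc f k : R := dot mu D f (hartley k).

Definition l2p f := [/\ periodic3 L f, measurable_fun [set: mpoint3 R] f &
  mu.-integrable D (EFin \o (fun x => f x ^+ 2))].

Lemma l2p_sqint f : l2p f -> sqint mu D f.
Proof. by move=> [_ mf f2]; split => //; exact: measurable_funTS. Qed.

Lemma sqint_hartley k : sqint mu D (hartley k).
Proof. exact: sqint_trig. Qed.

Lemma hartley_negE k (x : mpoint3 R) : hartley (negk k) x =
  trig L (Num.sqrt (L ^+ 3))^-1 (- (Num.sqrt (L ^+ 3))^-1) k x.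
Proof. by rewrite /hartley /trig phaseN cosN sinN; ring. Qed.

Lemma sqrtL3_gt0 : 0 < Num.sqrt (L ^+ 3).
Proof. by rewrite sqrtr_gt0 exprn_gt0. Qed.

Lemma integral_cos_hc f k : sqint mu D f ->
  \int[mu]_(x in D) (f x * cos (phase L k x)) = Num.sqrt (L ^+ 3) / 2 * (hc f k + hc f (negk k)).
Proof.
move=> sf; rewrite /hc -dotDr//; [|exact: sqint_hartley..].
rewrite -dotZr//; last by apply: sqintD => //; exact: sqint_hartley.
apply: eq_Rintegral => x _; rewrite hartley_negE /hartley /trig.
by field; rewrite gt_eqF ?sqrtL3_gt0.
Qed.

Lemma integral_sin_hc f k : sqint mu D f ->
  \int[mu]_(x in D) (f x * sin (phase L k x)) = Num.sqrt (L ^+ 3) / 2 * (hc f k - hc f (negk k)).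
Proof.
move=> sf; rewrite /hc -dotBr//; [|exact: sqint_hartley..].
rewrite -dotZr//; last by apply: sqintB => //; exact: sqint_hartley.
apply: eq_Rintegral => x _; rewrite hartley_negE /hartley /trig.
by field; rewrite gt_eqF ?sqrtL3_gt0.
Qed.

Lemma hc_cos_sin f k : sqint mu D f ->
  hc f k = (Num.sqrt (L ^+ 3))^-1 * (\int[mu]_(x in D) (f x * cos (phase L k x)) +
    \int[mu]_(x in D) (f x * sin (phase L k x))).
Proof.
by move=> sf; rewrite integral_cos_hc// integral_sin_hc//; field; rewrite gt_eqF ?sqrtL3_gt0.
Qed.

Lemma hc0_mean f : sqint mu D f -> hc f (fun=> 0) = (Num.sqrt (L ^+ 3))^-1 * \int[mu]_(x in D) f x.
Proof.
move=> sf; rewrite -RintegralZl//; last exact: sqint_integrable.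
by apply: eq_Rintegral => x _; rewrite /hartley /trig phase0 cos0 sin0; ring.
Qed.

Lemma hartley_ae_eq0 f : sqint mu D f -> (forall k, hc f k = 0) ->
  {ae mu, forall x, D x -> f x = 0}.
Proof.
move=> sf f0; apply: trig_complete => //; first exact: sqint_integrable.
by move=> k; rewrite integral_cos_hc// integral_sin_hc// !f0 addr0 subr0 mulr0.
Qed.

Lemma ae_eq0_dot f : sqint mu D f -> {ae mu, forall x, D x -> f x = 0} -> dot mu D f f = 0.
Proof.
move=> [mf f2] ae; rewrite /dot /Rintegral (ae_eq_integral (cst 0%E))// ?integral0//.
- by apply/measurable_EFinP; exact: measurable_funM.
- by apply: filterS ae => x fx Dx /=; rewrite fx// mulr0.
Qed.

Section Enumeration.
Variable kappa : nat -> 'I_3 -> int.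
Hypothesis kappa_inj : injective kappa.

Lemma hartley_enum_orthonormal m n :
  dot mu D (hartley (kappa m)) (hartley (kappa n)) = (m == n)%:R.
Proof.
rewrite hartley_orthonormal//; congr (_%:R); congr nat_of_bool.
by apply/asboolP/eqP => [/kappa_inj|->].
Qed.

Lemma hartley_bessel f n : sqint mu D f -> \sum_(0 <= i < n) hc f (kappa i) ^+ 2 <= dot mu D f f.
Proof.
move=> sf; apply: (bessel mD (fun n => sqint_hartley (kappa n)) hartley_enum_orthonormal) => //.
Qed.

Hypothesis kappa_surj : forall k, exists n, kappa n = k.

Lemma hartley_parseval f g : sqint mu D f -> sqint mu D g ->
  series (fun n => hc f (kappa n) * hc g (kappa n)) @ \oo --> dot mu D f g.
Proof.
apply: (parseval mD _ (fun n => sqint_hartley (kappa n)) hartley_enum_orthonormal).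
- by move=> n; apply: continuous_measurable3; exact: continuous_trig.
- move=> h sh h0; apply: ae_eq0_dot => //; apply: hartley_ae_eq0 => // k.
  by have [n <-] := kappa_surj k; exact: h0.
Qed.

Lemma hartley_synthesis (a : ('I_3 -> int) -> R) (B : R) :
  (forall n, \sum_(0 <= i < n) a (kappa i) ^+ 2 <= B) ->
  exists w, l2p w /\ forall k, hc w k = a k.
Proof.
move=> aB; have [|w [mw sw wp wa _]] := @riesz_fischer _ _ _ mu D mD
  (fun n => hartley (kappa n)) _ (fun n => sqint_hartley (kappa n)) hartley_enum_orthonormal (a \o kappa) B aB.
  by move=> n; apply: continuous_measurable3; exact: continuous_trig.
exists w; split; last by move=> k; have [n <-] := kappa_surj k; exact: wa.
split=> //; last by case: sw.
by move=> j x; apply: wp => n; exact: periodic3_trig.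
Qed.

End Enumeration.

Lemma freqN_inj : injective (negk \o freq).
Proof. by move=> m n /(inv_inj negkK)/freq_inj. Qed.

Lemma freqN_surj k : exists n, (negk \o freq) n = k.
Proof. by have [n nk] := freq_surj (negk k); exists n; rewrite /= nk negkK. Qed.

(** One side is expanded along [freq] and the other along [negk \o freq], so the two series agree
    term by term and no rearrangement is involved. This is why Parseval is proved for an arbitrary
    enumeration. *)
Lemma dot_coef_eqN f g f' g' : sqint mu D f -> sqint mu D g -> sqint mu D f' -> sqint mu D g' ->
  (forall k, hc f k * hc g k = hc f' (negk k) * hc g' (negk k)) -> dot mu D f g = dot mu D f' g'.
Proof.
move=> sf sg sf' sg' e.
have := hartley_parseval freq_inj freq_surj sf sg.
have := hartley_parseval freqN_inj freqN_surj sf' sg'.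
under [X in series X]eq_fun do rewrite /= -e.
by move=> h1 h2; exact: (cvg_unique _ h2 h1).
Qed.

Lemma hartley_synthesis_dom (a : ('I_3 -> int) -> R) y C : sqint mu D y ->
  (forall k, `|a k| <= C * `|hc y k|) -> exists w, l2p w /\ forall k, hc w k = a k.
Proof.
move=> sy aC; apply: (@hartley_synthesis freq freq_inj freq_surj _ (C ^+ 2 * dot mu D y y)) => n.
apply: le_trans (_ : C ^+ 2 * \sum_(0 <= i < n) hc y (freq i) ^+ 2 <= _); last first.
  by rewrite ler_wpM2l ?sqr_ge0// hartley_bessel//; exact: freq_inj.
rewrite mulr_sumr; apply: ler_sum => i _; rewrite -exprMn -[leLHS]real_normK ?num_real//.
rewrite -[leRHS]real_normK ?num_real// ler_pXn2r ?nnegrE//.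
apply: le_trans (aC _) _; rewrite normrM ler_wpM2r//; exact: ler_norm.
Qed.

Lemma hartley_synthesis_domN (a : ('I_3 -> int) -> R) y C : sqint mu D y ->
  (forall k, `|a k| <= C * `|hc y (negk k)|) -> exists w, l2p w /\ forall k, hc w k = a k.
Proof.
move=> sy aC.
have [|w [lw wa]] := @hartley_synthesis (negk \o freq) freqN_inj freqN_surj a (C ^+ 2 * dot mu D y y).
  move=> n; apply: le_trans (_ : C ^+ 2 * \sum_(0 <= i < n) hc y (freq i) ^+ 2 <= _); last first.
    by rewrite ler_wpM2l ?sqr_ge0// hartley_bessel//; exact: freq_inj.
  rewrite mulr_sumr; apply: ler_sum => i _; rewrite -exprMn -[leLHS]real_normK ?num_real//.
  rewrite -[leRHS]real_normK ?num_real// ler_pXn2r ?nnegrE//.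
  apply: le_trans (aC _) _; rewrite /= negkK normrM ler_wpM2r//; exact: ler_norm.
by exists w.
Qed.

End Fourier.

Lemma powRMhalf (R : realType) (x : R) : 0 <= x -> x `^ (1/2) * x `^ (1/2) = x.
Proof.
move=> x0; have e : (1 / 2 + 1 / 2 : R) = 1 by field.
by rewrite -powRD e ?powRr1// oner_eq0.
Qed.

(** * Fourier coefficients of derivatives and of powers of the Stokes operator *)

Section WeakDerivatives.
Variables (R : realType) (L : R).
Hypothesis L_gt0 : 0 < L.
Notation mu := (lebesgue3 R).
Notation D := (box3 L : set (mpoint3 R)).
Notation omega := (2 * pi / L).
Notation hartley := (hartley L).
Notation hc := (hc L).
Notation l2p := (l2p L).
Implicit Types (k l : 'I_3 -> int) (f g : mpoint3 R -> R).

Let mD : measurable D := measurable_box3 L.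

Lemma shift30 (j : 'I_3) (x : point3 R) : shift3 j 0 x = x.
Proof.
by case: j => -[|[|[|//]]] ?; case: x => -[? ?] ?; rewrite /shift3 /= addr0.
Qed.

Lemma smooth3_continuous phi : smooth3 phi -> continuous (phi : point3 R -> R).
Proof. by move=> /(_ [::])[]. Qed.

Lemma smooth3_derivable phi j (x : point3 R) : smooth3 phi ->
  derivable (fun h : R => phi (shift3 j h x)) 0 1.
Proof. by move=> /(_ [::])[]. Qed.

Lemma smooth3_partial_continuous phi j : smooth3 phi -> continuous (partial j phi : point3 R -> R).
Proof. by move=> /(_ [:: j])[]. Qed.

Lemma smooth3_hartley k : smooth3 (hartley k).
Proof. exact: smooth3_trig. Qed.

(** The derivative of [phi * hartley k] integrates to 0, and differentiating the Hartley function
    moves the coefficient to [-k]. *)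
Lemma hc_partial phi j k : smooth3 phi -> periodic3 L phi ->
  hc (partial j phi) k = - (omega * (k j)%:~R * hc phi (negk k)).
Proof.
move=> sphi pphi.
have cphi := smooth3_continuous sphi; have cdphi := @smooth3_partial_continuous _ j sphi.
have ch k' : continuous (hartley k') by exact: continuous_trig.
have e : partial j (fun x => phi x * hartley k x) =
    (fun x => partial j phi x * hartley k x + phi x * (omega * (k j)%:~R * hartley (negk k) x)).
  apply/funext => x; rewrite -partial_hartley /partial !derive1E.
  rewrite deriveM; [|exact: smooth3_derivable|exact: derivable_trig].
  by rewrite !shift30 /GRing.scale /= addrC; congr (_ + _); rewrite mulrC.
have sphi' : sqint mu D phi by exact: continuous_sqint.
have sdphi : sqint mu D (partial j phi) by exact: continuous_sqint.
have : \int[mu]_(x in D) partial j (fun x => phi x * hartley k x) x = 0.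
  apply: (integral_partial L_gt0).
  - by move=> i x; rewrite pphi; congr (_ * _); exact: periodic3_trig.
  - move=> x; apply: derivableM; first exact: smooth3_derivable.
    exact: derivable_trig.
  - rewrite e => x; apply: cvgD; apply: cvgM; [exact: cdphi|exact: ch|exact: cphi|].
    by apply: cvgM; [exact: cvg_cst|exact: ch].
rewrite e RintegralD//; last 2 first.
- by apply: sqint_mul => //; exact: sqint_hartley.
- by apply: sqint_mul => //; apply: sqintZ => //; exact: sqint_hartley.
have -> : \int[mu]_(x in D) (phi x * (omega * (k j)%:~R * hartley (negk k) x)) =
    omega * (k j)%:~R * hc phi (negk k).
  by rewrite -dotZr//; exact: sqint_hartley.
by move=> /eqP; rewrite addr_eq0 => /eqP.
Qed.

(** Forwards, Hartley functions are admissible test functions; backwards, Parseval recovers the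
    identity for every smooth periodic one. *)
Lemma is_wpartialP j g dg : sqint mu D g -> is_wpartial L j g dg <->
  l2p dg /\ forall k, hc dg k = - (omega * (k j)%:~R * hc g (negk k)).
Proof.
move=> sg; split=> [[/(_ tt) ldg h]|[ldg h]].
  split=> // k; rewrite -[LHS]opprK; congr (- _).
  rewrite -[LHS](h (hartley k))//; [|exact: smooth3_hartley|exact: periodic3_trig].
  rewrite -dotZr//; last exact: sqint_hartley.
  by apply: eq_Rintegral => x _; rewrite partial_hartley.
split=> // phi sphi pphi.
have sdg := l2p_sqint ldg.
have sphi' : sqint mu D phi by apply: continuous_sqint => //; exact: smooth3_continuous.
have sdphi : sqint mu D (partial j phi).
  by apply: continuous_sqint => //; exact: smooth3_partial_continuous.
have -> : - (\int[mu]_(x in D) (dg x * phi x)) = dot mu D (fun x => (-1) * dg x) phi.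
  by rewrite dotZl// mulN1r.
apply: (@dot_coef_eqN _ _ L_gt0) => //; first exact: sqintZ.
move=> k; rewrite /hc dotZl//; last exact: sqint_hartley.
rewrite -/(hc dg _) -/(hc _ _) -/(hc _ _) hc_partial// h negkK /negk mulrNz.
by rewrite -/(hc _ _); ring.
Qed.

Lemma wpartialP j g dg : sqint mu D g -> is_wpartial L j g dg ->
  l2p (wpartial L j g) /\
  forall k, hc (wpartial L j g) k = - (omega * (k j)%:~R * hc g (negk k)).
Proof. by move=> sg wg; apply/is_wpartialP => //; exact: (getPex (ex_intro _ dg wg)). Qed.

End WeakDerivatives.

Section StokesCoefficients.
Variables (R : realType) (L : R).
Hypothesis L_gt0 : 0 < L.
Notation mu := (lebesgue3 R).
Notation D := (box3 L : set (mpoint3 R)).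
Notation omega := (2 * pi / L).
Notation hartley := (hartley L).
Notation hc := (hc L).
Notation l2p := (l2p L).
Implicit Types (k l : 'I_3 -> int).

Let mD : measurable D := measurable_box3 L.

Lemma L2per_sqint (I : finType) (w : field R I) i : L2per L w -> sqint mu D (w i).
Proof. by move=> /(_ i); exact: l2p_sqint. Qed.

Lemma ip_sum_dot (I : finType) (w z : field R I) :
  (forall i, sqint mu D (w i)) -> (forall i, sqint mu D (z i)) ->
  ip L w z = \sum_i dot mu D (w i) (z i).
Proof.
move=> lw lz; rewrite /ip.
have h (r : seq I) : \int[mu]_(x in D) (\sum_(i <- r) w i x * z i x) = \sum_(i <- r) dot mu D (w i) (z i)
    /\ mu.-integrable D (EFin \o (fun x => \sum_(i <- r) w i x * z i x)).
  elim: r => [|i r [IH1 IH2]].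
    split; first by under eq_Rintegral do rewrite big_nil; rewrite big_nil Rintegral_cst// mul0r.
    rewrite (_ : _ \o _ = cst 0%E); first exact: integrable0.
    by apply/funext => x /=; rewrite big_nil.
  have ii : mu.-integrable D (EFin \o (fun x => w i x * z i x)) by exact: sqint_mul.
  rewrite (_ : (fun x => \sum_(i <- i :: r) _) = (fun x => w i x * z i x + \sum_(i <- r) w i x * z i x)).
    split; first by rewrite RintegralD// IH1 big_cons.
    exact: (integrableD mD ii IH2).
  by apply/funext => x; rewrite big_cons.
exact: (h (index_enum I)).1.
Qed.

Lemma eigvalN k : eigval L (negk k) = eigval L k.
Proof.
by rewrite /eigval; congr (_ * _); apply: eq_bigr => j _; rewrite /negk mulrNz sqrrN.
Qed.

Lemma L2per0P (I : finType) (w : field R I) : L2per0 L w <->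
  L2per L w /\ forall i, hc (w i) (fun=> 0) = 0.
Proof.
split=> -[lw h]; split=> // i.
  by rewrite hc0_mean ?h ?mulr0//; exact: L2per_sqint.
have := h i; rewrite hc0_mean//; last exact: L2per_sqint.
by move=> /eqP; rewrite mulf_eq0 invr_eq0 gt_eqF ?sqrtL3_gt0//= => /eqP.
Qed.

(** The cosine and sine integrals at [k] mix the Hartley coefficients at [k] and [-k]; as both
    frequencies have the same eigenvalue, the factor passes through. *)
Lemma is_ApowP (I : finType) s (w z : field R I) : L2per L w -> is_Apow L s w z <->
  L2per0 L z /\ forall i k, hc (z i) k = eigval L k `^ s * hc (w i) k.
Proof.
move=> lw; have sw i := L2per_sqint i lw.
split=> -[lz h]; split=> // i k; have sz i := L2per_sqint i lz.1.
  rewrite !hc_cos_sin//; have [-> ->] := h i k; ring.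
rewrite !integral_cos_hc// !integral_sin_hc// !h eigvalN; split; ring.
Qed.

Lemma eigval_gt0 k : k <> (fun=> 0) -> 0 < eigval L k.
Proof.
move=> k0; have [j kj] : exists j, k j != 0.
  by apply: contrapT => /forallNP h; apply: k0; apply/funext => j; have /negP := h j; rewrite negbK => /eqP.
rewrite /eigval mulr_gt0 ?exprn_gt0 ?divr_gt0 ?mulr_gt0 ?pi_gt0//.
rewrite (bigD1 j)//= ltr_pwDl ?sumr_ge0// => [|i _]; last exact: sqr_ge0.
by rewrite exprn_even_gt0//= intr_eq0.
Qed.

Lemma eigval_ge k : k <> (fun=> 0) -> omega ^+ 2 <= eigval L k.
Proof.
move=> k0; have [j kj] : exists j, k j != 0.
  by apply: contrapT => /forallNP h; apply: k0; apply/funext => j; have /negP := h j; rewrite negbK => /eqP.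
rewrite /eigval ler_peMr ?sqr_ge0// (bigD1 j)//= -[leLHS]addr0 lerD ?sumr_ge0// => [|i _]; last exact: sqr_ge0.
rewrite -rmorphXn /= (ler_int _ 1) -gtz0_ge1 exprn_even_gt0//=.
Qed.

Lemma eigval_ge0 k : 0 <= eigval L k.
Proof. by rewrite mulr_ge0 ?sqr_ge0 ?sumr_ge0// => i _; exact: sqr_ge0. Qed.

Lemma norm_freq_le k j : (omega * (k j)%:~R) ^+ 2 <= eigval L k.
Proof.
rewrite exprMn /eigval ler_wpM2l ?sqr_ge0// (bigD1 j)//= lerDl sumr_ge0// => i _.
exact: sqr_ge0.
Qed.

Lemma sum_freq_sq k : \sum_j (omega * (k j)%:~R) ^+ 2 = eigval L k.
Proof. by rewrite /eigval mulr_sumr; apply: eq_bigr => j _; rewrite exprMn. Qed.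

End StokesCoefficients.

Section FieldCoefficients.
Variables (R : realType) (L : R).
Hypothesis L_gt0 : 0 < L.
Notation mu := (lebesgue3 R).
Notation D := (box3 L : set (mpoint3 R)).
Notation omega := (2 * pi / L).
Notation hartley := (hartley L).
Notation hc := (hc L).
Notation l2p := (l2p L).
Implicit Types (k l : 'I_3 -> int).

Let mD : measurable D := measurable_box3 L.

Definition sqint_field (I : finType) (w : field R I) := forall i, sqint mu D (w i).

Lemma L2per_sqint_field (I : finType) (w : field R I) : L2per L w -> sqint_field w.
Proof. by move=> lw i; exact: L2per_sqint. Qed.

Definition ipc (I : finType) (w z : field R I) k : R := \sum_i hc (w i) k * hc (z i) k.

Lemma ip_parseval (kappa : nat -> 'I_3 -> int) (I : finType) (w z : field R I) :
  injective kappa -> (forall k, exists n, kappa n = k) -> sqint_field w -> sqint_field z ->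
  series (fun n => ipc w z (kappa n)) @ \oo --> ip L w z.
Proof.
move=> ki ks sw sz; rewrite ip_sum_dot//.
have h (r : seq I) : series (fun n => \sum_(i <- r) hc (w i) (kappa n) * hc (z i) (kappa n)) @ \oo -->
    \sum_(i <- r) dot mu D (w i) (z i).
  elim: r => [|i r IH].
    rewrite big_nil; apply: cvg_near_cst; apply: nearW => n.
    by rewrite seriesEnat /= big1// => j _; rewrite big_nil.
  rewrite big_cons (_ : series _ = fun n => series (fun n => hc (w i) (kappa n) * hc (z i) (kappa n)) n +
    series (fun n => \sum_(i <- r) hc (w i) (kappa n) * hc (z i) (kappa n)) n).
    by apply: cvgD => //; exact: (hartley_parseval L_gt0).
  by apply/funext => n; rewrite !seriesEnat /= -big_split; apply: eq_bigr => m _; rewrite big_cons.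
exact: h.
Qed.

Lemma ip_coef_eq (I J : finType) (w z : field R I) (w' z' : field R J) :
  sqint_field w -> sqint_field z -> sqint_field w' -> sqint_field z' ->
  (forall k, ipc w z k = ipc w' z' k) -> ip L w z = ip L w' z'.
Proof.
move=> sw sz sw' sz' e.
have h1 := ip_parseval freq_inj freq_surj sw sz.
have := ip_parseval freq_inj freq_surj sw' sz'.
under [X in series X]eq_fun do rewrite -e.
by move=> h2; exact: (cvg_unique _ h1 h2).
Qed.

Lemma ip_coef_eqN (I J : finType) (w z : field R I) (w' z' : field R J) :
  sqint_field w -> sqint_field z -> sqint_field w' -> sqint_field z' ->
  (forall k, ipc w z k = ipc w' z' (negk k)) -> ip L w z = ip L w' z'.
Proof.
move=> sw sz sw' sz' e.
have h1 := ip_parseval freq_inj freq_surj sw sz.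
have := ip_parseval freqN_inj freqN_surj sw' sz'.
under [X in series X]eq_fun do rewrite /= -e.
by move=> h2; exact: (cvg_unique _ h1 h2).
Qed.

Lemma ip_coef_leN (I J : finType) (w z : field R I) (w' z' : field R J) c :
  sqint_field w -> sqint_field z -> sqint_field w' -> sqint_field z' ->
  (forall k, c * ipc w z k <= ipc w' z' (negk k)) -> c * ip L w z <= ip L w' z'.
Proof.
move=> sw sz sw' sz' e.
have h1 := ip_parseval freq_inj freq_surj sw sz.
have h2 := ip_parseval freqN_inj freqN_surj sw' sz'.
apply: (ler_cvg_to (cvgM (cvg_cst c) h1) h2); apply: nearW => n.
by rewrite !seriesEnat /= mulr_sumr; apply: ler_sum.
Qed.

(** The test function for frequency [k] is [hartley (negk k)], whose partial derivatives are
    multiples of [hartley k]. *)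
Lemma div_freeP (v : vfield R) : L2per L v ->
  div_free L v <-> forall k, \sum_j (k j)%:~R * hc (v j) k = 0.
Proof.
move=> lv; have sv := L2per_sqint_field lv; split=> [dv k|dv phi sphi pphi].
  have sh : sqint_field (fun j => partial j (hartley (negk k)) : point3 R -> R).
    move=> j; apply: continuous_sqint => //.
    by apply: smooth3_partial_continuous; exact: smooth3_hartley.
  have := dv (hartley (negk k)) (smooth3_hartley L _) (periodic3_trig L_gt0 _ _ _).
  rewrite -/(ip L v (fun j => partial j (hartley (negk k)))) ip_sum_dot//.
  move=> h; have w0 : omega != 0 by rewrite gt_eqF// divr_gt0// mulr_gt0// pi_gt0.
  apply: (mulfI w0); rewrite mulr0 -[RHS]oppr0 -[in RHS]h mulr_sumr -sumrN.
  apply: eq_bigr => j _; rewrite /dot -mulrN1 -RintegralZr//; last exact: sqint_mul.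
  rewrite mulrA -RintegralZl//; last by apply: sqint_mul => //; exact: sqint_hartley.
  apply: eq_Rintegral => x _; rewrite partial_hartley -/(negk (negk k)) negkK /negk mulrNz.
  ring.
have sphi' : sqint mu D phi by apply: continuous_sqint => //; exact: smooth3_continuous.
have sdphi : sqint_field (fun j => partial j phi : point3 R -> R).
  by move=> j; apply: continuous_sqint => //; exact: smooth3_partial_continuous.
have s0 : sqint_field (fun _ : 'I_3 => fun _ : point3 R => 0 : R) by move=> j; exact: sqint0.
rewrite -/(ip L v (fun j => partial j phi)).
rewrite (@ip_coef_eq _ _ _ _ (fun _ : 'I_3 => fun _ : point3 R => 0 : R) (fun _ : 'I_3 => fun _ : point3 R => 0 : R))//.
  rewrite ip_sum_dot// big1// => j _; rewrite /dot.
  by under eq_Rintegral do rewrite mul0r; rewrite Rintegral_cst// mul0r.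
move=> k; rewrite /ipc [RHS]big1; last first.
  move=> j _; rewrite (_ : hc _ _ = 0) ?mul0r// /hc /dot.
  by under eq_Rintegral do rewrite mul0r; rewrite Rintegral_cst// mul0r.
transitivity (- (omega * hc phi (negk k)) * \sum_j (k j)%:~R * hc (v j) k).
  by rewrite mulr_sumr; apply: eq_bigr => j _; rewrite hc_partial//; ring.
by rewrite dv mulr0.
Qed.

Lemma ApowE (I : finType) s (w : field R I) : domA L s w -> is_Apow L s w (Apow L s w).
Proof. by move=> [_]; exact: getPex. Qed.

Lemma Apow_L2per0 (I : finType) s (w : field R I) : domA L s w -> L2per0 L (Apow L s w).
Proof. by move=> /ApowE[]. Qed.

Lemma Apow_coef (I : finType) s (w : field R I) i k : domA L s w ->
  hc (Apow L s w i) k = eigval L k `^ s * hc (w i) k.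
Proof. by move=> dw; have /(is_ApowP L_gt0 s _ dw.1.1)[_] := ApowE dw; apply. Qed.

Lemma hc0 (I : finType) (w : field R I) i : L2per0 L w -> hc (w i) (fun=> 0) = 0.
Proof. by move=> /(L2per0P L_gt0)[]. Qed.

Lemma domA_dom (I : finType) s (w y : field R I) C : L2per0 L w -> sqint_field y ->
  (forall i k, k <> (fun=> 0) -> `|eigval L k `^ s * hc (w i) k| <= C * `|hc (y i) k|) -> 0 <= C ->
  domA L s w.
Proof.
move=> lw sy wC C0; split=> //.
have /choice[z zP] : forall i, exists z, l2p z /\ forall k, hc z k = eigval L k `^ s * hc (w i) k.
  move=> i; apply: (@hartley_synthesis_dom _ _ L_gt0 _ (y i) C) => // k.
  have [->|k0] := pselect (k = (fun=> 0)); last exact: wC.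
  by rewrite hc0// mulr0 normr0 mulr_ge0.
exists z; apply/(is_ApowP L_gt0 s _ lw.1); split=> [|i k]; last exact: (zP i).2.
apply/(L2per0P L_gt0); split=> i; first exact: (zP i).1.
by rewrite (zP i).2 hc0// mulr0.
Qed.

Lemma domA_domN (I : finType) s (w y : field R I) C : L2per0 L w -> sqint_field y ->
  (forall i k, k <> (fun=> 0) -> `|eigval L k `^ s * hc (w i) k| <= C * `|hc (y i) (negk k)|) -> 0 <= C ->
  domA L s w.
Proof.
move=> lw sy wC C0; split=> //.
have /choice[z zP] : forall i, exists z, l2p z /\ forall k, hc z k = eigval L k `^ s * hc (w i) k.
  move=> i; apply: (@hartley_synthesis_domN _ _ L_gt0 _ (y i) C) => // k.
  have [->|k0] := pselect (k = (fun=> 0)); last exact: wC.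
  by rewrite hc0// mulr0 normr0 mulr_ge0.
exists z; apply/(is_ApowP L_gt0 s _ lw.1); split=> [|i k]; last exact: (zP i).2.
apply/(L2per0P L_gt0); split=> i; first exact: (zP i).1.
by rewrite (zP i).2 hc0// mulr0.
Qed.

Lemma domA_neg (I : finType) s (w : field R I) : s <= 0 -> L2per0 L w -> domA L s w.
Proof.
move=> s0 lw; have w0 : 0 < omega by rewrite divr_gt0// mulr_gt0// pi_gt0.
apply: (@domA_dom _ _ _ w ((omega ^+ 2) `^ s)) => //; first exact: L2per_sqint_field lw.1.
  move=> i k k0; rewrite normrM ler_wpM2r// ger0_norm ?powR_ge0//.
  have [r r0 ->] : exists2 r, 0 <= r & s = - r by exists (- s); rewrite ?oppr_ge0 ?opprK.
  rewrite !powRN lef_pV2 ?posrE ?powR_gt0 ?exprn_gt0 ?eigval_gt0//.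
  by rewrite ge0_ler_powR ?nnegrE ?sqr_ge0 ?eigval_ge0// eigval_ge.
exact: powR_ge0.
Qed.

End FieldCoefficients.

Section StokesFields.
Variables (R : realType) (L : R).
Hypothesis L_gt0 : 0 < L.
Notation mu := (lebesgue3 R).
Notation D := (box3 L : set (mpoint3 R)).
Notation omega := (2 * pi / L).
Notation hc := (hc L).
Notation ipc := (ipc L).
Implicit Types (k l : 'I_3 -> int).

Let mD : measurable D := measurable_box3 L.

Lemma eigval_powRD k (s t : R) : k <> (fun=> 0) ->
  eigval L k `^ s * eigval L k `^ t = eigval L k `^ (s + t).
Proof.
by move=> k0; rewrite -powRD// (negbTE (_ : eigval L k != 0)) ?implybT// gt_eqF ?eigval_gt0.
Qed.

Lemma Apow_sqint (I : finType) s (w : field R I) : domA L s w -> sqint_field L (Apow L s w).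
Proof. by move=> /Apow_L2per0[lw _]; exact: L2per_sqint_field. Qed.

Lemma ip_Apow_l (I : finType) (s t r : R) (w z : field R I) :
  domA L s w -> domA L t z -> domA L r w -> s + t = r ->
  ip L (Apow L s w) (Apow L t z) = ip L (Apow L r w) z.
Proof.
move=> ds dt dr e; apply: (ip_coef_eq L_gt0); [exact: Apow_sqint..|exact: L2per_sqint_field dt.1.1|].
move=> k; apply: eq_bigr => i _; rewrite !Apow_coef//.
(* At eigenvalue 0 the law of exponents can fail, since 0 to a nonzero power is 0 and to the power 0
   is 1; zero average makes the term vanish anyway. *)
have [->|k0] := pselect (k = (fun=> 0)); first by rewrite (hc0 L_gt0 i dr.1) !mulr0 !mul0r.
by rewrite mulrACA eigval_powRD// e mulrA.
Qed.

Lemma ip_self_ge0 (I : finType) (w : field R I) : 0 <= ip L w w.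
Proof. by apply: Rintegral_ge0 => x _; apply: sumr_ge0 => i _; rewrite -expr2 sqr_ge0. Qed.

Lemma L2norm_sq (I : finType) (w : field R I) : L2norm L w ^+ 2 = ip L w w.
Proof. by rewrite sqr_sqrtr// ip_self_ge0. Qed.

Lemma ip_self_eq0 (I : finType) (w : field R I) i k : sqint_field L w -> ip L w w = 0 -> hc (w i) k = 0.
Proof.
move=> sw; rewrite ip_sum_dot// => /eqP.
rewrite psumr_eq0 => [/allP/(_ i (mem_index_enum i))/eqP d0|j _]; last exact: dot_ge0.
have := dot_CS mD (sw i) (sqint_hartley L_gt0 k); rewrite d0 mul0r => le0.
by apply/eqP; rewrite -sqrf_eq0 eq_le le0 sqr_ge0.
Qed.

Lemma Apow_norm_gt0 (I : finType) s (w : field R I) : domA L s w -> ~ ae_zero L w ->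
  0 < L2norm L (Apow L s w).
Proof.
move=> dw; apply: contra_notP => /negP; rewrite -leNgt => n0.
have {}n0 : ip L (Apow L s w) (Apow L s w) = 0.
  by rewrite -L2norm_sq; apply/eqP; rewrite sqrf_eq0 eq_le n0 sqrtr_ge0.
have w0 i k : hc (w i) k = 0.
  have [->|k0] := pselect (k = (fun=> 0)); first by rewrite hc0//; exact: dw.1.
  have := ip_self_eq0 i k (Apow_sqint dw) n0; rewrite Apow_coef// => /eqP.
  by rewrite mulf_eq0 powR_eq0 gt_eqF ?eigval_gt0//= => /eqP.
have wae i : {ae mu, forall x, D x -> w i x = 0}.
  by apply: hartley_ae_eq0 => //; exact: L2per_sqint_field dw.1.1 i.
have h : \forall x \ae mu, forall i, D x -> w i x = 0.
  by apply: filter_forall => i; exact: wae.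
by rewrite /ae_zero; apply: filterS h => x h Dx i; exact: h.
Qed.

Lemma norm_gt0 (I : finType) (w : field R I) : L2per0 L w -> ~ ae_zero L w -> 0 < L2norm L w.
Proof.
move=> lw; apply: contra_notP => /negP; rewrite -leNgt => n0.
have {}n0 : ip L w w = 0 by rewrite -L2norm_sq; apply/eqP; rewrite sqrf_eq0 eq_le n0 sqrtr_ge0.
have wae i : {ae mu, forall x, D x -> w i x = 0}.
  apply: hartley_ae_eq0 => //; first exact: L2per_sqint_field lw.1 i.
  by move=> k; apply: ip_self_eq0 => //; exact: L2per_sqint_field lw.1.
have h : \forall x \ae mu, forall i, D x -> w i x = 0.
  by apply: filter_forall => i; exact: wae.
by rewrite /ae_zero; apply: filterS h => x h Dx i; exact: h.
Qed.

Lemma div_free_Apow s (v : vfield R) : domA L s v -> div_free L v -> div_free L (Apow L s v).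
Proof.
move=> dv dfv; apply/(div_freeP L_gt0); first exact: (Apow_L2per0 dv).1.
move=> k; have := (div_freeP L_gt0 dv.1.1).1 dfv k.
under [X in _ -> X = _]eq_bigr do rewrite Apow_coef// mulrCA.
by rewrite -mulr_sumr => ->; rewrite mulr0.
Qed.

(** [wpartial] is a [get], so a witness must exist first. It is synthesized from the expected
    coefficients, dominated by those of [A^(1/2) v] because [(omega * k_j)^2] is at most the
    eigenvalue. *)
Lemma grad_coef (v : vfield R) : domA L (1/2) v -> L2per0 L (grad L v) /\
  forall i j k, hc (grad L v (i, j)) k = - (omega * (k j)%:~R * hc (v i) (negk k)).
Proof.
move=> dv; have sv := L2per_sqint_field dv.1.1.
have h i j : l2p L (wpartial L j (v i)) /\
    forall k, hc (wpartial L j (v i)) k = - (omega * (k j)%:~R * hc (v i) (negk k)).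
  have [|z [lz zc]] := @hartley_synthesis_domN R L L_gt0
    (fun k => - (omega * (k j)%:~R * hc (v i) (negk k))) (Apow L (1/2) v i) 1 (Apow_sqint dv i).
    move=> k; rewrite Apow_coef// mul1r eigvalN normrN [leLHS]normrM [leRHS]normrM ler_wpM2r//.
    rewrite [leRHS]ger0_norm ?powR_ge0// -(@ler_pXn2r _ 2) ?nnegrE ?powR_ge0// real_normK ?num_real//.
    by rewrite expr2 [leRHS]expr2 powRMhalf ?eigval_ge0// -expr2 norm_freq_le.
  by apply: (@wpartialP _ _ L_gt0 _ _ z) => //; apply/is_wpartialP.
split; last by move=> i j k; exact: (h i j).2.
apply/(L2per0P L_gt0); split=> [[i j]|[i j]]; first exact: (h i j).1.
by rewrite [LHS](h i j).2 mulr0 mul0r oppr0.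
Qed.

Lemma ipc_grad (v : vfield R) k : domA L (1/2) v ->
  ipc (grad L v) (grad L v) k = eigval L k * ipc v v (negk k).
Proof.
move=> dv; have [_ gc] := grad_coef dv.
rewrite /ipc -(pair_bigA _ (fun i j => hc (grad L v (i, j)) k * hc (grad L v (i, j)) k)) /=.
rewrite mulr_sumr; apply: eq_bigr => i _.
rewrite -(sum_freq_sq L) mulr_suml; apply: eq_bigr => j _.
by rewrite gc; ring.
Qed.

Lemma poincare (v : vfield R) : domA L (1/2) v -> omega ^+ 2 * ip L v v <= ip L (grad L v) (grad L v).
Proof.
move=> dv; have [lg _] := grad_coef dv.
have sv := L2per_sqint_field dv.1.1; have sg := L2per_sqint_field lg.1.
apply: (ip_coef_leN L_gt0) => // k; rewrite ipc_grad// negkK eigvalN.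
have [->|k0] := pselect (k = (fun=> 0)).
  by rewrite /ipc big1 ?mulr0// => i _; rewrite hc0 ?mul0r//; exact: dv.1.
rewrite ler_wpM2r ?eigval_ge// sumr_ge0// => i _; rewrite -expr2; exact: sqr_ge0.
Qed.

End StokesFields.

(** * The trilinear form and the test field [A^-1 f] *)

Section Trilinear.
Variables (R : realType) (L : R).
Hypothesis L_gt0 : 0 < L.
Notation mu := (lebesgue3 R).
Notation D := (box3 L : set (mpoint3 R)).
Notation omega := (2 * pi / L).
Notation hc := (hc L).
Notation ipc := (ipc L).
Implicit Types (k l : 'I_3 -> int).

Let mD : measurable D := measurable_box3 L.

(** Lagrange's identity. *)
Lemma sum_CS (I : finType) (a b : I -> R) :
  (\sum_i a i * b i) ^+ 2 <= (\sum_i a i ^+ 2) * (\sum_i b i ^+ 2).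
Proof.
have h : \sum_i \sum_j (a i * b j - a j * b i) ^+ 2 =
    2 * ((\sum_i a i ^+ 2) * (\sum_i b i ^+ 2) - (\sum_i a i * b i) ^+ 2).
  have e1 : (\sum_i a i ^+ 2) * (\sum_i b i ^+ 2) = \sum_i \sum_j a i ^+ 2 * b j ^+ 2.
    by rewrite mulr_suml; apply: eq_bigr => i _; rewrite mulr_sumr.
  have e2 : (\sum_i a i ^+ 2) * (\sum_i b i ^+ 2) = \sum_i \sum_j a j ^+ 2 * b i ^+ 2.
    by rewrite e1 exchange_big.
  have e3 : (\sum_i a i * b i) ^+ 2 = \sum_i \sum_j (a i * b i) * (a j * b j).
    by rewrite expr2 mulr_suml; apply: eq_bigr => i _; rewrite mulr_sumr.
  rewrite mulrBr mulrDl mul1r {1}e1 e2 e3 mulr_sumr -big_split -sumrB /=.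
  apply: eq_bigr => i _; rewrite mulr_sumr -big_split -sumrB /=; apply: eq_bigr => j _; ring.
by rewrite -subr_ge0 -(pmulr_rge0 _ (ltr0n _ 2)) -h sumr_ge0// => i _; rewrite sumr_ge0// => j _; exact: sqr_ge0.
Qed.

Lemma ip_CS (I : finType) (w z : field R I) : sqint_field L w -> sqint_field L z ->
  `|ip L w z| <= L2norm L w * L2norm L z.
Proof.
move=> sw sz; rewrite -(@ler_pXn2r _ 2) ?nnegrE ?mulr_ge0 ?sqrtr_ge0// real_normK ?num_real//.
rewrite exprMn !L2norm_sq !ip_sum_dot//.
have d0 (w' : field R I) i : 0 <= dot mu D (w' i) (w' i) by exact: dot_ge0.
under [leRHS]congr2.
  under eq_bigr do rewrite -[dot _ _ _ _]sqr_sqrtr//.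
  over.
  under eq_bigr do rewrite -[dot _ _ _ _]sqr_sqrtr//.
  over.
apply: le_trans (sum_CS _ _); rewrite -[leLHS]real_normK ?num_real// ler_pXn2r ?nnegrE//; last first.
  by apply: sumr_ge0 => i _; rewrite mulr_ge0 ?sqrtr_ge0.
apply: le_trans (ler_norm_sum _ _ _) _; apply: ler_sum => i _.
rewrite -(@ler_pXn2r _ 2) ?nnegrE ?mulr_ge0 ?sqrtr_ge0// real_normK ?num_real// exprMn !sqr_sqrtr//.
exact: dot_CS.
Qed.

Lemma Linfnorm_ae (I : finType) (w : field R I) (B : R) : (Linfnorm L w <= B%:E)%E ->
  {ae mu, forall x, D x -> euclid w x <= B}.
Proof.
rewrite /Linfnorm unlock; case: ifPn => [_ /ess_supP|].
  by apply: filterS => x h Dx; move: h; rewrite /= patchE mem_set//= lee_fin; apply: le_trans; exact: ler_norm.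
(* The sup norm is 0 by convention if the whole space is null; then everything holds almost
   everywhere. *)
rewrite -leNgt measure_le0 => /eqP m0 _; exists setT; split => //.
Qed.

(** Pointwise, the integrand is the Euclidean product of the matrix [grad v] with [u_i * u_j], whose
    Euclidean norm is exactly [|u|^2]. Hence no dimensional constant appears. *)
Lemma trilinear_le (u v : vfield R) (B : R) : sqint_field L u -> sqint_field L (grad L v) ->
  0 <= B -> (Linfnorm L (grad L v) <= B%:E)%E -> `|trilinear L u v u| <= B * ip L u u.
Proof.
move=> su sg B0 /Linfnorm_ae aeB; rewrite /trilinear /ip.
set G := grad L v in aeB sg *.
apply: le_abs_Rintegral_nomeas.
have mG : measurable_fun D (fun x => \sum_i (\sum_j u j x * G (i, j) x) * u i x).
  apply: measurable_sum => i; apply: measurable_funM; last exact: (su i).1.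
  by apply: measurable_sum => j; apply: measurable_funM; [exact: (su j).1|exact: (sg (i, j)).1].
have mU : measurable_fun D (fun x => \sum_i u i x * u i x).
  by apply: measurable_sum => i; apply: measurable_funM; exact: (su i).1.
have iU : mu.-integrable D (EFin \o (fun x => \sum_i u i x * u i x)).
  have -> : EFin \o (fun x => \sum_i u i x * u i x) = (fun x => \sum_(i <- index_enum 'I_3) (u i x * u i x)%:E)%E.
    by apply/funext => x /=; rewrite sumEFin.
  by apply: integrable_sum => // i _; exact: sqint_mul (su i) (su i).
rewrite EFinM /Rintegral fineK; last exact: integrable_fin_num.
rewrite -integralZl//; apply: ae_ge0_le_integral => //.
- by apply/measurableT_comp => //; exact/measurable_EFinP.
- by move=> x _; rewrite -EFinM lee_fin mulr_ge0// sumr_ge0// => i _; rewrite -expr2 sqr_ge0.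
- by apply/measurable_EFinP; exact: measurable_funM.
apply: filterS aeB => x h Dx; rewrite -EFinM lee_fin.
have U0 : 0 <= \sum_i u i x * u i x by rewrite sumr_ge0// => i _; rewrite -expr2 sqr_ge0.
apply: le_trans (ler_wpM2r U0 (h Dx)).
rewrite -(@ler_pXn2r _ 2) ?nnegrE ?mulr_ge0 ?sqrtr_ge0// real_normK ?num_real// exprMn.
rewrite sqr_sqrtr; last by rewrite sumr_ge0// => ij _; exact: sqr_ge0.
have -> : \sum_i (\sum_j u j x * G (i, j) x) * u i x = \sum_(ij : 'I_3 * 'I_3) G ij x * (u ij.1 x * u ij.2 x).
  rewrite -(pair_bigA _ (fun i j => G (i, j) x * (u i x * u j x))) /=.
  by apply: eq_bigr => i _; rewrite mulr_suml; apply: eq_bigr => j _; ring.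
apply: le_trans (sum_CS _ _) _; rewrite ler_wpM2l ?sumr_ge0// => [ij _|]; first exact: sqr_ge0.
rewrite -(pair_bigA _ (fun i j => (u i x * u j x) ^+ 2)) /= expr2 mulr_suml le_eqVlt; apply/orP; left; apply/eqP.
by apply: eq_bigr => i _; rewrite mulr_sumr; apply: eq_bigr => j _; ring.
Qed.

Section TestField.
Variable f : vfield R.
Hypotheses (Lf : L2per0 L f) (df : div_free L f).
Let v := Apow L (-1) f.

Let dv1 : domA L (-1) f.
Proof. by apply: domA_neg => //; rewrite lerN10. Qed.

Let sf : sqint_field L f := L2per_sqint_field Lf.1.

Let coef i k : k <> (fun=> 0) -> hc (v i) k = (eigval L k)^-1 * hc (f i) k.
Proof. by move=> k0; rewrite Apow_coef// powR_inv1// ltW// eigval_gt0. Qed.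

Lemma Ainv_domA s (y : vfield R) : sqint_field L y ->
  (forall i k, k <> (fun=> 0) -> eigval L k `^ (s - 1) * hc (f i) k = hc (y i) k) -> domA L s v.
Proof.
move=> sy yc; apply: (@domA_dom _ _ L_gt0 _ _ _ y 1) => //; first exact: Apow_L2per0.
move=> i k k0; rewrite mul1r -yc// Apow_coef// mulrA eigval_powRD//.
Qed.

Lemma Ainv_inV : inV L v.
Proof.
have dhf : domA L (1/2 - 1) f by apply: domA_neg => //; lra.
split; first by split; [exact: Apow_L2per0|exact: div_free_Apow].
apply: (@Ainv_domA _ (Apow L (1/2 - 1) f)); first exact: Apow_sqint.
by move=> i k k0; rewrite Apow_coef.
Qed.

Let dv : domA L (1/2) v := Ainv_inV.2.

(** Here [y] stands for [A^(s - 1/2) f]: the squares of the factors [omega * k_j] sum to the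
    eigenvalue, so the gradient counts as [A^(1/2)] in norm. It also flips frequencies, hence the
    comparison of coefficients at [k] and [-k]. *)
Lemma Ainv_grad s (y : vfield R) : L2per0 L y ->
  (forall i k, k <> (fun=> 0) -> eigval L k `^ (s - 1/2) * hc (f i) k = hc (y i) k) ->
  domA L s (grad L v) /\
  ip L (Apow L s (grad L v)) (Apow L s (grad L v)) = ip L y y.
Proof.
move=> ly yc; have [lg gc] := grad_coef L_gt0 dv.
have sy := L2per_sqint_field ly.1.
have nz k : k <> (fun=> 0) -> negk k <> (fun=> 0).
  by move=> k0 e; apply: k0; rewrite -(negkK k) e; apply/funext => j; rewrite /negk oppr0.
have gc' i j k : k <> (fun=> 0) ->
    eigval L k `^ s * hc (grad L v (i, j)) k =
      - (omega * (k j)%:~R / eigval L k `^ (1/2) * hc (y i) (negk k)).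
  move=> k0; rewrite gc coef; last exact: nz.
  rewrite -yc; last exact: nz.
  rewrite eigvalN -{2}(powRMhalf (eigval_ge0 L k)) [in LHS](_ : s = s - 1/2 + 1/2); last ring.
  rewrite -eigval_powRD//; have : eigval L k `^ (1/2) != 0 by rewrite gt_eqF// powR_gt0 ?eigval_gt0//.
  move: (_ `^ (1/2)) (_ `^ (s - 1/2)) (hc _ _) (_%:~R) omega => h x a c o h0.
  by rewrite invfM; field.
have dg : domA L s (grad L v).
  apply: (@domA_domN _ _ L_gt0 _ _ _ (fun ij => y ij.1) 1) => //.
  move=> [i j] k k0.
  rewrite mul1r gc'// normrN normrM ler_piMl// normrM normfV ler_pdivrMr; last first.
    by rewrite normr_gt0 gt_eqF// powR_gt0 ?eigval_gt0//.
  rewrite [leRHS]mul1r -(@ler_pXn2r _ 2) ?nnegrE// !real_normK ?num_real//.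
  by rewrite [leRHS]expr2 powRMhalf ?eigval_ge0// norm_freq_le.
split=> //; apply: (ip_coef_eqN L_gt0) => // [||k]; [exact: Apow_sqint..|].
have [->|k0] := pselect (k = (fun=> 0)).
  rewrite /ipc !big1// => [i _|ij _]; last by rewrite Apow_coef// hc0// mulr0 mul0r.
  by rewrite [negk _](_ : _ = (fun=> 0)) ?hc0 ?mul0r//; apply/funext => j; rewrite /negk oppr0.
transitivity (\sum_i \sum_j hc (Apow L s (grad L v) (i, j)) k * hc (Apow L s (grad L v) (i, j)) k).
  by rewrite pair_bigA; apply: eq_bigr => -[].
apply: eq_bigr => i _; under eq_bigr do rewrite Apow_coef// gc'//.
set a := hc (y i) _; set h := eigval L k `^ (1/2).
transitivity (\sum_j (omega * (k j)%:~R) ^+ 2 * (a ^+ 2 / (h * h))).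
  by apply: eq_bigr => j _; rewrite invfM; ring.
rewrite -mulr_suml sum_freq_sq powRMhalf ?eigval_ge0// mulrCA divff ?mulr1//.
by rewrite gt_eqF// eigval_gt0.
Qed.

End TestField.
End Trilinear.

Section InverseStokes.
Variables (R : realType) (L : R) (f : vfield R).
Hypotheses (L_gt0 : 0 < L) (Hf : inDA L (1/2) f).
Let v := Apow L (-1) f.

Let Lf : L2per0 L f := Hf.1.1.
Let df : div_free L f := Hf.1.2.
Let dhf : domA L (1/2) f := Hf.2.

Lemma ipC (I : finType) (w z : field R I) : ip L w z = ip L z w.
Proof. by apply: eq_Rintegral => x _; apply: eq_bigr => i _; rewrite mulrC. Qed.

Lemma ip_Ainv : ip L f v = L2norm L (Apow L (-(1/2)) f) ^+ 2.
Proof.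
rewrite L2norm_sq ipC (@ip_Apow_l _ _ L_gt0 _ _ _ (-1))//.
- by apply: domA_neg => //; lra.
- by apply: domA_neg => //; lra.
- by apply: domA_neg => //; lra.
by field.
Qed.

Lemma ip_Ahalf_Ainv (u : vfield R) : inV L u ->
  ip L (Apow L (1/2) u) (Apow L (1/2) v) = ip L u f.
Proof.
move=> [[lu _] du]; have [_ dv] := Ainv_inV L_gt0 Lf df.
have dv1 : domA L (-1) f by apply: domA_neg => //; lra.
apply: (ip_coef_eq L_gt0); [exact: Apow_sqint..|exact: L2per_sqint_field lu.1|exact: L2per_sqint_field Lf.1|].
move=> k; apply: eq_bigr => i _; rewrite !(Apow_coef L_gt0 i k du, Apow_coef L_gt0 i k dv, Apow_coef L_gt0 i k dv1).
have [->|k0] := pselect (k = (fun=> 0)); first by rewrite (hc0 L_gt0 i lu) !mulr0 !mul0r.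
by rewrite powR_inv1 ?eigval_ge0// mulrACA powRMhalf ?eigval_ge0// mulrCA mulVKf// gt_eqF// eigval_gt0.
Qed.

(** Agmon's inequality is applied to [grad L v]. That [f] lies in [D(A^(1/2))] puts this gradient in
    [D(A)], and [Ainv_grad] with exponents [1/2] and [1] turns the two norms into those of [f] and
    [A^(1/2) f]. *)
Lemma trilinear_Ainv_le CA (u : vfield R) : agmon_constant L CA -> sqint_field L u ->
  `|trilinear L u v u| <=
    CA * L2norm L f `^ (1/2) * L2norm L (Apow L (1/2) f) `^ (1/2) * ip L u u.
Proof.
move=> [CA0 agmon] su; have [_ dv] := Ainv_inV L_gt0 Lf df.
have [dg1 n1] := @Ainv_grad _ _ L_gt0 _ Lf df (1/2) f Lf
  (fun i k _ => ltac:(by rewrite subrr powRr0 mul1r)).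
have lhf : L2per0 L (Apow L (1/2) f) by exact: Apow_L2per0.
have [dg2 n2] : domA L 1 (grad L v) /\ ip L (Apow L 1 (grad L v)) (Apow L 1 (grad L v)) =
    ip L (Apow L (1/2) f) (Apow L (1/2) f).
  apply: Ainv_grad => // i k _; rewrite (Apow_coef L_gt0)//.
  by congr (_ `^ _ * _); field.
apply: trilinear_le => //; first exact: L2per_sqint_field dg2.1.1.
  by rewrite !mulr_ge0 ?powR_ge0// ltW.
by apply: le_trans (agmon _ _ dg2) _; rewrite /L2norm n1 n2.
Qed.

End InverseStokes.

(** * Almost everywhere comparison and the bound on the attractor *)

Section LowerIntegralAe.
Local Open Scope ereal_scope.
Context {d} {T : measurableType d} {R : realType}.
Variable mu : {measure set T -> \bar R}.
Implicit Types (f g : T -> \bar R) (D : set T).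
Import HBNNSimple.

(** A simple function below [f] is set to 0 on the exceptional null set: its integral is unchanged
    and it then lies below [g] everywhere. *)
Lemma ae_ge0_le_integral_nomeas D f g : measurable D -> (forall x, D x -> 0 <= f x) ->
  (forall x, D x -> 0 <= g x) -> {ae mu, forall x, D x -> f x <= g x} ->
  \int[mu]_(x in D) f x <= \int[mu]_(x in D) g x.
Proof.
move=> mD f0 g0 [N [mN N0 subN]].
rewrite [leLHS]ge0_integralE//; apply: ge_ereal_sup => _ [h hf <-].
have -> : sintegral mu h = \int[mu]_(x in D) (h x)%:E.
  rewrite -integralT_nnsfun [RHS]integral_mkcond; apply: eq_integral => x _.
  rewrite patchE; case: ifPn => // xD; apply/eqP.
  by have := hf x; rewrite patchE (negbTE xD) eq_le => ->; rewrite lee_fin fun_ge0.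
apply: (@le_trans _ _ (\int[mu]_(x in D) (h x * \1_(~` N) x)%:E)).
  apply: ae_ge0_le_integral => //.
  - by move=> x _; rewrite lee_fin fun_ge0.
  - by apply/measurable_EFinP; exact: measurable_funTS.
  - by move=> x _; rewrite lee_fin mulr_ge0 ?fun_ge0.
  - apply/measurable_EFinP; apply: measurable_funM; first exact: measurable_funTS.
    by apply: measurable_indic; exact: measurableC.
  exists N; split=> // x /=; apply: contra_notP => Nx _.
  by rewrite indicE mem_set// mulr1.
apply: ge0_le_integral_nomeas => x Dx; first by rewrite lee_fin mulr_ge0 ?fun_ge0.
have [Nx|Nx] := pselect (N x).
  by rewrite indicE memNset ?mulr0 ?g0//; exact: contra_not.
rewrite indicE mem_set// mulr1.
have /(_ Dx) fg : D x -> f x <= g x by apply: contrapT => fg; apply: Nx; exact: subN.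
by apply: le_trans fg; have := hf x; rewrite patchE mem_set.
Qed.

End LowerIntegralAe.

(* [ae_filter_ringOfSetsType] is not found for the unbundled measure. *)
#[local] Instance ae_lebesgue_filter (R : realType) : Filter (almost_everywhere (@lebesgue_measure R)).
Proof. exact: ae_filter_ringOfSetsType. Qed.

Section Attractor.
Variables (R : realType) (L nu : R) (f : vfield R).
Hypotheses (L_gt0 : 0 < L) (nu_gt0 : 0 < nu).
Notation lam := (@lebesgue_measure R).
Notation omega := (2 * pi / L).

Lemma LH_norm_grad u : LerayHopf L nu f u ->
  {ae lam, forall t, 0 < t -> omega ^+ 2 * L2norm L (u t) ^+ 2 <= L2norm L (grad L (u t)) ^+ 2}.
Proof.
move=> /LH_L2V[aeV _]; apply: filterS aeV => t h /h[_ du].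
by rewrite !L2norm_sq; exact: poincare.
Qed.

Lemma lebesgue_itvcc (a b : R) : a <= b -> lam `[a, b]%classic = (b - a)%:E.
Proof. by move=> ab; rewrite lebesgue_measure_itv/= lte_fin; case: ltgtP ab => // ->; rewrite subrr. Qed.

Lemma integral_cst_itvcc (a b c : R) : a <= b ->
  (\int[lam]_(t in `[a, b]) c%:E = (c * (b - a))%:E)%E.
Proof. by move=> ab; rewrite integral_cst//= lebesgue_itvcc. Qed.

Lemma ae_itvcc (P : R -> Prop) (a b : R) : a < b -> {ae lam, forall t, P t} -> exists2 t, a <= t <= b & P t.
Proof.
move=> ab [N [mN N0 subN]]; apply: contrapT => /forall2NP h.
have : (lam `[a, b]%classic <= lam N)%E.
  apply: le_measure; rewrite ?inE// => t; rewrite /= in_itv/= => tab; apply: subN => Pt.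
  by have [] := h t.
by rewrite N0 (lebesgue_itvcc (ltW ab)) lee_fin subr_le0 leNgt ab.
Qed.

Lemma integral_ip_le (u : R -> vfield R) (a b S : R) : a <= b -> sqint_field L f ->
  (forall t, a <= t <= b -> sqint_field L (u t)) -> (forall t, a <= t <= b -> L2norm L (u t) <= S) ->
  `|\int[lam]_(t in `[a, b]) ip L f (u t)| <= L2norm L f * S * (b - a).
Proof.
move=> ab sf su uS; apply: le_abs_Rintegral_nomeas.
apply: (@le_trans _ _ (\int[lam]_(t in `[a, b]) (L2norm L f * S)%:E)%E).
  apply: ge0_le_integral_nomeas => // t; rewrite /= in_itv /= => tab.
  rewrite lee_fin; apply: le_trans (ip_CS sf (su _ tab)) _.
  by rewrite ler_wpM2l ?sqrtr_ge0// uS.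
by rewrite integral_cst_itvcc.
Qed.

(* Let [S] be the supremum of the norms and [t1] a time where it is almost
   attained.  By the energy inequality the norm is still close to [S] shortly
   before [t1]; if [S] were larger than the bound, dissipation would exceed the
   work of [f] there, and the norm would have been larger than [S] earlier. *)
Lemma complete_bound (v : R -> vfield R) : L2per0 L f -> complete_LerayHopf L nu f v ->
  (exists M : R, forall t, L2norm L (v t) <= M) ->
  forall t, L2norm L (v t) <= L2norm L f / (nu * omega ^+ 2).
Proof.
move=> Lf cv [M vM].
have sf := L2per_sqint_field Lf.1.
have sv t : sqint_field L (v t).
  by have := LH_H (cv t) (lexx 0); rewrite add0r => -[[lv _] _]; exact: L2per_sqint_field.
pose a := nu * omega ^+ 2; pose F := L2norm L f.
have a0 : 0 < a by rewrite mulr_gt0// exprn_gt0// divr_gt0// mulr_gt0// pi_gt0.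
have F0 : 0 <= F by exact: sqrtr_ge0.
pose n t := L2norm L (v t).
have hs : has_sup (range n) by split; [exists (n 0), 0|exists M => _ [t _ <-]; exact: vM].
pose S := sup (range n).
have nS t : n t <= S by apply: sup_ubound; [exact: hs.2|exists t].
suff SF : S <= F / a by move=> t; exact: le_trans (nS t) SF.
rewrite leNgt; apply/negP => FS.
have S0 : 0 < S by apply: le_lt_trans FS; rewrite divr_ge0// ltW.
have FaS : F < a * S by rewrite mulrC -ltr_pdivrMr.
(* [2 * kappa] is the surplus of dissipation over work at norm [S]. *)
have [kappa k0 kE] : exists2 kappa : R, 0 < kappa & 2 * kappa = a * S ^+ 2 - F * S.
  exists ((a * S ^+ 2 - F * S) / 2); last by field.
  by rewrite divr_gt0// subr_gt0 expr2 mulrA ltr_pM2r.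
have FS0 : 0 <= F * S by rewrite mulr_ge0// ltW.
(* The window length [tau] and the defect [e] below [S ^+ 2] each cost at most [kappa / 2], so a
   surplus [kappa] persists on the whole window; [e] is moreover small against [kappa * tau], the
   gain collected by going back in time. *)
have [tau tau0 tauE] : exists2 tau : R, 0 < tau & 2 * a * F * S * tau <= kappa / 2.
  have den0 : 0 < 4 * a * F * S + 1 by have := mulr_ge0 (ltW a0) FS0; lra.
  exists (kappa / (4 * a * F * S + 1)); first by rewrite divr_gt0.
  rewrite mulrA ler_pdivrMr//; have := mulr_ge0 (mulr_ge0 (ltW a0) FS0) (ltW k0); lra.
have [e [e0 e1 e2]] : exists e : R, [/\ 0 < e, a * e <= kappa / 2 & e <= kappa * tau / 2].
  exists (Num.min (kappa / (2 * a)) (kappa * tau / 2)); split.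
  - by rewrite lt_min; apply/andP; split; apply: divr_gt0 => //; rewrite mulr_gt0.
  - apply: (@le_trans _ _ (a * (kappa / (2 * a)))); first by rewrite ler_wpM2l ?ge_min ?lexx// ltW.
    by rewrite le_eqVlt; apply/orP; left; apply/eqP; field; rewrite gt_eqF.
  - by rewrite ge_min lexx orbT.
have [t1 t1S] : exists t1, S ^+ 2 - e < n t1 ^+ 2.
  have d0 : 0 < e / (2 * S) by rewrite divr_gt0// mulr_gt0.
  have [_ [t1 _ <-] h] := sup_adherent d0 hs; exists t1.
  rewrite -/S in h.
  have h2 : e / (2 * S) * (2 * S) = e by rewrite divfK// gt_eqF// mulr_gt0.
  have n0 : 0 <= n t1 by exact: sqrtr_ge0.
  have [le|] := leP (S - e / (2 * S)) 0; nra.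
pose s := t1 - tau; pose u t := v (t + s).
have ut1 : L2norm L (u tau) = n t1 by rewrite /u /s addrC subrK.
have lhu : LerayHopf L nu f u := cv s.
have Iip t0 : t0 <= tau -> `|\int[lam]_(t in `[t0, tau]) ip L f (u t)| <= F * S * (tau - t0).
  by move=> t0t; apply: integral_ip_le => // t _; [exact: sv|exact: nS].
have ae1 : {ae lam, forall t0, 0 <= t0 -> t0 <= tau ->
    S ^+ 2 - e - 2 * F * S * tau <= L2norm L (u t0) ^+ 2}.
  apply: filterS (LH_energy lhu) => t0 h t00 t0t.
  have : (0 <= (L2norm L (u t0) ^+ 2 / 2 - L2norm L (u tau) ^+ 2 / 2
         + \int[lam]_(t in `[t0, tau]) ip L f (u t))%:E)%E.
    apply: le_trans (h t00 _ t0t); apply: mule_ge0; first exact: ltW.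
    by apply: integral_ge0 => t _; rewrite lee_fin sqr_ge0.
  rewrite lee_fin ut1; have := Iip _ t0t; rewrite ler_norml => /andP[_ hI].
  have : F * S * (tau - t0) <= F * S * tau by rewrite ler_wpM2l// lerBlDr lerDl.
  by move: hI; lra.
have ae2 : {ae lam, forall t0, 0 <= t0 -> t0 <= tau ->
    S ^+ 2 / 2 - e / 2 + kappa * (tau - t0) < L2norm L (u t0) ^+ 2 / 2}.
  apply: filterS (LH_energy lhu) => t0 h t00 t0t.
  pose q := S ^+ 2 - e - 2 * F * S * tau.
  have aq : kappa <= a * q - F * S by rewrite /q; move: tauE e1 kE; lra.
  have q0 : 0 <= q.
    rewrite -(pmulr_rge0 _ a0); have : 0 <= F * S by rewrite mulr_ge0// ltW.
    by move: k0 aq; lra.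
  have lower : ((omega ^+ 2 * q * (tau - t0))%:E <=
      \int[lam]_(t in `[t0, tau]) (L2norm L (grad L (u t)) ^+ 2)%:E)%E.
    apply: (@le_trans _ _ (\int[lam]_(t in `[t0, tau]) (omega ^+ 2 * q)%:E)%E).
      by rewrite integral_cst_itvcc.
    apply: ae_ge0_le_integral_nomeas => //.
    - by move=> t _; rewrite lee_fin mulr_ge0// sqr_ge0.
    - by move=> t _; rewrite lee_fin sqr_ge0.
    have : {ae lam, forall t, t != 0}.
      exists [set 0]; split => //; first exact: lebesgue_measure_set1.
      by move=> t /=; apply: contra_notP => /eqP.
    apply: filterS3 ae1 (LH_norm_grad lhu) => t h1 h2 tn0; rewrite /= in_itv/= => /andP[tt0 ttau].
    have t_ge0 := le_trans t00 tt0.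
    rewrite lee_fin; apply: le_trans (h2 _); last by rewrite lt_neqAle eq_sym tn0.
    by rewrite ler_wpM2l ?sqr_ge0// h1.
  have := h t00 _ t0t; rewrite ut1 => en.
  have nu0 : (0 <= nu%:E)%E by rewrite lee_fin ltW.
  have := le_trans (lee_wpmul2l nu0 lower) en.
  rewrite -EFinM lee_fin; have := Iip _ t0t; rewrite ler_norml => /andP[_ hI].
  have : (kappa + F * S) * (tau - t0) <= a * q * (tau - t0).
    by rewrite ler_wpM2r ?subr_ge0//; move: aq; lra.
  rewrite /a; move: hI t1S; lra.
(* A time in the first half of the window has at least [kappa * tau / 2 >= e] of gain, which exceeds
   the loss [e / 2]. *)
have [t0 /andP[t00 t0t] h] := ae_itvcc (divr_gt0 tau0 (ltr0n _ 2)) ae2.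
have := h t00 _; have -> : t0 <= tau by move: tau0 t0t; lra.
move=> /(_ isT).
have : L2norm L (u t0) ^+ 2 <= S ^+ 2 by rewrite ler_pXn2r ?nnegrE ?sqrtr_ge0 ?(ltW S0)//; exact: (nS (t0 + s)).
have : kappa * (tau / 2) <= kappa * (tau - t0) by rewrite ler_wpM2l ?(ltW k0)//; lra.
by move: e2; lra.
Qed.

Lemma weak_attractor_bound (h : vfield R) : L2per0 L f -> weak_attractor L nu f h ->
  L2norm L h <= L2norm L f / (nu * omega ^+ 2).
Proof. by move=> Lf [v [cv vM [t ->]]]; exact: complete_bound. Qed.

End Attractor.

(** * Time cut-offs and time integrals *)

(** A ratio in [[0, 1]] is at most its [r]-th power; this is summed over [x / (x + y)] and
    [y / (x + y)]. *)
Lemma powR_subadd (R : realType) (x y r : R) : 0 <= x -> 0 <= y -> 0 < r -> r <= 1 ->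
  (x + y) `^ r <= x `^ r + y `^ r.
Proof.
move=> x0 y0 r0 r1; have [xy0|xy] := eqVneq (x + y) 0.
  by rewrite xy0 powR0 ?gt_eqF// addr_ge0 ?powR_ge0.
have s0 : 0 < x + y by rewrite lt_neqAle eq_sym xy addr_ge0.
have h z : 0 <= z -> z <= x + y -> z / (x + y) * (x + y) `^ r <= z `^ r.
  move=> z0 zs; have [->|zn0] := eqVneq z 0; first by rewrite !mul0r powR_ge0.
  have zp : 0 < z by rewrite lt_neqAle eq_sym zn0.
  rewrite -[in leRHS](divfK xy z) powRM ?ler_wpM2r ?powR_ge0 ?divr_ge0 ?(ltW s0)//.
  by rewrite ger1_powR// divr_gt0//= ler_pdivrMr// mul1r.
have hx := h x x0 (_ : x <= x + y); have hy := h y y0 (_ : y <= x + y).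
apply: le_trans (lerD (hx _) (hy _)); rewrite ?lerDl ?lerDr//.
by rewrite -mulrDl -mulrDl divff// mul1r.
Qed.

Lemma ge0_integral_supp_le d (T : measurableType d) (R : realType) (mu : {measure set T -> \bar R})
    (A B : set T) (f : T -> \bar R) : (forall t, 0 <= f t)%E -> (forall t, A t -> ~ B t -> f t = 0)%E ->
  (\int[mu]_(t in A) f t <= \int[mu]_(t in B) f t)%E.
Proof.
move=> f0 fAB; rewrite [leLHS]integral_mkcond [leRHS]integral_mkcond.
apply: ge0_le_integral_nomeas => t _; rewrite !patchE.
  by case: ifPn.
case: ifPn => [/set_mem At|_]; case: ifPn => [|/negP Bt] //.
by rewrite fAB// => /mem_set.
Qed.

Section Cutoff.
Variables (R : realType) (C0 delta T : R) (eta : R -> R).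
Hypotheses (C0_gt0 : 0 < C0) (delta_gt0 : 0 < delta) (delta_le1 : delta <= 1) (T_gt0 : 0 < T).
Hypothesis eta_cutoff : time_cutoff C0 delta T eta.
Notation lam := (@lebesgue_measure R).

Let eta_ge0 t : 0 <= eta t.
Proof. by have /andP[] := cutoff_range eta_cutoff t. Qed.

Let eta_le1 t : eta t <= 1.
Proof. by have /andP[] := cutoff_range eta_cutoff t. Qed.

Lemma cutoff_powR_ge (t : R) : eta t <= eta t `^ delta.
Proof.
have [->|e0] := eqVneq (eta t) 0; first exact: powR_ge0.
by rewrite ger1_powR// eta_le1 andbT lt_neqAle eq_sym e0 eta_ge0.
Qed.

Lemma cutoff_powR_le1 (t : R) : eta t `^ delta <= 1.
Proof.
have : eta t `^ delta <= 1 `^ delta by rewrite ge0_ler_powR ?nnegrE ?(ltW delta_gt0).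
by rewrite powR1.
Qed.

Lemma cutoff_eq0 (t : R) : ~ (0 <= t <= T) -> eta t = 0.
Proof.
move=> tT; apply/eqP; apply: contra_notT tT => e0.
have /(cutoff_supp eta_cutoff) : supp eta t by apply: subset_closure.
by rewrite /= in_itv.
Qed.

Lemma cutoff_derivable (t : R) : derivable eta t 1.
Proof. by have := @cutoff_smooth _ _ _ _ _ eta_cutoff 0%N t. Qed.

Lemma cutoff_continuous : continuous eta.
Proof.
by move=> t; apply: differentiable_continuous; apply/derivable1_diffP; exact: cutoff_derivable.
Qed.

Lemma cutoff_derive_le (t : R) : `|derive1 eta t| <= C0 / T.
Proof.
apply: le_trans (cutoff_derive eta_cutoff t) _.
by rewrite ler_piMr ?cutoff_powR_le1// divr_ge0 ?ltW.
Qed.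

Lemma cutoff_lip (a b : R) : a <= b -> `|eta b - eta a| <= C0 / T * (b - a).
Proof.
move=> ab; have [||c _ ->] := @MVT_segment R eta (derive1 eta) a b ab _ _.
- move=> x _; apply: DeriveDef; first exact: cutoff_derivable.
  by rewrite derive1E.
- by apply: continuous_subspaceT; exact: cutoff_continuous.
by rewrite normrM (ger0_norm (_ : 0 <= b - a)) ?subr_ge0// ler_wpM2r ?subr_ge0// cutoff_derive_le.
Qed.

(** [eta] is Lipschitz with constant [C0 / T], and subadditivity of the power [delta] turns this
    into a Hoelder estimate that is uniform in [t]. *)
Lemma cutoff_powR_shift (h t : R) : 0 <= h ->
  eta (t - h) `^ delta <= eta t `^ delta + (C0 / T * h) `^ delta.
Proof.
move=> h0; have c0 : 0 <= C0 / T * h by rewrite mulr_ge0// divr_ge0// ltW.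
apply: le_trans (powR_subadd (eta_ge0 t) c0 delta_gt0 delta_le1).
rewrite ge0_ler_powR ?nnegrE ?addr_ge0 ?(ltW delta_gt0)//.
have := @cutoff_lip (t - h) t; rewrite opprB addrCA subrr addr0 => /(_ _).
by rewrite gerBl h0 => /(_ isT); rewrite ler_norml => /andP[]; lra.
Qed.

Lemma measurable_cutoff (D : set R) (h : R) : measurable_fun D (fun t => eta (t - h)).
Proof.
apply: measurable_funTS; apply: continuous_measurable_fun => t.
apply: (@continuous_comp _ _ _ (fun t => t - h) eta); last exact: cutoff_continuous.
by apply: continuousB; [exact: id|exact: cst_continuous].
Qed.

Lemma measurable_cutoff_powR (D : set R) (h : R) : measurable_fun D (fun t => eta (t - h) `^ delta).
Proof. by apply: (measurableT_comp (measurable_powR _)) => //; exact: measurable_cutoff. Qed.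

Lemma derive1n_shift (g : R -> R) (h : R) n :
  derive1n n (fun t => g (t - h)) = fun t => derive1n n g (t - h).
Proof.
elim: n => //= n ->; apply/funext => t.
have e : (fun s : R => s^-1 *: (derive1n n g (s + t - h) - derive1n n g (t - h))) =
    (fun s : R => s^-1 *: (derive1n n g (s + (t - h)) - derive1n n g (t - h))).
  by apply/funext => s; rewrite -addrA.
by rewrite /derive1 e.
Qed.

(** The shift moves the support into [[h, T + h]], a compact subset of the open half-line. *)
Lemma cutoff_test_function (h : R) : 0 < h -> test_function (fun t => eta (t - h)).
Proof.
move=> h0.
have sub : supp (fun t => eta (t - h)) `<=` `[h, T + h].
  rewrite (_ : `[h, T + h]%classic = closure `[h, T + h]); last by apply/closure_id; exact: interval_closed.
  apply: closureS => t /= e0; rewrite in_itv/=; apply: contrapT => ht; move/eqP: e0; apply.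
  by apply: cutoff_eq0; rewrite subr_ge0 lerBlDr.
split.
- move=> n t; rewrite derive1n_shift.
  have := @cutoff_smooth _ _ _ _ _ eta_cutoff n (t - h).
  rewrite /derivable (_ : (fun s : R => s^-1 *: (((fun t => derive1n n eta (t - h)) \o shift t) (s *: 1) - _)) =
    (fun s : R => s^-1 *: ((derive1n n eta \o shift (t - h)) (s *: 1) - derive1n n eta (t - h))))//.
  by apply/funext => s /=; rewrite addrA.
- by apply: subclosed_compact sub; [exact: closed_closure|exact: segment_compact].
- by move=> t /sub; rewrite /= !in_itv/= andbT => /andP[+ _]; exact: lt_le_trans.
Qed.

Lemma derive1_cutoff_shift (h t : R) : derive1 (fun t => eta (t - h)) t = derive1 eta (t - h).
Proof. exact: (congr1 (@^~ t) (derive1n_shift eta h 1)). Qed.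

Lemma integral_cutoff_shift (h : R) : 0 < h ->
  (\int[lam]_(t in `]0%R, +oo[) (eta (t - h))%:E = \int[lam]_(t in `[0%R, T]) (eta t)%:E)%E.
Proof.
move=> h0.
have dF (x : R) : is_derive x 1 (fun t : R => t - h) (1 - 0) by apply: is_deriveB.
have F' : derive1 (fun t : R => t - h) = cst 1.
  by apply/funext => x; rewrite derive1E derive_val subr0.
transitivity (\int[lam]_t (eta t)%:E)%E; last first.
  apply/eqP; rewrite eq_le; apply/andP; split; apply: ge0_integral_supp_le => t;
    rewrite ?lee_fin// => _; last by case.
  by rewrite /= in_itv/= => tT; rewrite cutoff_eq0.
rewrite (@increasing_ge0_integration_by_substitutionT _ (fun t => t - h) eta)//; last first.
- exact: cutoff_continuous.
- exact: cvg_addrr.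
- exact: cvg_addrr_Ny.
- by rewrite F'; exact: is_cvg_cst.
- by rewrite F'; exact: is_cvg_cst.
- by rewrite F' => x; exact: cvg_cst.
- by move=> x y xy; rewrite ltrD2r.
rewrite F'; under [in RHS]eq_integral do rewrite /= mulr1.
apply/eqP; rewrite eq_le; apply/andP; split; apply: ge0_integral_supp_le => t;
  rewrite ?lee_fin//= => _.
rewrite /= in_itv/= andbT => t0; rewrite cutoff_eq0// => /andP[th _]; apply: t0.
by apply: lt_le_trans h0 _; rewrite -subr_ge0.
Qed.

Lemma integral_cutoff_powR_le (h : R) :
  (\int[lam]_(t in `]0%R, +oo[) (eta (t - h) `^ delta)%:E <= T%:E)%E.
Proof.
apply: (@le_trans _ _ (\int[lam]_(t in `[h, (T + h)%R]) (eta (t - h) `^ delta)%:E)%E).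
  apply: ge0_integral_supp_le => [t|t _]; first by rewrite lee_fin powR_ge0.
  by rewrite /= in_itv/= => ht; rewrite cutoff_eq0 ?powR0 ?gt_eqF// subr_ge0 lerBlDr.
apply: (@le_trans _ _ (\int[lam]_(t in `[h, (T + h)%R]) 1%:E)%E).
  by apply: ge0_le_integral_nomeas => t _; rewrite lee_fin ?powR_ge0 ?cutoff_powR_le1.
by rewrite integral_cst_itvcc ?lerDr ?(ltW T_gt0)// mul1r addrK.
Qed.

Lemma integral_cutoff_gt0 : 0 < \int[lam]_(t in `[0, T]) eta t.
Proof.
have [t1 e1] := cutoff_neq0 eta_cutoff.
have e0 : 0 < eta t1 by rewrite lt_neqAle eq_sym e1 eta_ge0.
have /nbhs_ballP[d /= d0 hd] : \forall t \near t1, eta t1 / 2 < eta t.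
  by apply: (cvgr_gt _ (@cutoff_continuous t1)); lra.
have fin : (\int[lam]_(t in `[0%R, T]) (eta t)%:E <= T%:E)%E.
  apply: (@le_trans _ _ (\int[lam]_(t in `[0%R, T]) 1%:E)%E).
    by apply: ge0_le_integral_nomeas => t _; rewrite lee_fin.
  by rewrite integral_cst_itvcc ?(ltW T_gt0)// mul1r subr0.
have pos : ((eta t1 / 2 * (d / 2))%:E <= \int[lam]_(t in `[0%R, T]) (eta t)%:E)%E.
  apply: (@le_trans _ _ (\int[lam]_(t in `[t1, (t1 + d / 2)%R]) (eta t)%:E)%E).
    have e : d / 2 = t1 + d / 2 - t1 by rewrite addrAC subrr add0r.
    rewrite {1}e -integral_cst_itvcc; last by rewrite lerDl divr_ge0// ltW.
    apply: ge0_le_integral_nomeas => t; rewrite /= in_itv/= => tt; rewrite lee_fin.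
      by rewrite divr_ge0// ltW.
    apply: ltW; apply: hd; rewrite /ball /= ltr_norml; lra.
  apply: ge0_integral_supp_le => [t|t _]; first by rewrite lee_fin.
  by rewrite /= in_itv/= => tT; rewrite cutoff_eq0.
have p0 : 0 < eta t1 / 2 * (d / 2) by rewrite mulr_gt0// divr_gt0.
rewrite /Rintegral; case: (\int[lam]_(t in _) _)%E pos fin => [r| |] //=; rewrite !lee_fin.
by move=> pr _; exact: lt_le_trans pr.
Qed.

End Cutoff.

(* Cauchy-Schwarz in time, with Young's parameter [l] left free: optimizing it
   would need a case distinction on [X = 0]. *)
Lemma integral_young_le (R : realType) (D : set R) (g w n : R -> R) (Q X T l : R) :
  measurable D -> measurable_fun D w -> (forall t, D t -> 0 <= w t) -> 0 < Q -> 0 < l ->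
  {ae (@lebesgue_measure R), forall t, D t -> `|g t| <= Q * (w t * n t)} ->
  (\int[@lebesgue_measure R]_(t in D) (w t * (n t ^+ 2 / 2))%:E <= X%:E)%E ->
  (\int[@lebesgue_measure R]_(t in D) (w t)%:E <= T%:E)%E ->
  `|\int[@lebesgue_measure R]_(t in D) g t| <= Q * (l * X + T / (2 * l)).
Proof.
move=> mD mw w0 Q0 l0 gw wX wT; apply: le_abs_Rintegral_nomeas.
have c1 : 0 < Q * l by rewrite mulr_gt0.
have c2 : 0 < Q / (2 * l) by rewrite divr_gt0 ?mulr_gt0.
have wn0 t : D t -> (0 <= (w t * (n t ^+ 2 / 2))%:E)%E.
  by move=> Dt; rewrite lee_fin mulr_ge0 ?w0// divr_ge0// sqr_ge0.
apply: (@le_trans _ _ (\int[@lebesgue_measure R]_(t in D)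
    ((Q * l)%:E * (w t * (n t ^+ 2 / 2))%:E + (Q / (2 * l))%:E * (w t)%:E))%E).
  apply: ae_ge0_le_integral_nomeas => //.
    by move=> t Dt; rewrite adde_ge0// mule_ge0 ?wn0// lee_fin ?w0// ltW.
  apply: filterS gw => t h Dt; rewrite -!EFinM -EFinD lee_fin; apply: le_trans (h Dt) _.
  rewrite -subr_ge0 [X in 0 <= X](_ : _ = Q / (2 * l) * (w t * (l * n t - 1) ^+ 2)).
    by rewrite mulr_ge0 ?(ltW c2)// mulr_ge0 ?w0// sqr_ge0.
  by field; rewrite gt_eqF.
apply: le_trans; first apply: ge0_integralD_le_nomeas => //.
- by move=> t Dt; rewrite mule_ge0 ?wn0// lee_fin ltW.
- by move=> t Dt; rewrite mule_ge0 ?lee_fin ?w0// ltW.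
- by apply/measurable_EFinP; exact: measurable_funM.
- by move=> t Dt; rewrite -EFinM ltry.
rewrite !ge0_integralZl_nomeas//.
have -> : Q * (l * X + T / (2 * l)) = Q * l * X + Q / (2 * l) * T by field; rewrite gt_eqF.
by rewrite EFinD [(Q * l * X)%:E]EFinM [(Q / (2 * l) * T)%:E]EFinM; apply: leeD; apply: lee_wpmul2l => //; rewrite lee_fin ltW.
Qed.

Lemma weighted_sum_le (R : realType) (c i1 i2 i3 q p x y : R) : 0 <= c ->
  `|i1| <= q * y -> `|i2| <= p * y -> `|i3| <= x -> - i1 + c * i2 - i3 <= (q + c * p) * y + x.
Proof.
rewrite !ler_norml => c0 /andP[h1 _] /andP[_ h2] /andP[h3 _].
by have := ler_wpM2l c0 h2; move: h1 h3; lra.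
Qed.

(** * Lower bound on the energy *)

Section LerayHopfBounds.
Variables (R : realType) (L nu : R) (f : vfield R) (u : R -> vfield R).
Hypotheses (L_gt0 : 0 < L) (nu_gt0 : 0 < nu) (LHu : LerayHopf L nu f u).
Notation lam := (@lebesgue_measure R).
Notation n := (fun t => L2norm L (u t)).

Lemma LH_sqint_field t : 0 <= t -> sqint_field L (u t).
Proof. by move=> /(LH_H LHu)[[lu _] _]; exact: L2per_sqint_field. Qed.

(* The bound holds at every time since [|u(t)|^2 = lim (u(s), u(t))] as [s -> t]
   by weak continuity. *)
Lemma LH_bound : exists M, 0 <= M /\ forall t, 0 <= t -> n t <= M.
Proof.
have [M aeM] := LH_bounded LHu; exists M.
have M0 : 0 <= M.
  have [t /andP[t0 _] /(_ t0)] := ae_itvcc ltr01 aeM; apply: le_trans; exact: sqrtr_ge0.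
split=> // t t0; rewrite leNgt; apply/negP => Mn.
have n0 : 0 < n t by exact: le_lt_trans Mn.
have /subspace_continuousP/(_ t) := LH_weakly_continuous LHu (LH_H LHu t0).
rewrite /= in_itv/= andbT => /(_ t0) ct.
have : \forall s \near within `[0, +oo[%classic (nbhs t), M * n t < ip L (u s) (u t).
  apply: (cvgr_gt _ ct); rewrite [ltRHS](_ : _ = L2norm L (u t) * L2norm L (u t)) ?ltr_pM2r//.
  by rewrite -expr2 L2norm_sq.
rewrite near_withinE => /nbhs_ballP[d /= d0 hd].
have td : t < t + d / 2 by rewrite ltrDl divr_gt0.
have [s /andP[ts std] /(_ (le_trans t0 ts)) hs] := ae_itvcc td aeM.
have s0 := le_trans t0 ts.
have : M * n t < ip L (u s) (u t).
  apply: (hd s); last by rewrite /= in_itv/= andbT.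
  by rewrite /ball /= ltr_norml; lra.
rewrite ltNge => /negP; apply.
apply: le_trans (ler_norm _) _; apply: le_trans (ip_CS (LH_sqint_field s0) (LH_sqint_field t0)) _.
by rewrite ler_wpM2r// ltW.
Qed.

Section WeakForm.
Variables (C0 delta T CA : R) (eta : R -> R).
Hypotheses (C0_gt0 : 0 < C0) (delta_gt0 : 0 < delta) (delta_le1 : delta <= 1) (T_gt0 : 0 < T).
Hypothesis eta_cutoff : time_cutoff C0 delta T eta.
Hypothesis agmon : agmon_constant L CA.
Hypotheses (Hf : inDA L (1/2) f) (f_neq0 : ~ ae_zero L f).

Notation F := (L2norm L f).
Notation P := (L2norm L (Apow L (-(1/2)) f)).
Notation Q := (L2norm L (Apow L (-1) f)).
Notation B := (CA * F `^ (1/2) * L2norm L (Apow L (1/2) f) `^ (1/2)).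

Let Lf : L2per0 L f := Hf.1.1.

Let eta_ge0 t : 0 <= eta t.
Proof. by have /andP[] := cutoff_range eta_cutoff t. Qed.

Lemma cutoff_integral_fin : (\int[lam]_(t in `[0%R, T]) (eta t)%:E)%E \is a fin_num.
Proof.
rewrite ge0_fin_numE; last by apply: integral_ge0 => t _; rewrite lee_fin.
apply: (@le_lt_trans _ _ (\int[lam]_(t in `[0%R, T]) 1%:E)%E).
  by apply: ge0_le_integral_nomeas => t _; rewrite lee_fin//; have /andP[] := cutoff_range eta_cutoff t.
by rewrite integral_cst_itvcc ?(ltW T_gt0)// ltry.
Qed.

(** All terms are brought to the weight [eta ^ delta]: the one with [eta'] by the defining
    inequality of the cut-off, the others by [eta <= eta ^ delta]. The terms linear in [|u|] go
    through Young's inequality with the same [l]; the trilinear one is already a multiple of the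
    energy. *)
Lemma weak_form_le (h X l : R) : 0 < h -> 0 < l ->
  (\int[lam]_(t in `]0%R, +oo[) (eta (t - h) `^ delta * (n t ^+ 2 / 2))%:E <= X%:E)%E ->
  P ^+ 2 * \int[lam]_(t in `[0, T]) eta t <=
    (C0 / T * Q + nu * F) * (l * X + T / (2 * l)) + 2 * B * X.
Proof.
move=> h0 l0 wX.
have P0 : 0 < P by apply: Apow_norm_gt0 => //; apply: domA_neg => //; lra.
have Q0 : 0 < Q by apply: Apow_norm_gt0 => //; apply: domA_neg => //; lra.
have F0 : 0 < F by apply: norm_gt0.
have B0 : 0 < B.
  have H0 : 0 < L2norm L (Apow L (1/2) f) by apply: Apow_norm_gt0 => //; exact: Hf.2.
  exact: mulr_gt0 (mulr_gt0 agmon.1 (powR_gt0 _ F0)) (powR_gt0 _ H0).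
pose v := Apow L (-1) f.
have Vv : inV L v by apply: Ainv_inV => //; exact: Hf.1.2.
have sv : sqint_field L v by exact: L2per_sqint_field Vv.1.1.1.
pose I1 := \int[lam]_(t in `]0, +oo[) (derive1 (fun t => eta (t - h)) t * ip L (u t) v).
pose I2 := \int[lam]_(t in `]0, +oo[)
  (eta (t - h) * ip L (Apow L (1/2) (u t)) (Apow L (1/2) v)).
pose I3 := \int[lam]_(t in `]0, +oo[) (eta (t - h) * trilinear L (u t) v (u t)).
pose I4 := \int[lam]_(t in `]0, +oo[) (eta (t - h) * ip L f v).
have weq : - I1 + nu * I2 - I3 = I4.
  have tf : test_function (fun t => eta (t - h)) by apply: cutoff_test_function eta_cutoff _ h0.
  exact: (@LH_equation _ _ _ _ _ LHu v _ Vv tf).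
have I4E : I4 = P ^+ 2 * \int[lam]_(t in `[0, T]) eta t.
  rewrite /I4 ip_Ainv// /Rintegral; under eq_integral do rewrite mulrC EFinM.
  have p2 : 0 < P ^+ 2 := exprn_gt0 2 P0.
  have e0 t : `]0, +oo[%classic t -> (0%R <= (eta (t - h))%:E)%E by rewrite lee_fin.
  rewrite (ge0_integralZl_nomeas lam p2 e0).
  rewrite (integral_cutoff_shift eta_cutoff h0) fineM//; last exact: cutoff_integral_fin.
have itv0 (t : R) : `]0, +oo[%classic t -> 0 <= t by rewrite /= in_itv/= andbT => /ltW.
have mw := @measurable_cutoff_powR R C0 delta T eta eta_cutoff `]0, +oo[%classic h.
have w0 (t : R) : `]0, +oo[%classic t -> 0 <= eta (t - h) `^ delta by rewrite powR_ge0.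
have wT := integral_cutoff_powR_le delta_gt0 T_gt0 eta_cutoff h.
have b1 : `|I1| <= C0 / T * Q * (l * X + T / (2 * l)).
  apply: (integral_young_le _ mw) wX wT => //; first by rewrite !mulr_gt0 ?invr_gt0.
  apply: aeW => t Dt; rewrite derive1_cutoff_shift normrM.
  rewrite [leRHS](_ : _ = C0 / T * eta (t - h) `^ delta * (n t * Q)); last ring.
  apply: ler_pM => //; first exact: cutoff_derive eta_cutoff _.
  exact: ip_CS (LH_sqint_field (itv0 _ Dt)) sv.
have b2 : `|I2| <= F * (l * X + T / (2 * l)).
  apply: (integral_young_le _ mw) wX wT => //.
  apply: filterS (LH_L2V LHu).1 => t hV Dt; have t0 : 0 < t by move: Dt; rewrite /= in_itv/= andbT.
  rewrite ip_Ahalf_Ainv//; last exact: hV.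
  rewrite normrM ger0_norm// [leRHS](_ : _ = eta (t - h) `^ delta * (n t * F)); last ring.
  apply: ler_pM => //; first exact: cutoff_powR_ge delta_le1 eta_cutoff _.
  by apply: ip_CS; [exact: LH_sqint_field (ltW t0)|exact: L2per_sqint_field Lf.1].
have half (b w m : R) : 2 * b * (w * (m / 2)) = w * (b * m) by field.
have b3 : `|I3| <= 2 * B * X.
  apply: le_abs_Rintegral_nomeas; rewrite EFinM.
  apply: (@le_trans _ _ (\int[lam]_(t in `]0%R, +oo[)
      ((2 * B)%:E * (eta (t - h) `^ delta * (n t ^+ 2 / 2))%:E))%E).
    apply: ge0_le_integral_nomeas => // t Dt; rewrite -EFinM lee_fin normrM ger0_norm//.
    rewrite half.
    rewrite L2norm_sq; apply: ler_pM => //; first exact: cutoff_powR_ge delta_le1 eta_cutoff _.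
    by apply: trilinear_Ainv_le => //; exact: LH_sqint_field (itv0 _ Dt).
  have B2 : 0 < 2 * B := mulr_gt0 (ltr0n _ 2) B0.
  have e0 t : `]0, +oo[%classic t -> (0%R <= (eta (t - h) `^ delta * (n t ^+ 2 / 2))%:E)%E.
    by move=> Dt; rewrite lee_fin; exact: mulr_ge0 (w0 _ Dt) (divr_ge0 (sqr_ge0 _) (ler0n _ 2)).
  rewrite (ge0_integralZl_nomeas lam B2 e0).
  by apply: lee_wpmul2l wX; rewrite lee_fin; exact: ltW B2.
rewrite -I4E -weq.
exact: weighted_sum_le (ltW nu_gt0) b1 b2 b3.
Qed.

(** The Hoelder estimate on the weight and the bound [M] on the norms give an explicit error.
    Dominated convergence would require [|u(t)|^2] to be measurable. *)
Lemma shifted_energy_le (E e : R) : 0 < e ->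
  (\int[lam]_(t in `[0%R, T]) (eta t `^ delta * (n t ^+ 2 / 2))%:E <= E%:E)%E ->
  exists2 h, 0 < h &
    (\int[lam]_(t in `]0%R, +oo[) (eta (t - h) `^ delta * (n t ^+ 2 / 2))%:E <= (E + e)%:E)%E.
Proof.
move=> e0 hE; have [M [M0 nM]] := LH_bound.
pose c := M ^+ 2 / 2 * (T + 1).
have c0 : 0 <= c by rewrite !mulr_ge0 ?sqr_ge0// addr_ge0// ltW.
have [x x0 xc] : exists2 x, 0 < x & x * c <= e.
  exists (e / (c + 1)); first by rewrite divr_gt0// ltr_wpDl.
  by rewrite mulrAC ler_pdivrMr ?ltr_wpDl// ler_pM2l// lerDl.
(* The second entry solves [(C0 / T * h) ^ delta = x]; the first keeps the shifted support inside
   [[0, T + 1]], whose length enters [c]. *)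
pose h := Num.min 1 (T / C0 * x `^ delta^-1).
have h0 : 0 < h by rewrite lt_min ltr01 !mulr_gt0 ?invr_gt0 ?powR_gt0.
have h1 : h <= 1 by rewrite ge_min lexx.
have hx : (C0 / T * h) `^ delta <= x.
  rewrite -[leRHS]powRr1 ?(ltW x0)// -(mulVf (lt0r_neq0 delta_gt0)) powRrM.
  rewrite ge0_ler_powR ?nnegrE ?powR_ge0 ?(ltW delta_gt0)//; first by rewrite !mulr_ge0 ?invr_ge0 ?ltW.
  rewrite -ler_pdivlMl ?divr_gt0// invf_div.
  by rewrite ge_min lexx orbT.
exists h => //.
have wn0 s t : 0 <= eta s `^ delta * (n t ^+ 2 / 2).
  by rewrite mulr_ge0 ?powR_ge0// divr_ge0// sqr_ge0.
have eta0 := cutoff_eq0 eta_cutoff.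
apply: (@le_trans _ _ (\int[lam]_(t in `[0%R, (T + 1)%R]) (eta (t - h) `^ delta * (n t ^+ 2 / 2))%:E)%E).
  apply: ge0_integral_supp_le => [t|t]; first by rewrite lee_fin.
  rewrite /= !in_itv/= andbT => t0 tT; rewrite eta0 ?powR0 ?mul0r ?gt_eqF// => /andP[_ th].
  by apply: tT; rewrite ltW//=; lra.
apply: (@le_trans _ _ (\int[lam]_(t in `[0%R, (T + 1)%R])
    ((eta t `^ delta * (n t ^+ 2 / 2))%:E + (x * (M ^+ 2 / 2))%:E))%E).
  apply: ge0_le_integral_nomeas => t; rewrite /= in_itv/= => /andP[t0 _]; rewrite ?lee_fin//.
  have := cutoff_powR_shift C0_gt0 delta_gt0 delta_le1 T_gt0 eta_cutoff t (ltW h0).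
  have n2 : n t ^+ 2 / 2 <= M ^+ 2 / 2.
    by rewrite ler_pM2r ?invr_gt0// ler_pXn2r ?nnegrE ?sqrtr_ge0//; exact: nM.
  have n20 : 0 <= n t ^+ 2 / 2 by rewrite divr_ge0// sqr_ge0.
  move=> hs; apply: (@le_trans _ _ ((eta t `^ delta + x) * (n t ^+ 2 / 2))).
    by rewrite ler_wpM2r//; move: hs hx; lra.
  by rewrite mulrDl lerD2l ler_wpM2l// ltW.
apply: le_trans; first apply: ge0_integralD_le_nomeas => //.
- by move=> t _; rewrite lee_fin.
- by move=> t _; rewrite lee_fin mulr_ge0 ?(ltW x0)// divr_ge0// sqr_ge0.
- by move=> t _; rewrite ltry.
rewrite EFinD integral_cst_itvcc; last by rewrite addr_ge0// ltW.
apply: leeD; last by rewrite lee_fin subr0 -mulrA.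
apply: le_trans hE; apply: ge0_integral_supp_le => [t|t _]; first by rewrite lee_fin.
by rewrite /= in_itv/= => tT; rewrite eta0 ?powR0 ?mul0r ?gt_eqF.
Qed.

(** The bound of [weak_form_le] is affine in the shifted energy with slope [a >= 0], so an error
    [e / (a + 1)] in that energy costs at most [e]. *)
Lemma energy_lower_le (E l : R) : 0 < l ->
  (\int[lam]_(t in `[0%R, T]) (eta t `^ delta * (n t ^+ 2 / 2))%:E <= E%:E)%E ->
  P ^+ 2 * \int[lam]_(t in `[0, T]) eta t <=
    (C0 / T * Q + nu * F) * (l * E + T / (2 * l)) + 2 * B * E.
Proof.
move=> l0 hE; pose a := (C0 / T * Q + nu * F) * l + 2 * B.
have a0 : 0 <= a.
  rewrite addr_ge0 ?mulr_ge0 ?addr_ge0 ?mulr_ge0 ?powR_ge0 ?invr_ge0 ?sqrtr_ge0 ?(ltW l0) ?(ltW C0_gt0)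
    ?(ltW T_gt0) ?(ltW nu_gt0) ?(ltW agmon.1)//.
apply/ler_addgt0Pr => e e0.
have e1 : 0 < e / (a + 1) by rewrite divr_gt0// ltr_wpDl.
have [h h0 hX] := shifted_energy_le e1 hE.
apply: le_trans (weak_form_le h0 l0 hX) _.
have : a * (e / (a + 1)) <= e by rewrite mulrCA ger_pMr// ler_pdivrMr ?ltr_wpDl// mul1r lerDl.
have lin (A B' x d m y : R) : A * (m * (x + d) + y) + B' * (x + d) = A * (m * x + y) + B' * x + (A * m + B') * d.
  by ring.
by rewrite lin lerD2l.
Qed.

End WeakForm.
End LerayHopfBounds.

(** * Upper bound on the energy input *)

Section EnergyInput.
Variables (R : realType) (L nu : R) (f : vfield R) (u : R -> vfield R).
Variables (C0 delta T N : R) (eta : R -> R).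
Hypotheses (LHu : LerayHopf L nu f u) (Lf : L2per0 L f) (F_gt0 : 0 < L2norm L f).
Hypotheses (C0_gt0 : 0 < C0) (delta_gt0 : 0 < delta) (delta_le1 : delta <= 1) (T_gt0 : 0 < T).
Hypothesis eta_cutoff : time_cutoff C0 delta T eta.
Hypothesis uN : forall t, 0 <= t <= T -> L2norm L (u t) <= N.
Notation lam := (@lebesgue_measure R).
Notation n := (fun t => L2norm L (u t)).
Notation E := (\int[lam]_(t in `[0, T]) (eta t `^ delta * (n t ^+ 2 / 2))).

Let wn_ge0 t : 0 <= eta t `^ delta * (n t ^+ 2 / 2).
Proof. exact: mulr_ge0 (powR_ge0 _ _) (divr_ge0 (sqr_ge0 _) (ler0n _ 2)). Qed.

Let energy_le : (\int[lam]_(t in `[0%R, T]) (eta t `^ delta * (n t ^+ 2 / 2))%:E <= (T * (N ^+ 2 / 2))%:E)%E.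
Proof.
apply: (@le_trans _ _ (\int[lam]_(t in `[0%R, T]) (N ^+ 2 / 2)%:E)%E).
  apply: ge0_le_integral_nomeas => t; rewrite ?lee_fin// /= in_itv/= => tT.
  have n2 : n t ^+ 2 / 2 <= N ^+ 2 / 2.
    rewrite ler_pM2r ?invr_gt0// ler_pXn2r ?nnegrE ?sqrtr_ge0 ?uN//.
    by apply: le_trans (uN tT); exact: sqrtr_ge0.
  apply: le_trans n2; apply: ler_piMl.
    exact: divr_ge0 (sqr_ge0 _) (ler0n _ 2).
  exact: cutoff_powR_le1 delta_gt0 eta_cutoff _.
by rewrite integral_cst_itvcc ?(ltW T_gt0)// subr0 mulrC.
Qed.

Lemma energy_integralE :
  (\int[lam]_(t in `[0%R, T]) (eta t `^ delta * (n t ^+ 2 / 2))%:E = E%:E)%E.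
Proof.
rewrite /Rintegral fineK// ge0_fin_numE; last by apply: integral_ge0 => t _; rewrite lee_fin.
exact: le_lt_trans energy_le (ltry _).
Qed.

Lemma energy_integral_le : E <= T * (N ^+ 2 / 2).
Proof. by rewrite -lee_fin -energy_integralE. Qed.

Lemma cutoff_derive_energy_le :
  `|\int[lam]_(t in `[0, T]) (derive1 eta t * (n t ^+ 2 / 2))| <= C0 / T * E.
Proof.
have CT : 0 < C0 / T := divr_gt0 C0_gt0 T_gt0.
apply: le_abs_Rintegral_nomeas; rewrite EFinM -energy_integralE.
rewrite -(ge0_integralZl_nomeas lam CT); last by move=> t _; rewrite lee_fin.
apply: ge0_le_integral_nomeas => // t _; rewrite -EFinM lee_fin normrM [leRHS]mulrA.
rewrite [X in _ * X <= _]ger0_norm; last exact: divr_ge0 (sqr_ge0 _) (ler0n _ 2).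
apply: ler_wpM2r; first exact: divr_ge0 (sqr_ge0 _) (ler0n _ 2).
exact: cutoff_derive eta_cutoff _.
Qed.

Lemma cutoff_work_le l : 0 < l ->
  `|\int[lam]_(t in `[0, T]) (eta t * ip L f (u t))| <= L2norm L f * (l * E + T / (2 * l)).
Proof.
move=> l0.
have mw : measurable_fun (`[0, T] : set R) (fun t => eta t `^ delta).
  have := @measurable_cutoff_powR R C0 delta T eta eta_cutoff `[0, T]%classic 0.
  rewrite (_ : (fun t : R => eta (t - 0) `^ delta) = (fun t => eta t `^ delta))//.
  by apply/funext => t; rewrite subr0.
apply: (@integral_young_le _ _ _ _ n _ _ _ _ _ mw) => //; last 2 first.
- by rewrite energy_integralE.
- apply: (@le_trans _ _ (\int[lam]_(t in `[0%R, T]) 1%:E)%E).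
    apply: ge0_le_integral_nomeas => t _; rewrite lee_fin ?powR_ge0//.
    exact: cutoff_powR_le1 delta_gt0 eta_cutoff _.
  by rewrite integral_cst_itvcc ?(ltW T_gt0)// mul1r subr0.
- by move=> t _; exact: powR_ge0.
apply: aeW => t; rewrite /= in_itv/= => /andP[t0 _].
rewrite normrM ger0_norm; last by have /andP[] := cutoff_range eta_cutoff t.
rewrite [leRHS](_ : _ = eta t `^ delta * (L2norm L f * n t)); last ring.
apply: ler_pM => //; first by have /andP[] := cutoff_range eta_cutoff t.
  exact: cutoff_powR_ge delta_le1 eta_cutoff _.
by apply: ip_CS; [exact: L2per_sqint_field Lf.1|exact: LH_sqint_field LHu _ t0].
Qed.

End EnergyInput.

(** * Combining the estimates *)

Section Algebra.
Variable R : realType.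
Implicit Types (x s t : R).

Lemma powR_expn x s t k : t = s * k%:R -> x `^ t = (x `^ s) ^+ k.
Proof. by move=> ->; rewrite powRrM powR_mulrn ?powR_ge0. Qed.

(* The choice [l = 2 G T / p] makes [G T / (2 l) = p / 4]. *)
Lemma energy_lower_alg (p B G E T : R) : 0 < p -> 0 < B -> 0 < G -> 0 < T ->
  2 * G ^+ 2 * T <= p * B -> (forall l, 0 < l -> p <= G * (l * E + T / (2 * l)) + 2 * B * E) ->
  0 <= E -> p / (4 * B) <= E.
Proof.
move=> p0 B0 G0 T0 GB h E0.
have l0 : 0 < 2 * G * T / p by rewrite divr_gt0 ?mulr_gt0.
have := h _ l0.
have -> : G * (2 * G * T / p * E + T / (2 * (2 * G * T / p))) = 2 * G ^+ 2 * T / p * E + p / 4.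
  by field; rewrite !gt_eqF.
have : 2 * G ^+ 2 * T / p <= B by rewrite ler_pdivrMr// [B * p]mulrC.
move=> /(ler_wpM2r E0) h1 h2; rewrite ler_pdivrMr ?mulr_gt0//; lra.
Qed.

(** Here [r] is the square root of [e0] and [k] is [R0^(3/2)]. Both parts of the energy input are
    bounded by the same quantity [sqrt 2 * F * r * T * k], which produces the constant
    [2 sqrt 2]. *)
Lemma dissipation_upper_alg (F k N C0 T r eps J1 J2 : R) :
  0 < F -> 0 < k -> 0 < C0 -> 0 < T -> 0 < r ->
  eps = T^-1 * (k ^+ 2)^-1 * J1 + T^-1 * (k ^+ 2)^-1 * J2 ->
  `|J1| <= C0 / T * (r ^+ 2 * T * k ^+ 2) ->
  (forall l, 0 < l -> `|J2| <= F * (l * (r ^+ 2 * T * k ^+ 2) + T / (2 * l))) ->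
  r ^+ 2 * T * k ^+ 2 <= T * (N ^+ 2 / 2) -> 0 <= N -> C0 * N <= 2 * F * T ->
  eps <= 2 * Num.sqrt 2 * (F / k) * r.
Proof.
move=> F0 k0 C00 T0 r0 -> hJ1 hJ2 hN N0 CN.
have s0 : 0 < Num.sqrt 2 :> R by rewrite sqrtr_gt0.
have s2 : Num.sqrt 2 ^+ 2 = 2 :> R by rewrite sqr_sqrtr.
move: (Num.sqrt 2 : R) s0 s2 => s s0 s2.
have rkN : s * (r * k) <= N.
  rewrite -(@ler_pXn2r _ 2) ?nnegrE ?mulr_ge0 ?(ltW s0) ?(ltW r0) ?(ltW k0)//.
  rewrite exprMn s2 exprMn; have : T * (r ^+ 2 * k ^+ 2) <= T * (N ^+ 2 / 2) by move: hN; lra.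
  by rewrite ler_pM2l//; lra.
(* This is the minimizer of [l * E + T / (2 * l)] for [E = r^2 * T * k^2]; the minimum is
   [s * r * T * k]. *)
have l0 : 0 < (s * (r * k))^-1 by rewrite invr_gt0 !mulr_gt0.
have h2 : J2 <= F * (s * r * T * k).
  apply: le_trans (ler_norm _) _; apply: le_trans (hJ2 _ l0) _.
  rewrite [leLHS](_ : _ = F * (r * T * k) * (1 / s + s / 2)); last by field; rewrite !gt_eqF.
  rewrite (_ : 1 / s = s / 2); last by apply: (mulIf (lt0r_neq0 s0)); rewrite divfK ?gt_eqF// mulrAC -expr2 s2 divff.
  by rewrite le_eqVlt; apply/orP; left; apply/eqP; field.
have h1 : J1 <= F * (s * r * T * k).
  apply: le_trans (ler_norm _) _; apply: le_trans hJ1 _.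
  rewrite [leLHS](_ : _ = (C0 * (r * k)) * (r * k)); last by field; rewrite gt_eqF.
  rewrite [leRHS](_ : _ = (s * F * T) * (r * k)); last ring.
  rewrite ler_pM2r ?mulr_gt0// -(ler_pM2l s0).
  rewrite mulrCA; apply: le_trans (ler_wpM2l (ltW C00) rkN) _.
  by have -> : s * (s * F * T) = 2 * F * T by rewrite -s2; ring.
have c0 : 0 < T^-1 * (k ^+ 2)^-1 by rewrite mulr_gt0 ?invr_gt0 ?exprn_gt0.
apply: (@le_trans _ _ (T^-1 * (k ^+ 2)^-1 * (2 * (F * (s * r * T * k))))).
  by rewrite -mulrDr ler_pM2l//; lra.
by rewrite le_eqVlt; apply/orP; left; apply/eqP; field; rewrite !gt_eqF.
Qed.

(** The variables stand for [K^(1/2)], [theta_f^(1/2)], [|f|^(1/2)], [R0^(1/4)], [e0^(1/2)],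
    [8^(1/4)] and [eps0]; with these roots all fractional exponents become integers. Comparing the
    lower bound of order [r^3] with the upper bound of order [r] bounds [r] from above. *)
Lemma scaling_alg (ka ta ph b r m e : R) :
  0 < ka -> 0 < ta -> 0 < ph -> 0 < b -> 0 < r -> 0 < m ->
  e <= m ^+ 2 * (ph ^+ 2 / b ^+ 6) * r ->
  ta * (ph / b) <= r ->
  ka ^+ 2 * (r ^+ 3 / b ^+ 4) <= e -> e <= m ^+ 2 / ta ^+ 2 * (r ^+ 3 / b ^+ 4) ->
  [/\ ka ^+ 3 * ta ^+ 3 / m * (ph ^+ 2 / b ^+ 6) * r <= e,
      r <= m / ka * (ph / b),
      ka ^+ 2 * ta ^+ 3 * (ph ^+ 3 / b ^+ 7) <= e &
      e <= m ^+ 5 / (ka ^+ 3 * ta ^+ 2) * (ph ^+ 3 / b ^+ 7)].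
Proof.
move=> ka0 ta0 ph0 b0 r0 m0 eU rL eL eU'.
have pb0 : 0 < ph / b by rewrite divr_gt0.
have tpb0 : 0 < ta * (ph / b) by rewrite mulr_gt0.
have mpb0 : 0 < m / ka * (ph / b) by rewrite mulr_gt0// divr_gt0.
have kr0 : 0 < ka * r by rewrite mulr_gt0.
have mp0 : 0 < m * (ph / b) by rewrite mulr_gt0.
have kr : ka * r <= m * (ph / b).
  rewrite -(@ler_pXn2r _ 2) ?nnegrE ?(ltW kr0) ?(ltW mp0)//.
  have := le_trans eL eU.
  rewrite [leLHS](_ : _ = (ka * r) ^+ 2 * (r / b ^+ 4)); last by field; rewrite gt_eqF.
  rewrite [leRHS](_ : _ = (m * (ph / b)) ^+ 2 * (r / b ^+ 4)); last by field; rewrite gt_eqF.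
  by rewrite ler_pM2r// divr_gt0// exprn_gt0.
have rU : r <= m / ka * (ph / b).
  by rewrite mulrAC ler_pdivlMr// mulrC.
(* The lower and upper bounds on [r] are compatible only if this holds; it accounts for the factor
   [ka * ta / m] in the first estimate. *)
have kt : ka * ta <= m.
  rewrite -(@ler_pM2r _ (ph / b)) ?divr_gt0//; apply: le_trans kr.
  by rewrite -mulrA ler_pM2l.
have r2 : ta ^+ 2 * (ph / b) ^+ 2 <= r ^+ 2.
  by rewrite -exprMn lerXn2r ?nnegrE ?(ltW tpb0) ?(ltW r0).
have r3 : (ta * (ph / b)) ^+ 3 <= r ^+ 3.
  by rewrite lerXn2r ?nnegrE ?(ltW tpb0) ?(ltW r0).
split=> //.
- apply: le_trans eL.
  apply: (@le_trans _ _ (ka ^+ 2 * (r / b ^+ 4) * (ta ^+ 2 * (ph / b) ^+ 2))); last first.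
    rewrite [leRHS](_ : _ = ka ^+ 2 * (r / b ^+ 4) * r ^+ 2); last by field; rewrite gt_eqF.
    by rewrite ler_pM2l// mulr_gt0 ?divr_gt0 ?exprn_gt0.
  rewrite [leLHS](_ : _ = ka ^+ 2 * ta ^+ 2 * (ph ^+ 2 / b ^+ 6) * r * (ka * ta / m)); last by field; rewrite !gt_eqF.
  rewrite [leRHS](_ : _ = ka ^+ 2 * ta ^+ 2 * (ph ^+ 2 / b ^+ 6) * r * 1); last by field; rewrite !gt_eqF.
  rewrite ler_pM2l; last by rewrite !mulr_gt0 ?invr_gt0 ?exprn_gt0.
  by rewrite ler_pdivrMr// mul1r.
- apply: le_trans eL.
  rewrite [leLHS](_ : _ = ka ^+ 2 / b ^+ 4 * (ta * (ph / b)) ^+ 3); last by field; rewrite gt_eqF.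
  rewrite [leRHS](_ : _ = ka ^+ 2 / b ^+ 4 * r ^+ 3); last by field; rewrite gt_eqF.
  by rewrite ler_pM2l// divr_gt0 ?exprn_gt0.
apply: le_trans eU' _.
have r3' : r ^+ 3 <= (m / ka * (ph / b)) ^+ 3.
  by rewrite lerXn2r ?nnegrE ?(ltW mpb0) ?(ltW r0).
rewrite [leLHS](_ : _ = m ^+ 2 / ta ^+ 2 / b ^+ 4 * r ^+ 3); last by field; rewrite !gt_eqF.
rewrite [leRHS](_ : _ = m ^+ 2 / ta ^+ 2 / b ^+ 4 * (m / ka * (ph / b)) ^+ 3); last by field; rewrite !gt_eqF.
by rewrite ler_pM2l// !divr_gt0 ?exprn_gt0.
Qed.

End Algebra.

(** Pure real arithmetic: [P], [Q], [H] are the norms of [A^(-1/2) f], [A^-1 f], [A^(1/2) f], [I]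
    and [E] the integrals of the cut-off and of the weighted energy, [J1] and [J2] the two parts of
    the input, [N] the attractor bound. *)
Lemma bounds_alg (R : realType) (nu R0 T C0 CA K F P Q H I E eps J1 J2 N : R) :
  let c_eta := T^-1 * I in
  let gamma := C0 / (nu * T) * (Q / F) + 1 in
  let sigma := 2 * gamma ^+ 2 * nu ^+ 2 / (c_eta * CA) * (F `^ (1/2) / H `^ (1/2)) * (F ^+ 2 / P ^+ 2) in
  let theta := c_eta / (4 * CA) * (R0 `^ (5/2))^-1 * (P ^+ 2 / (F `^ (3/2) * H `^ (1/2))) in
  let e0 := T^-1 * (R0 ^+ 3)^-1 * E in
  0 < nu -> 0 < R0 -> 0 < T -> 0 < C0 -> 0 < CA -> 0 < K -> 0 < F -> 0 < P -> 0 < Q -> 0 < H ->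
  0 < I -> 0 <= E ->
  (forall l, 0 < l -> P ^+ 2 * I <= (C0 / T * Q + nu * F) * (l * E + T / (2 * l))
    + 2 * (CA * F `^ (1/2) * H `^ (1/2)) * E) ->
  eps = T^-1 * (R0 ^+ 3)^-1 * J1 + T^-1 * (R0 ^+ 3)^-1 * J2 ->
  `|J1| <= C0 / T * E -> (forall l, 0 < l -> `|J2| <= F * (l * E + T / (2 * l))) ->
  E <= T * (N ^+ 2 / 2) -> N = F / (nu * (2 * pi / (4 * R0)) ^+ 2) ->
  sigma <= F -> 2 * C0 / pi ^+ 2 * (R0 ^+ 2 / nu) <= T ->
  K * (e0 `^ (3/2) / R0) <= eps ->
  eps <= 2 * Num.sqrt 2 / theta * (e0 `^ (3/2) / R0) ->
  [/\ K `^ (3/2) * theta `^ (3/2) / 8 `^ (1/4) * (F / R0 `^ (3/2)) * e0 `^ (1/2) <= eps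
      /\ eps <= 2 * Num.sqrt 2 * (F / R0 `^ (3/2)) * e0 `^ (1/2),
      theta * (F / R0 `^ (1/2)) <= e0 /\ e0 <= 2 * Num.sqrt 2 / K * (F / R0 `^ (1/2)) &
      K * theta `^ (3/2) * (F `^ (3/2) / R0 `^ (7/4)) <= eps
      /\ eps <= 8 `^ (5/4) / (K `^ (3/2) * theta) * (F `^ (3/2) / R0 `^ (7/4))].
Proof.
move=> c_eta gamma sigma theta e0 nu0 R00 T0 C00 CA0 K0 F0 P0 Q0 H0 I0 E0 hlow epsE hJ1 hJ2 hN NE sF cT epsL epsU.
have half (x : R) : 0 < x -> x = (x `^ (1/2)) ^+ 2.
  by move=> x0; rewrite -(@powR_expn _ _ _ 1) ?powRr1 ?(ltW x0)//; field.
have threehalves (x : R) : x `^ (3/2) = (x `^ (1/2)) ^+ 3 by apply: powR_expn; field.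
have R0E : R0 = (R0 `^ (1/4)) ^+ 4.
  by rewrite -(@powR_expn _ _ _ 1) ?powRr1 ?(ltW R00)//; field.
have R12 : R0 `^ (1/2) = (R0 `^ (1/4)) ^+ 2 by apply: powR_expn; field.
have R32 : R0 `^ (3/2) = (R0 `^ (1/4)) ^+ 6 by apply: powR_expn; field.
have R52 : R0 `^ (5/2) = (R0 `^ (1/4)) ^+ 10 by apply: powR_expn; field.
have R74 : R0 `^ (7/4) = (R0 `^ (1/4)) ^+ 7 by apply: powR_expn; field.
have m4 : (8 : R) = (8 `^ (1/4)) ^+ 4.
  by rewrite -(@powR_expn _ _ _ 1) ?powRr1//; field.
have m54 : (8 : R) `^ (5/4) = (8 `^ (1/4)) ^+ 5 by apply: powR_expn; field.
have m0 : (0 : R) < 8 `^ (1/4) by rewrite powR_gt0.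
have m2 : 2 * Num.sqrt 2 = (8 `^ (1/4)) ^+ 2 :> R.
  apply/eqP; rewrite -(@eqrXn2 _ 2) ?mulr_ge0 ?sqrtr_ge0 ?exprn_ge0 ?(ltW m0)//.
  by rewrite -exprM -m4 exprMn sqr_sqrtr//; apply/eqP; ring.
have b0 : 0 < R0 `^ (1/4) by rewrite powR_gt0.
have ph0 : 0 < F `^ (1/2) by rewrite powR_gt0.
have h0 : 0 < H `^ (1/2) by rewrite powR_gt0.
have FE := half _ F0.
have B0 : 0 < CA * F `^ (1/2) * H `^ (1/2) by rewrite !mulr_gt0.
have G0 : 0 < C0 / T * Q + nu * F by rewrite addr_gt0 ?mulr_gt0 ?invr_gt0.
(* This is [sigma <= F] with denominators cleared, since [gamma] is the linear coefficient
   [C0 / T * Q + nu * F] divided by [nu * F]. *)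
have GB : 2 * (C0 / T * Q + nu * F) ^+ 2 * T <= P ^+ 2 * I * (CA * F `^ (1/2) * H `^ (1/2)).
  have gE : gamma = (C0 / T * Q + nu * F) / (nu * F) by rewrite /gamma; field; rewrite !gt_eqF.
  move: sF; rewrite /sigma gE /c_eta; move: (C0 / T * Q + nu * F) => G.
  rewrite [X in X <= _](_ : _ = 2 * G ^+ 2 * T * F `^ (1/2) / (P ^+ 2 * I * CA * H `^ (1/2))); last first.
    by field; rewrite !gt_eqF.
  rewrite ler_pdivrMr ?mulr_gt0 ?exprn_gt0//.
  rewrite [leRHS](_ : _ = P ^+ 2 * I * (CA * F `^ (1/2) * H `^ (1/2)) * F `^ (1/2)); last first.
    by rewrite {1}FE; ring.
  by rewrite ler_pM2r.
have p0 : 0 < P ^+ 2 * I by rewrite mulr_gt0// exprn_gt0.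
have Elow := energy_lower_alg p0 B0 G0 T0 GB hlow E0.
have th0 : 0 < theta.
  by rewrite /theta /c_eta !(mulr_gt0, divr_gt0, invr_gt0, exprn_gt0, powR_gt0).
(* [theta] is the lower bound [P^2 * I / (4 * B)] on the weighted energy, [B] being the Agmon
   factor, normalized by [T * R0^3] and measured in units of [F / R0^(1/2)]. *)
have elow : theta * (F / R0 `^ (1/2)) <= e0.
  rewrite (_ : theta * _ = T^-1 * (R0 ^+ 3)^-1 * (P ^+ 2 * I / (4 * (CA * F `^ (1/2) * H `^ (1/2))))).
    by rewrite /e0 ler_pM2l// mulr_gt0 ?invr_gt0 ?exprn_gt0.
  rewrite /theta /c_eta R12 R52 threehalves {2}FE [in RHS]R0E.
  by field; rewrite !gt_eqF.
have e0p : 0 < e0 by apply: lt_le_trans elow; rewrite mulr_gt0 ?divr_gt0 ?powR_gt0.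
have r0 : 0 < e0 `^ (1/2) by rewrite powR_gt0.
have ka0 : 0 < K `^ (1/2) by rewrite powR_gt0.
have ta0 : 0 < theta `^ (1/2) by rewrite powR_gt0.
have eE := half _ e0p; have KE := half _ K0; have tE := half _ th0.
have EE : E = e0 `^ (1/2) ^+ 2 * T * (R0 `^ (1/4) ^+ 6) ^+ 2.
  rewrite -eE /e0 -exprM (exprM _ 4 3) -R0E; field; rewrite !gt_eqF//.
have R03 : R0 ^+ 3 = (R0 `^ (1/4) ^+ 6) ^+ 2 by rewrite {1}R0E -!exprM.
have N0 : 0 <= N by rewrite NE; exact: divr_ge0 (ltW F0) (mulr_ge0 (ltW nu0) (sqr_ge0 _)).
have pi0 : 0 < pi :> R by exact: pi_gt0.
(* With side [4 * R0] the attractor bound is [N = 4 * R0^2 * F / (nu * pi^2)], so this is precisely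
   [T >= c1 * R0^2 / nu]; the constant [c1] originates here. *)
have CN : C0 * N <= 2 * F * T.
  move: NE cT pi0; move: (pi : R) => c NE cT c0.
  rewrite NE [leLHS](_ : _ = 2 * F * (2 * C0 / c ^+ 2 * (R0 ^+ 2 / nu))); last by field; rewrite !gt_eqF.
  by rewrite ler_pM2l ?mulr_gt0.
have eU : eps <= 2 * Num.sqrt 2 * (F / R0 `^ (1/4) ^+ 6) * e0 `^ (1/2).
  apply: (@dissipation_upper_alg _ F _ N C0 T _ _ J1 J2) => //; rewrite -?EE// -?R03//.
  exact: exprn_gt0.
have rL : theta `^ (1/2) * (F `^ (1/2) / R0 `^ (1/4)) <= e0 `^ (1/2).
  rewrite -(@ler_pXn2r _ 2) ?nnegrE ?(ltW r0)//; last by rewrite ltW// mulr_gt0// divr_gt0.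
  by rewrite -eE exprMn expr_div_n -tE -FE -R12.
have [|||s1 s2 s3 s4] := @scaling_alg _ (K `^ (1/2)) (theta `^ (1/2)) (F `^ (1/2)) (R0 `^ (1/4))
    (e0 `^ (1/2)) (8 `^ (1/4)) eps ka0 ta0 ph0 b0 r0 m0 _ rL _ _.
- by rewrite -m2 -FE.
- by rewrite -KE -threehalves -R0E.
- by rewrite -m2 -tE -threehalves -R0E.
rewrite R32 R12 R74 m54 !threehalves.
split; split.
- by rewrite -FE in s1.
- exact: eU.
- by rewrite -R12.
- rewrite {1}eE m2 {1}KE {1}FE.
  rewrite [leRHS](_ : _ = (8 `^ (1/4) / K `^ (1/2) * (F `^ (1/2) / R0 `^ (1/4))) ^+ 2); last by field; rewrite !gt_eqF.
  by rewrite lerXn2r ?nnegrE ?(ltW r0)// ltW// mulr_gt0 ?divr_gt0.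
- by rewrite -KE in s3.
- by rewrite -tE in s4.
Qed.

Theorem theorem5 (R : realType) (nu R0 T C0 delta CA : R) (eta : R -> R)
    (f : vfield R) (u : R -> vfield R) (eps_inf K : R) :
  let L := 4 * R0 in
  let normf := L2norm L f in
  let normAf (s : R) := L2norm L (Apow L s f) in
  let e0 := global_energy R0 T delta eta u in
  let eps0 := viscous_dissipation R0 T nu eta u + eps_inf in
  let c1 := 2 * C0 / pi ^+ 2 in
  let c_eta := T^-1 * \int[@lebesgue_measure R]_(t in `[0, T]) eta t in
  let gamma_f := C0 / (nu * T) * (normAf (-1) / normf) + 1 in
  let sigma_f := 2 * gamma_f ^+ 2 * nu ^+ 2 / (c_eta * CA)
                 * (normf `^ (1/2) / normAf (1/2) `^ (1/2))
                 * (normf ^+ 2 / normAf (-(1/2)) ^+ 2) in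
  let theta_f := c_eta / (4 * CA) * (R0 `^ (5/2))^-1
                 * (normAf (-(1/2)) ^+ 2
                    / (normf `^ (3/2) * normAf (1/2) `^ (1/2))) in
  0 < nu -> 0 < R0 -> 0 < T -> 0 < C0 -> 1/2 < delta < 1 ->
  time_cutoff C0 delta T eta ->
  agmon_constant L CA ->
  inDA L (1/2) f -> ~ ae_zero L f ->
  LerayHopf L nu f u ->
  (forall t, 0 <= t <= T -> weak_attractor L nu f (u t)) ->
  0 <= eps_inf -> eps0 = energy_input R0 T eta f u ->
  sigma_f <= normf ->
  c1 * (R0 ^+ 2 / nu) <= T ->
  0 < K ->
  K * (e0 `^ (3/2) / R0) <= eps0 ->
  eps0 <= 2 * Num.sqrt 2 / theta_f * (e0 `^ (3/2) / R0) ->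
  [/\ K `^ (3/2) * theta_f `^ (3/2) / 8 `^ (1/4)
        * (normf / R0 `^ (3/2)) * e0 `^ (1/2) <= eps0
      /\ eps0 <= 2 * Num.sqrt 2 * (normf / R0 `^ (3/2)) * e0 `^ (1/2),
      theta_f * (normf / R0 `^ (1/2)) <= e0
      /\ e0 <= 2 * Num.sqrt 2 / K * (normf / R0 `^ (1/2)) &
      K * theta_f `^ (3/2) * (normf `^ (3/2) / R0 `^ (7/4)) <= eps0
      /\ eps0 <= 8 `^ (5/4) / (K `^ (3/2) * theta_f)
                 * (normf `^ (3/2) / R0 `^ (7/4))].
Proof.
move=> L normf normAf e0 eps0 c1 c_eta gamma_f sigma_f theta_f nu0 R00 T0 C00 /andP[d12 d1] cut agm Hf fn0
  LHu att einf epsE sF cT K0 epsL epsU.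
have L0 : 0 < L by rewrite mulr_gt0.
have d0 : 0 < delta by move: d12; lra.
have d1' := ltW d1.
have Lf : L2per0 L f := Hf.1.1.
have F0 : 0 < normf by exact: norm_gt0.
have P0 : 0 < normAf (-(1/2)) by apply: Apow_norm_gt0 => //; apply: domA_neg => //; lra.
have Q0 : 0 < normAf (-1) by apply: Apow_norm_gt0 => //; apply: domA_neg => //; lra.
have H0 : 0 < normAf (1/2) by apply: Apow_norm_gt0 => //; exact: Hf.2.
have uN (t : R) : 0 <= t <= T -> L2norm L (u t) <= normf / (nu * (2 * pi / L) ^+ 2).
  by move=> tT; apply: weak_attractor_bound => //; exact: att.
have EE := energy_integralE d0 T0 cut uN.
apply: (@bounds_alg R nu R0 T C0 CA K normf (normAf (-(1/2))) (normAf (-1)) (normAf (1/2))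
  (\int[@lebesgue_measure R]_(t in `[0, T]) eta t)
  (\int[@lebesgue_measure R]_(t in `[0, T]) (eta t `^ delta * (L2norm L (u t) ^+ 2 / 2)))
  eps0
  (\int[@lebesgue_measure R]_(t in `[0, T]) (derive1 eta t * (L2norm L (u t) ^+ 2 / 2)))
  (\int[@lebesgue_measure R]_(t in `[0, T]) (eta t * ip L f (u t)))
  (normf / (nu * (2 * pi / L) ^+ 2))) => //.
- exact: agm.1.
- exact: integral_cutoff_gt0 T0 cut.
- apply: Rintegral_ge0 => t _; exact: mulr_ge0 (powR_ge0 _ _) (divr_ge0 (sqr_ge0 _) (ler0n _ 2)).
- move=> l l0; apply: (energy_lower_le L0 nu0 LHu C00 d0 d1' T0 cut agm Hf fn0 l0).
  by rewrite EE.
- exact: cutoff_derive_energy_le C00 d0 T0 cut uN.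
- move=> l l0; exact: cutoff_work_le LHu Lf F0 d0 d1' T0 cut uN _ l0.
- exact: energy_integral_le d0 T0 cut uN.
Qed.
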